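(* Let $h>0$, let $\Omega_0\subset\mathbb R^2$ be a bounded $C^2$ domain, let $F,H$ be $C^1$ functions of one variable (defined on the range of $\psi$), and let $c$ be a constant. Write $|\vec\xi|^2=x_1^2+x_2^2+h^2$ and $$K(x_1,x_2)=\frac1{|\vec\xi|^2}\begin{pmatrix}h^2+x_2^2&-x_1x_2\\-x_1x_2&h^2+x_1^2\end{pmatrix}.$$ Suppose that $\psi\in C^1(\overline{\Omega_0})$ solves $$\nabla\cdot(K\nabla\psi)=-\frac{2h^2F(\psi)}{|\vec\xi|^4}-\frac{F'(\psi)F(\psi)}{|\vec\xi|^2}+H'(\psi)\quad\text{in }\Omega_0$$ together with $\psi=0$ on $\partial\Omega_0$ and $$\frac1{|\vec\xi|^2}\left[(h^2+x_2^2)(\partial_{x_1}\psi)^2+(h^2+x_1^2)(\partial_{x_2}\psi)^2-2x_1x_2\,\partial_{x_1}\psi\,\partial_{x_2}\psi+F(0)^2\right]=c\quad\text{on }\partial\Omega_0 .$$ Define $u^*=0$ and $p^*=H(0)-c/2$ outside $\Omega_0$, and in $\Omega_0$ $$u^*=\frac1{|\vec\xi|^2}\begin{pmatrix}-x_1x_2\partial_{x_1}\psi+(h^2+x_1^2)\partial_{x_2}\psi+F(\psi)x_2\\-(h^2+x_2^2)\partial_{x_1}\psi+x_1x_2\partial_{x_2}\psi-F(\psi)x_1\\-hx_1\partial_{x_1}\psi-hx_2\partial_{x_2}\psi+F(\psi)h\end{pmatrix},$$ $$p^*=H(\psi)-\frac1{2|\vec\xi|^2}\left[(h^2+x_2^2)(\partial_{x_1}\psi)^2+(h^2+x_1^2)(\partial_{x_2}\psi)^2-2x_1x_2\,\partial_{x_1}\psi\,\partial_{x_2}\psi+F(\psi)^2\right].$$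 Let $u(x_1,x_2,x_3)=Q_{x_3/h}\,u^*\bigl(R_{-x_3/h}(x_1,x_2)\bigr)$ and $p(x_1,x_2,x_3)=p^*\bigl(R_{-x_3/h}(x_1,x_2)\bigr)$. Then $(u,p)$ is a weak helically symmetric solution of the stationary Euler equations in $\mathbb R^3$.
   Context: The rotations are $R_\theta=\begin{pmatrix}\cos\theta&\sin\theta\\-\sin\theta&\cos\theta\end{pmatrix}$ and $Q_\theta=\begin{pmatrix}R_\theta&0\\0&1\end{pmatrix}$. With $\bar Q_{h,\theta}(x)=Q_\theta x+(0,0,h\theta)^t$, a function $f$ is helical if $f\circ\bar Q_{h,\theta}=f$ for all $\theta$, and a vector field $u$ is helical if $u(\bar Q_{h,\theta}(x))=Q_\theta u(x)$ for all $\theta,x$; ''helically symmetric'' for $(u,p)$ means both are helical. A pair $(u,p)$ with $u\in L^2_{\rm loc}(\mathbb R^3)$ and $p\in L^1_{\rm loc}(\mathbb R^3)$ is a weak solution of the stationary Euler equations ($u\cdot\nabla u+\nabla p=0$, $\nabla\cdot u=0$) if $\int_{\mathbb R^3}[(u\otimes u)\cdot\nabla\eta+p\,\nabla\cdot\eta]\,dx=0$ and $\int_{\mathbb R^3}u\cdot\nabla\varphi\,dx=0$ for all vector fields $\eta\in C_c^\infty(\mathbb R^3)$ and all $\varphi\in C_c^\infty(\mathbb R^3)$. The equation for $\psi$ is understood in the sense of distributions. *)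

(* Defs.v *)
From HB Require Import structures.
From mathcomp Require Import all_boot all_order all_algebra.
From mathcomp Require Import all_classical all_reals all_analysis.

Set Implicit Arguments.
Unset Strict Implicit.
Unset Printing Implicit Defensive.

Import Order.TTheory GRing.Theory Num.Theory.
Import numFieldNormedType.Exports.

Local Open Scope classical_set_scope.
Local Open Scope ring_scope.

Section Smoothness.
Context {R : realType}.

(* [:: v1; ...; vk] is sent to the iterated directional derivative
   D_v1 (... (D_vk f)). *)
Definition iterD {V W : normedModType R} (vs : seq V) (f : V -> W) : V -> W :=
  foldr (fun v g x => 'D_v g x) f vs.

Definition smooth {V W : normedModType R} (f : V -> W) : Prop :=
  forall (vs : seq V) (x : V), differentiable (iterD vs f) x.

Definition tsupport {V W : normedModType R} (f : V -> W) : set V :=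
  closure [set x | f x != 0].

Definition test_function {V W : normedModType R} (U : set V) (f : V -> W) :
    Prop :=
  [/\ smooth f, compact (tsupport f) & tsupport f `<=` U].

Definition C2_line (g : R -> R) : Prop :=
  [/\ forall t, derivable g t 1, forall t, derivable (derive1 g) t 1
    & continuous (derive1n 2 g)].

(* Derivative relative to J: the limit of the difference quotients at t is taken
   along J only, so it is one-sided at an endpoint of an interval J. *)
Definition derive_in (J : set R) (f : R -> R) (t : R) : R :=
  lim ((f s - f t) / (s - t) @[s --> within J t^']).

Definition C1_in (J : set R) (f : R -> R) : Prop :=
  (forall t, J t -> cvg ((f s - f t) / (s - t) @[s --> within J t^'])) /\
  {within J, continuous (derive_in J f)}.

End Smoothness.

Section Plane.
Context {R : realType}.
Local Notation R2 := (R * R)%type.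

Definition rot2 (theta : R) (x : R2) : R2 :=
  (cos theta * x.1 + sin theta * x.2, - sin theta * x.1 + cos theta * x.2).

Definition e1 : R2 := (1, 0).
Definition e2 : R2 := (0, 1).

Definition frontier (Omega : set R2) : set R2 :=
  closure Omega `\` interior Omega.

(* Near each boundary point, after a rotation of the coordinates, Omega is the
   region strictly above the graph of a C^2 function. *)
Definition C2_boundary (Omega : set R2) : Prop :=
  forall x0, frontier Omega x0 ->
    exists (theta : R) (g : R -> R), C2_line g /\
      \forall x \near x0, Omega x <-> g (rot2 theta x).1 < (rot2 theta x).2.

Definition bounded_C2_domain (Omega : set R2) : Prop :=
  [/\ Omega !=set0, open Omega, connected Omega, bounded_set Omega
    & C2_boundary Omega].

Definition C1_closure (Omega : set R2) (psi : R2 -> R) : Prop :=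
  [/\ {within closure Omega, continuous psi},
      forall x, Omega x -> differentiable psi x
    & forall v, exists g : R2 -> R,
        {within closure Omega, continuous g} /\
        forall x, Omega x -> 'D_v psi x = g x].

Definition grad (psi : R2 -> R) (x : R2) : R2 :=
  ('D_e1 psi x, 'D_e2 psi x).

(* Value at x of the continuous extension of the gradient from Omega to its
   closure; psi carries no information outside the closure, so 'D_v psi cannot
   be used at a boundary point. *)
Definition grad_closure (Omega : set R2) (psi : R2 -> R) (x : R2) :
    R2 :=
  (lim ('D_e1 psi y @[y --> within Omega (nbhs x)]),
   lim ('D_e2 psi y @[y --> within Omega (nbhs x)])).

Definition mu2 := (@lebesgue_measure R \x @lebesgue_measure R)%E.

Definition dot2 (v w : R2) : R := v.1 * w.1 + v.2 * w.2.

(* div A = f in the sense of distributions on Omega. *)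
Definition distributional_div (Omega : set R2) (A : R2 -> R2)
    (f : R2 -> R) : Prop :=
  forall phi : R2 -> R, test_function Omega phi ->
    - (\int[mu2]_(x in Omega) dot2 (A x) (grad phi x)) =
    \int[mu2]_(x in Omega) (f x * phi x).

End Plane.

Section Space.
Context {R : realType}.
Local Notation R3 := (R * R * R)%type.

Definition basis3 (i : 'I_3) : R3 :=
  ((i == 0 :> nat)%:R, (i == 1 :> nat)%:R, (i == 2 :> nat)%:R).

Definition coord3 (i : 'I_3) (x : R3) : R :=
  match val i with 0 => x.1.1 | 1 => x.1.2 | _ => x.2 end.

Definition rot3 (theta : R) (x : R3) : R3 := (rot2 theta x.1, x.2).

Definition screw (h theta : R) (x : R3) : R3 :=
  rot3 theta x + (0, 0, h * theta).

Definition helical_function (h : R) (f : R3 -> R) : Prop :=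
  forall theta x, f (screw h theta x) = f x.

Definition helical_field (h : R) (u : R3 -> R3) : Prop :=
  forall theta x, u (screw h theta x) = rot3 theta (u x).

Definition mu3 :=
  ((@lebesgue_measure R \x @lebesgue_measure R) \x @lebesgue_measure R)%E.

Definition L1loc (f : R3 -> R) : Prop :=
  measurable_fun setT f /\
  forall C : set R3, compact C -> mu3.-integrable C (EFin \o f).

Definition L2loc (u : R3 -> R3) : Prop :=
  forall i : 'I_3, measurable_fun setT (coord3 i \o u) /\
  forall C : set R3, compact C ->
    mu3.-integrable C (fun x => (coord3 i (u x) ^+ 2)%:E).

Definition weak_Euler (u : R3 -> R3) (p : R3 -> R) : Prop :=
  [/\ L2loc u, L1loc p,
      forall eta : R3 -> R3, test_function setT eta ->
        \int[mu3]_x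
          (\sum_(i < 3) \sum_(j < 3)
             coord3 i (u x) * coord3 j (u x) * 'D_(basis3 i) (coord3 j \o eta) x
           + p x * \sum_(i < 3) 'D_(basis3 i) (coord3 i \o eta) x) = 0
    & forall phi : R3 -> R, test_function setT phi ->
        \int[mu3]_x (\sum_(i < 3) coord3 i (u x) * 'D_(basis3 i) phi x) = 0].

End Space.

Section HelicalReduction.
Context {R : realType} (h : R).
Local Notation R2 := (R * R)%type.
Local Notation R3 := (R * R * R)%type.

Definition xi2 (x : R2) : R := x.1 ^+ 2 + x.2 ^+ 2 + h ^+ 2.

(* The matrix K(x) applied to the vector v. *)
Definition Kmul (x v : R2) : R2 :=
  ((xi2 x)^-1 * ((h ^+ 2 + x.2 ^+ 2) * v.1 - x.1 * x.2 * v.2),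
   (xi2 x)^-1 * (- (x.1 * x.2) * v.1 + (h ^+ 2 + x.1 ^+ 2) * v.2)).

(* The squared Euclidean norm of velocity x v f below. *)
Definition speed2 (x v : R2) (f : R) : R :=
  (xi2 x)^-1 * ((h ^+ 2 + x.2 ^+ 2) * v.1 ^+ 2 + (h ^+ 2 + x.1 ^+ 2) * v.2 ^+ 2
                - 2 * x.1 * x.2 * v.1 * v.2 + f ^+ 2).

Definition velocity (x v : R2) (f : R) : R3 :=
  ((xi2 x)^-1 * (- (x.1 * x.2 * v.1) + (h ^+ 2 + x.1 ^+ 2) * v.2 + f * x.2),
   (xi2 x)^-1 * (- ((h ^+ 2 + x.2 ^+ 2) * v.1) + x.1 * x.2 * v.2 - f * x.1),
   (xi2 x)^-1 * (- (h * x.1 * v.1) - h * x.2 * v.2 + f * h)).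

Definition ustar (Omega : set R2) (F : R -> R) (psi : R2 -> R)
    (x : R2) : R3 :=
  if x \in Omega then velocity x (grad psi x) (F (psi x)) else 0.

Definition pstar (Omega : set R2) (F H : R -> R) (c : R)
    (psi : R2 -> R) (x : R2) : R :=
  if x \in Omega then H (psi x) - speed2 x (grad psi x) (F (psi x)) / 2
  else H 0 - c / 2.

Definition helical_u (us : R2 -> R3) (x : R3) : R3 :=
  rot3 (x.2 / h) (us (rot2 (- x.2 / h) x.1)).

Definition helical_p (ps : R2 -> R) (x : R3) : R :=
  ps (rot2 (- x.2 / h) x.1).

End HelicalReduction.

(* Main.v *)
Require Import Defs.
From HB Require Import structures.
From mathcomp Require Import all_boot all_order all_algebra.
From mathcomp Require Import all_classical all_reals all_analysis.
From mathcomp Require Import measurable_realfun ring lra.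

Set Implicit Arguments.
Unset Strict Implicit.
Unset Printing Implicit Defensive.

Import Order.TTheory GRing.Theory Num.Theory.
Import numFieldNormedType.Exports.

Local Open Scope classical_set_scope.
Local Open Scope ring_scope.

(* In the helical frame [(y, z) -> (R_{z/h} y, z)], which preserves volume, the fields
   [u] and [p] depend on [y] only. Hence the [z]-derivatives of the test field integrate to
   zero, and it remains to prove, for planar tests [a] and with [w = (psi_2, - psi_1)],
   [m = u*_3 / h] and [q = p* - H 0 + c / 2],
     (D)  int w.grad a = 0
     (F)  int F(psi) w.grad a = 0
     (1)  int u*_1 w.grad a + q a_1 - m u*_2 a = 0
     (2)  int u*_2 w.grad a + q a_2 + m u*_1 a = 0;
   the identity for the third component is a combination of (F), (1) and (2).

   For tests supported inside the domain, (D) follows by mollification and (F) by testing (D)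
   with [F(psi) a]. Up to (F) and exact derivatives, (1) and (2) state that the energy with
   density [K grad psi . grad psi / 2] is stationary under displacements of [psi] along the
   coordinate directions. As [psi] is only C^1, this Noether identity is not obtained by
   multiplying the equation by [psi_i] and integrating by parts, but from the convexity of
   the energy: the equation, tested with [psi (x + t a e_i) - psi x], bounds the variation of
   the energy from below for both signs of [t].

   The identities extend to tests meeting the boundary by cutting off at distance [delta]:
   the derivative of the cut-off is of size [1 / delta] on a strip of area [O(delta)], and the
   normal components of the fluxes vanish on the boundary, because [psi = 0] there makes [w]
   tangent and the overdetermined condition gives [q = 0]. *)

(** * Integrals of bounded functions with bounded support *)

(** The equation is given against smooth tests only, whereas the variation argument tests it with
    [psi (x + t a e_i) - psi x], which is merely C^1; mollifying the test function bridges this gap.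
    [F] and [H] are C^1 only along the range of [psi] on the closure, so their derivatives are taken
    relative to that set.

    In the variation argument the right-hand side is frozen as a function [f] of the position. The
    functional is then quadratic plus linear and convex whatever [F] and [H] are, because [K] is
    positive. The form of [f] enters only afterwards: in [f psi_i a] the terms in [H'] and [F' F]
    complete the derivatives of [H(psi)] and [F(psi)^2 / 2], and [2 h^2 / |xi|^4], the divergence of
    [x / |xi|^2], is absorbed by (F).

    [F(psi)] is the scalar product of [u*] with the helical direction [(x_2, - x_1, h)], that is,
    [h u*_3 = F(psi) + x_1 u*_2 - x_2 u*_1]. Hence the third component follows from (F) and from (1)
    and (2) tested with [x_2 a] and [x_1 a], a balance of angular momentum. Subtracting the outer
    pressure [H 0 - c / 2] makes [q] vanish on the boundary and outside. *)

Section measurable_basis.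
(** Open sets of a product have to be measurable for the product sigma-algebra. A countable basis
    with members in [M] is the property that passes from the factors to the product. *)
Definition countable_basis_in (T : topologicalType) (M : set (set T)) :=
  exists B : nat -> set T, (forall n, M (B n)) /\
    forall x V, nbhs x V -> exists n, B n x /\ B n `<=` V.

Lemma countable_basis_in_prod (T1 T2 : topologicalType) M1 M2
    (M : set (set (T1 * T2))) :
  M set0 -> (forall A B, M1 A -> M2 B -> M (A `*` B)) ->
  countable_basis_in M1 -> countable_basis_in M2 -> countable_basis_in M.
Proof.
move=> M0 MX [B1 [mB1 bB1]] [B2 [mB2 bB2]].
pose B n := if unpickle n is Some (i, j) then B1 i `*` B2 j else set0.
exists B; split=> [n|[x y] V [[V1 V2] /= [nV1 nV2] sV]].
  by rewrite /B; case: unpickle => [[i j]|]//; exact: MX.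
have [i [Bi sBi]] := bB1 _ _ nV1; have [j [Bj sBj]] := bB2 _ _ nV2.
exists (pickle (i, j)); rewrite /B pickleK; split=> //.
by move=> -[a b] [/= /sBi ? /sBj ?]; exact: sV.
Qed.

Lemma open_of_countable_basis (T : topologicalType) (M : set (set T)) :
  (forall F : nat -> set T, (forall n, M (F n)) -> M (\bigcup_n F n)) ->
  M set0 -> countable_basis_in M -> forall U : set T, open U -> M U.
Proof.
move=> MU M0 [B [mB bB]] U oU.
suff -> : U = \bigcup_n (if `[< B n `<=` U >] then B n else set0).
  by apply: MU => n; case: ifPn.
rewrite eqEsubset; split=> [x Ux|x [n _]]; last by case: ifPn => // /asboolP sB /sB.
have [n [Bx sB]] := bB x U (open_nbhs_nbhs (conj oU Ux)).
by exists n => //; case: ifPn => // /asboolP.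
Qed.

Lemma measurable_fun_preimage_open (R : realType) d (T : measurableType d)
    (f : T -> R) :
  (forall U : set R, open U -> d.-measurable (f @^-1` U)) ->
  measurable_fun setT f.
Proof.
move=> mf; apply: (measurability _ (RGenOInfty.measurableE R)).
move=> _ [_ [a ->] <-]; rewrite setTI set_itvoy; apply: mf; exact: open_gt.
Qed.
End measurable_basis.

Lemma countable_basis_in_R (R : realType) :
  countable_basis_in (fun A : set R => measurable A).
Proof.
pose B n : set R := if unpickle n is Some (a, b) then `]ratr (a : rat), ratr (b : rat)[%classic
  else set0.
exists B; split=> [n|x V]; first by rewrite /B; case: unpickle => [[i j]|].
rewrite nbhs_ballP => -[e /= e0 sV].
have [a] := @rat_in_itvoo R (x - e) x ltac:(lra).
rewrite in_itv /= => /andP[a1 a2].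
have [b] := @rat_in_itvoo R x (x + e) ltac:(lra).
rewrite in_itv /= => /andP[b1 b2].
exists (pickle (a, b)); rewrite /B pickleK; split.
  by rewrite /= in_itv /= a2 b1.
move=> y /=; rewrite in_itv /= => /andP[y1 y2]; apply: sV; rewrite /ball /=.
by rewrite ltr_norml; apply/andP; split; lra.
Qed.

Section bounded_compactly_supported.
Context d (T : measurableType d) (R : realType).
Variables (mu : {measure set T -> \bar R}) (N : T -> R).

(** [N] acts as a norm. The same [M] bounds the values and the gauge of the support, so one
    predicate carries integrability, Fubini and dominated convergence, and it is stable under
    products, sections and partial integrals. *)
Definition bcf (f : T -> R) := measurable_fun setT f /\
  exists M : R, forall x, `|f x| <= M /\ (M < N x -> f x = 0).

Lemma bcf_meas (f : T -> R) : bcf f -> measurable_fun setT f. Proof. by case. Qed.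

Lemma bcf0 : bcf (fun=> 0).
Proof. by split=> //; exists 0 => x; rewrite normr0. Qed.

Lemma bcf_bounded_mul (f g : T -> R) : bcf f -> measurable_fun setT g ->
  (forall M, exists B : R, forall x, N x <= M -> `|g x| <= B) ->
  bcf (fun x => g x * f x).
Proof.
move=> [mf [M fM]] mg gB; split; first exact: measurable_funM.
have [B hB] := gB M; exists (Num.max M (`|B| * `|M|)) => x.
have [f1 f2] := fM x; split.
  have [xM|xM] := leP (N x) M.
    rewrite le_max; apply/orP; right; rewrite normrM ler_pM ?normr_ge0//.
      by rewrite (le_trans (hB _ xM))// ler_norm.
    by rewrite (le_trans f1)// ler_norm.
  rewrite f2// mulr0 normr0 le_max; apply/orP; right.
  by rewrite mulr_ge0.
by rewrite gt_max => /andP[/f2 -> _]; rewrite mulr0.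
Qed.

Lemma bcfZ k (f : T -> R) : bcf f -> bcf (fun x => k * f x).
Proof.
by move=> bf; apply: bcf_bounded_mul => // M; exists `|k| => x.
Qed.

Lemma bcfM (f g : T -> R) : bcf f -> bcf g -> bcf (fun x => f x * g x).
Proof.
move=> [mf [M fM]] bg; apply: bcf_bounded_mul => // M'.
by exists M => x _; case: (fM x).
Qed.

Lemma bcfD (f g : T -> R) : bcf f -> bcf g -> bcf (fun x => f x + g x).
Proof.
move=> [mf [M fM]] [mg [M' gM]]; split; first exact: measurable_funD.
have M0 : 0 <= M by rewrite (le_trans _ (proj1 (fM point))).
have M0' : 0 <= M' by rewrite (le_trans _ (proj1 (gM point))).
exists (M + M') => x; have [f1 f2] := fM x; have [g1 g2] := gM x; split.
  by rewrite (le_trans (ler_normD _ _))// lerD.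
by move=> h; rewrite f2 ?g2 ?addr0//; lra.
Qed.

Lemma bcfN (f : T -> R) : bcf f -> bcf (fun x => - f x).
Proof.
move=> bf; rewrite (_ : (fun x => - f x) = (fun x => -1 * f x)); first exact: bcfZ.
by apply/funext => x; rewrite mulN1r.
Qed.

Lemma bcfB (f g : T -> R) : bcf f -> bcf g -> bcf (fun x => f x - g x).
Proof. by move=> bf bg; apply: bcfD => //; exact: bcfN. Qed.

Lemma bcf_le (f g : T -> R) : measurable_fun setT f -> bcf g ->
  (forall x, `|f x| <= `|g x|) -> bcf f.
Proof.
move=> mf [_ [M gM]] fg; split=> //; exists M => x; have [g1 g2] := gM x.
split; first exact: le_trans (fg x) _.
by move=> /g2 gx; apply/eqP; rewrite -normr_le0 (le_trans (fg x))// gx normr0.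
Qed.

Lemma bcf_norm (f : T -> R) : bcf f -> bcf (fun x => `|f x|).
Proof.
move=> bf; apply: bcf_le (bf) _ => [|x]; last by rewrite normr_id.
by apply: measurableT_comp (bcf_meas bf).
Qed.

Record locally_finite : Prop := {
  gauge_meas : measurable_fun setT N ;
  gauge_fin : forall M, (mu [set x | (N x <= M)%R] < +oo)%E }.

Hypothesis lf : locally_finite.

Lemma gauge_meas_set M : measurable [set x | N x <= M].
Proof.
rewrite (_ : [set x | _] = N @^-1` `]-oo, M]).
  by rewrite -[X in measurable X]setTI; exact: (gauge_meas lf).
by apply/seteqP; split=> x /=; rewrite in_itv.
Qed.

Lemma bcf_integrable (f : T -> R) : bcf f -> mu.-integrable setT (EFin \o f).
Proof.
move=> [mf [M fM]].
have M0 : 0 <= M by rewrite (le_trans _ (proj1 (fM point))).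
pose g := (EFin \o (cst M)) \_ [set x | N x <= M].
have ig : mu.-integrable setT g.
  apply/(integrable_mkcond _ (gauge_meas_set M)).
  apply: measurable_bounded_integrable => //.
  - exact: gauge_meas_set.
  - exact: (gauge_fin lf).
    by exists `|M|; split=> // M' MM' x _ /=; exact: ltW.
apply: le_integrable ig => //; first exact/measurable_EFinP.
move=> x _; rewrite /g patchE; have [f1 f2] := fM x.
case: ifPn => [_|]; first by rewrite /= lee_fin (le_trans f1)// ler_norm.
by rewrite notin_setE /= => /negP; rewrite -ltNge => /f2 ->.
Qed.

Lemma locally_finite_sigma_finite : sigma_finite setT mu.
Proof.
exists (fun n => [set x | N x <= n%:R]).
  apply/seteqP; split=> // x _; exists (Num.truncn `|N x|).+1 => //=.
  by rewrite (le_trans (ler_norm _))// ltW// truncnS_gt.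
by move=> n; split; [exact: gauge_meas_set|exact: (gauge_fin lf)].
Qed.

Local Notation Int f := (\int[mu]_x f x).

Lemma IntD (f g : T -> R) : bcf f -> bcf g ->
  Int (fun x => f x + g x) = Int f + Int g.
Proof. by move=> bf bg; rewrite RintegralD//; exact: bcf_integrable. Qed.

Lemma IntB (f g : T -> R) : bcf f -> bcf g ->
  Int (fun x => f x - g x) = Int f - Int g.
Proof. by move=> bf bg; rewrite RintegralB//; exact: bcf_integrable. Qed.

Lemma IntZ k (f : T -> R) : bcf f -> Int (fun x => k * f x) = k * Int f.
Proof. by move=> bf; rewrite RintegralZl//; exact: bcf_integrable. Qed.

Lemma IntN (f : T -> R) : bcf f -> Int (fun x => - f x) = - Int f.
Proof.
by move=> bf; rewrite -mulN1r -IntZ//; apply: eq_Rintegral => x _; rewrite mulN1r.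
Qed.

Lemma Int0 : Int (fun=> 0 : R) = 0.
Proof. by rewrite /Rintegral integral0. Qed.

Lemma le_Int (f g : T -> R) : bcf f -> bcf g -> (forall x, f x <= g x) ->
  Int f <= Int g.
Proof. by move=> bf bg fg; apply: le_Rintegral => //; exact: bcf_integrable. Qed.

Lemma Int_norm (f : T -> R) : bcf f -> `|Int f| <= Int (fun x => `|f x|).
Proof. by move=> bf; apply: le_normr_Rintegral => //; exact: bcf_integrable. Qed.

Lemma Int_norm_le (f g : T -> R) : bcf f -> bcf g ->
  (forall x, `|f x| <= g x) -> `|Int f| <= Int g.
Proof.
by move=> bf bg fg; apply: le_trans (Int_norm bf) _; apply: le_Int => //; exact: bcf_norm.
Qed.

(** Dominated convergence with the majorant equal to [M] on [N x <= M] and to 0 elsewhere; it is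
    integrable because that set has finite measure. *)
Lemma Int_cvg (f_ : nat -> T -> R) (f : T -> R) (M : R) :
  (forall n, measurable_fun setT (f_ n)) ->
  (forall n x, `|f_ n x| <= M /\ (M < N x -> f_ n x = 0)) ->
  (forall x, f_ n x @[n --> \oo] --> f x) ->
  bcf f /\ Int (f_ n) @[n --> \oo] --> Int f.
Proof.
move=> mf_ f_M f_f.
have mf : measurable_fun setT f by apply: (measurable_fun_cvg mf_) => x _; exact: f_f.
have bf : bcf f.
  split=> //; exists M => x; split.
    have /cvg_norm fx := f_f x.
    rewrite -(cvg_lim _ fx)//; apply: limr_le; first by apply/cvg_ex; exists `|f x|.
    by apply: nearW => n; case: (f_M n x).
  move=> Mx; apply: (cvg_unique _ (f_f x)) => //.
  rewrite (_ : (fun n => f_ n x) = (fun=> 0)); first exact: cvg_cst.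
  by apply/funext => n; exact: (proj2 (f_M n x) Mx).
split=> //.
have M0 : 0 <= M by rewrite (le_trans _ (proj1 (f_M 0%N point))).
have bg : bcf (fun x => if N x <= M then M else 0).
  split; last first.
    by exists M => x; case: ifPn => xM; rewrite ?normr0 ?ger0_norm//; split=> //; rewrite ltNge xM.
  apply: measurable_fun_ifT => //.
  by apply: measurable_fun_ler => //; exact: (gauge_meas lf).
have [] := @dominated_convergence _ _ _ mu setT measurableT
   (fun n x => (f_ n x)%:E) (EFin \o f) (fun x => (if N x <= M then M else 0)%:E).
- by move=> n; exact/measurable_EFinP.
- exact/measurable_EFinP.
- by apply: aeW => x _ /=; apply/cvg_EFin; [exact: nearW|exact: f_f].
- exact: bcf_integrable.
- apply: aeW => x n _ /=; rewrite lee_fin; have [f1 f2] := f_M n x.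
  by case: ifPn => //; rewrite -ltNge => /f2 ->; rewrite normr0.
move=> _ _ cvgI; rewrite /Rintegral; apply: fine_cvg; rewrite fineK//.
exact: integrable_fin_num (bcf_integrable bf).
Qed.
End bounded_compactly_supported.

Section product_gauge.
Context d1 d2 (T1 : measurableType d1) (T2 : measurableType d2) (R : realType).
Variables (m1 : {sigma_finite_measure set T1 -> \bar R}).
Variables (m2 : {sigma_finite_measure set T2 -> \bar R}).
Variables (N1 : T1 -> R) (N2 : T2 -> R).
Hypotheses (lf1 : locally_finite m1 N1) (lf2 : locally_finite m2 N2).

(** The maximum makes the sublevel sets rectangles, whose measure is a product of two finite
    ones. *)
Definition gauge_prod (p : T1 * T2) := Num.max (N1 p.1) (N2 p.2).

Lemma locally_finite_prod : locally_finite (product_measure1 m1 m2) gauge_prod.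
Proof.
split.
  apply: measurable_maxr; first exact: measurableT_comp (gauge_meas lf1) _.
  exact: measurableT_comp (gauge_meas lf2) _.
move=> M; rewrite (_ : [set x | _] = [set x | N1 x <= M] `*` [set x | N2 x <= M]).
  rewrite [ltLHS]product_measure1E; [|exact: (gauge_meas_set lf1)|exact: (gauge_meas_set lf2)].
  apply: lte_mul_pinfty => //; last exact: gauge_fin lf2 _.
  by rewrite ge0_fin_numE//; exact: gauge_fin lf1 _.
by apply/seteqP; split=> -[x y] /=; rewrite /gauge_prod ge_max => /andP.
Qed.

Section fubini_bcf.
Variable f : T1 * T2 -> R.
Hypothesis bf : bcf gauge_prod f.

Lemma bcf_section1 x : bcf N2 (fun y => f (x, y)).
Proof.
have [mf [M fM]] := bf; split; first exact: measurableT_comp mf _.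
exists M => y; have [f1 f2] := fM (x, y); split=> // My; apply: f2.
by rewrite /gauge_prod lt_max My orbT.
Qed.

Lemma bcf_section2 y : bcf N1 (fun x => f (x, y)).
Proof.
have [mf [M fM]] := bf; split; first exact: measurableT_comp mf _.
exists M => x; have [f1 f2] := fM (x, y); split=> // My; apply: f2.
by rewrite /gauge_prod lt_max My.
Qed.

Lemma Fubini1 : \int[product_measure1 m1 m2]_z f z = \int[m1]_x \int[m2]_y f (x, y).
Proof.
have /= := integral12_prod_meas1 (bcf_integrable locally_finite_prod bf).
rewrite /Rintegral => <-; congr fine; apply: eq_integral => x _ /=.
by rewrite fineK//; exact: integrable_fin_num (bcf_integrable lf2 (bcf_section1 x)).
Qed.

Lemma Fubini2 : \int[product_measure1 m1 m2]_z f z = \int[m2]_y \int[m1]_x f (x, y).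
Proof.
have /= := integral21_prod_meas1 (bcf_integrable locally_finite_prod bf).
rewrite /Rintegral => <-; congr fine; apply: eq_integral => x _ /=.
by rewrite fineK//; exact: integrable_fin_num (bcf_integrable lf1 (bcf_section2 x)).
Qed.

Lemma bcf_int1 : bcf N1 (fun x => \int[m2]_y f (x, y)).
Proof.
have [mf [M fM]] := bf; split.
  apply: measurableT_comp; first exact: fine_measurable.
  exact: measurable_fubini_F (bcf_integrable locally_finite_prod bf).
have M0 : 0 <= M by rewrite (le_trans _ (proj1 (fM point))).
pose C := \int[m2]_y (if N2 y <= M then M else 0).
have bg : bcf N2 (fun y => if N2 y <= M then M else 0).
  split; last first.
    by exists M => y; case: ifPn => yM; rewrite ?normr0 ?ger0_norm//; split=> //; rewrite ltNge yM.
  by apply: measurable_fun_ifT => //; apply: measurable_fun_ler => //; exact: (gauge_meas lf2).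
exists (Num.max M C) => x; split.
  rewrite le_max; apply/orP; right; apply: (Int_norm_le lf2) => //; first exact: bcf_section1.
  move=> y; have [f1 f2] := fM (x, y); case: ifPn => //; rewrite -ltNge => My.
  by rewrite f2 ?normr0// /gauge_prod lt_max My orbT.
rewrite gt_max => /andP[Mx _]; rewrite -[RHS](Int0 m2); apply: eq_Rintegral => y _.
by apply: (proj2 (fM (x, y))); rewrite /gauge_prod lt_max Mx.
Qed.
End fubini_bcf.
End product_gauge.

(** * Translations, shears and rotations *)

Section lebesgue_line.
Context {R : realType}.
Local Notation lambda := (@lebesgue_measure R).

Definition N1 (x : R) : R := `|x|.

Lemma locally_finite_lebesgue : locally_finite lambda N1.
Proof.
split; first exact: normr_measurable.
move=> M; rewrite (_ : [set x | _] = `[- M, M]%classic).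
  have : (lambda [set` `[(- M)%R, M]] < +oo)%E.
    by rewrite lebesgue_measure_itv /=; case: ifPn => _; rewrite ?ltry.
  by [].
by apply/seteqP; split=> x /=; rewrite /N1 in_itv /= ler_norml.
Qed.

(** The translated measure agrees with [lambda] on half-open intervals, and these determine Lebesgue
    measure. *)
Lemma lebesgue_measure_translation (a : R) (A : set R) : measurable A ->
  lambda (( +%R^~ a) @^-1` A) = lambda A.
Proof.
move=> mA; have ma : measurable_fun [set: measurableTypeR R] (( +%R^~ a) : measurableTypeR R -> measurableTypeR R).
  by apply: (@measurable_funD _ R R setT id (cst a)).
apply/esym.
have := @lebesgue_measure_unique R (measure_function_pushforward__canonical__measure_function_Measure lambda ma) _ A mA.
apply.
move=> X [[x y]] /= _ <-.
rewrite /pushforward (_ : _ @^-1` _ = `]x - a, y - a]%classic).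
  have : lambda [set` `]x - a, y - a]] = lambda [set` `]x, y]].
    rewrite !lebesgue_measure_itv /= !lte_fin ltrD2r.
    by case: ifPn => // _; rewrite -!EFinB; congr EFin; ring.
  by [].
by apply/seteqP; split=> z /=; rewrite !in_itv /= => /andP[z1 z2]; apply/andP; split; lra.
Qed.

Lemma Int_translation (a : R) (f : R -> R) : bcf N1 f ->
  \int[lambda]_x f (x + a) = \int[lambda]_x f x.
Proof.
move=> bf; have ma : measurable_fun [set: measurableTypeR R] (( +%R^~ a) : measurableTypeR R -> measurableTypeR R).
  by apply: (@measurable_funD _ R R setT id (cst a)).
rewrite /Rintegral; congr fine.
rewrite -[RHS](eq_measure_integral lambda (m1 := measure_function_pushforward__canonical__measure_function_Measure lambda ma)); last first.
  by move=> A mA _; exact: lebesgue_measure_translation.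
rewrite (integral_pushforward ma)//=.
  by apply/measurable_EFinP; case: bf.
have [mf [M fM]] := bf.
apply: (bcf_integrable locally_finite_lebesgue); split.
  exact: measurableT_comp mf ma.
exists (M + `|a|) => x; have [f1 f2] := fM (x + a); split; first by rewrite (le_trans f1)// lerDl.
move=> Mx; apply: f2; rewrite /N1 in Mx *.
by have := ler_normB (x + a) a; rewrite addrK; lra.
Qed.
End lebesgue_line.

(** The last hypothesis is a quantitative properness of [phi]: far points stay far, so the support
    of [f \o phi] remains bounded. *)
Lemma bcf_comp (R : realType) d1 d2 (T1 : measurableType d1) (T2 : measurableType d2)
    (N1 : T1 -> R) (N2 : T2 -> R) (phi : T1 -> T2) (f : T2 -> R) :
  bcf N2 f -> measurable_fun setT phi ->
  (exists2 C : R, 0 <= C & forall x, N1 x <= C * N2 (phi x)) ->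
  bcf N1 (f \o phi).
Proof.
move=> [mf [M fM]] mphi [C C0 hC]; split; first exact: measurableT_comp mf mphi.
have M0 : 0 <= M by rewrite (le_trans _ (proj1 (fM point))).
exists (M + C * M) => x; have [f1 f2] := fM (phi x); split.
  by rewrite (le_trans f1)// lerDl mulr_ge0.
move=> h; apply: f2; rewrite ltNge; apply/negP => h2.
by have := le_trans (hC x) (ler_wpM2l C0 h2); lra.
Qed.

Section lebesgue_plane.
Context {R : realType}.
Local Notation lambda := (@lebesgue_measure R).
Local Notation R2 := (R * R)%type.

Definition N2 : R2 -> R := gauge_prod (@N1 R) (@N1 R).
Definition N3 : R2 * R -> R := gauge_prod N2 (@N1 R).
Definition N4 : R2 * R2 -> R := gauge_prod N2 N2.

(* The library's sigma-finite instance for products is only found for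
   probability measures, so it is rebuilt here from the gauge. *)
Definition lam2 := product_measure1 lambda lambda.

HB.instance Definition _ := Measure.on lam2.

Let lam2_lf : locally_finite lam2 N2.
Proof. exact: locally_finite_prod locally_finite_lebesgue locally_finite_lebesgue. Qed.

HB.instance Definition _ := Measure_isSigmaFinite.Build _ _ _ lam2
  (locally_finite_sigma_finite lam2_lf).

Lemma lf2 : locally_finite lam2 N2.
Proof. exact: locally_finite_prod locally_finite_lebesgue locally_finite_lebesgue. Qed.

Lemma lf3 : locally_finite (product_measure1 lam2 lambda) N3.
Proof. exact: (locally_finite_prod lf2 locally_finite_lebesgue). Qed.

Definition I2 (f : R2 -> R) : R := \int[mu2]_x f x.
Definition I3 (f : R2 * R -> R) : R := \int[mu3]_x f x.

Lemma N2_fst (x : R2) : `|x.1| <= N2 x.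
Proof. by rewrite /N2 /gauge_prod le_max lexx. Qed.

Lemma N2_snd (x : R2) : `|x.2| <= N2 x.
Proof. by rewrite /N2 /gauge_prod le_max lexx orbT. Qed.

Lemma N2_le (x : R2) M : `|x.1| <= M -> `|x.2| <= M -> N2 x <= M.
Proof. by move=> h1 h2; rewrite /N2 /gauge_prod ge_max h1 h2. Qed.

Lemma N2_ge0 x : 0 <= N2 x. Proof. exact: le_trans (N2_fst x). Qed.

Lemma I2_Fubini1 f : bcf N2 f ->
  I2 f = \int[lambda]_x \int[lambda]_y f (x, y).
Proof. exact: (Fubini1 locally_finite_lebesgue locally_finite_lebesgue). Qed.

Lemma I2_Fubini2 f : bcf N2 f ->
  I2 f = \int[lambda]_y \int[lambda]_x f (x, y).
Proof. exact: (Fubini2 locally_finite_lebesgue locally_finite_lebesgue). Qed.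

Lemma I3_Fubini1 f : bcf N3 f -> I3 f = I2 (fun x => \int[lambda]_z f (x, z)).
Proof. exact: (Fubini1 lf2 locally_finite_lebesgue). Qed.

Lemma I3_Fubini2 f : bcf N3 f -> I3 f = \int[lambda]_z I2 (fun x => f (x, z)).
Proof. exact: (Fubini2 lf2 locally_finite_lebesgue). Qed.

Definition lin2 (a b c d : R) (x : R2) : R2 := (a * x.1 + b * x.2, c * x.1 + d * x.2).

Lemma measurable_lin2 a b c d : measurable_fun setT (lin2 a b c d).
Proof.
apply: measurable_fun_pair; apply: measurable_funD; apply: measurable_funM => //.
Qed.

Lemma N2_lin2 a b c d x : N2 (lin2 a b c d x) <= (`|a| + `|b| + `|c| + `|d|) * N2 x.
Proof.
have := N2_fst x; have := N2_snd x; have := N2_ge0 x.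
have := normr_ge0 a; have := normr_ge0 b; have := normr_ge0 c; have := normr_ge0 d.
set A := `|a|; set B := `|b|; set C := `|c|; set D := `|d|; set n := N2 x.
move=> D0 C0 B0 A0 n0 h2 h1.
apply: N2_le; apply: le_trans (ler_normD _ _) _; rewrite !normrM -/A -/B -/C -/D; nra.
Qed.

Lemma bcf_lin2 a b c d a' b' c' d' (f : R2 -> R) : cancel (lin2 a b c d) (lin2 a' b' c' d') ->
  bcf N2 f -> bcf N2 (f \o lin2 a b c d).
Proof.
move=> K bf; apply: bcf_comp bf (measurable_lin2 _ _ _ _) _.
exists (`|a'| + `|b'| + `|c'| + `|d'|); first by rewrite !addr_ge0.
by move=> x; rewrite -[x in N2 x]K; exact: N2_lin2.
Qed.

(** A shear acts on each horizontal line as a translation, so Fubini reduces the claim to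
    [Int_translation]. *)
Lemma I2_shear1 k (f : R2 -> R) : bcf N2 f -> I2 (f \o lin2 1 k 0 1) = I2 f.
Proof.
move=> bf; have K : cancel (lin2 1 k 0 1) (lin2 1 (- k) 0 1).
  by move=> [x y]; rewrite /lin2 /=; congr pair; ring.
rewrite (I2_Fubini2 (bcf_lin2 K bf)) (I2_Fubini2 bf).
apply: eq_Rintegral => y _.
rewrite -(Int_translation (k * y) (bcf_section2 bf y)).
by apply: eq_Rintegral => x _; rewrite /= /lin2 /=; congr (f (_, _)); ring.
Qed.

Lemma I2_shear2 k (f : R2 -> R) : bcf N2 f -> I2 (f \o lin2 1 0 k 1) = I2 f.
Proof.
move=> bf; have K : cancel (lin2 1 0 k 1) (lin2 1 0 (- k) 1).
  by move=> [x y]; rewrite /lin2 /=; congr pair; ring.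
rewrite (I2_Fubini1 (bcf_lin2 K bf)) (I2_Fubini1 bf).
apply: eq_Rintegral => y _.
rewrite -(Int_translation (k * y) (bcf_section1 bf y)).
by apply: eq_Rintegral => x _; rewrite /= /lin2 /=; congr (f (_, _)); ring.
Qed.

Lemma lin2_rot_cancel c s : c ^+ 2 + s ^+ 2 = 1 ->
  cancel (lin2 c s (- s) c) (lin2 c (- s) s c).
Proof.
move=> h [x y]; rewrite /lin2 /=; congr pair.
  by rewrite -[RHS]mul1r -h; ring.
by rewrite -[RHS]mul1r -h; ring.
Qed.

Lemma bcf_rot c s (f : R2 -> R) : c ^+ 2 + s ^+ 2 = 1 -> bcf N2 f ->
  bcf N2 (f \o lin2 c s (- s) c).
Proof. by move=> h; apply: bcf_lin2 (lin2_rot_cancel h). Qed.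

(* A rotation with nonzero sine is a product of three shears. *)
Lemma I2_rot c s (f : R2 -> R) : c ^+ 2 + s ^+ 2 = 1 -> bcf N2 f ->
  I2 (f \o lin2 c s (- s) c) = I2 f.
Proof.
have key c0 s0 (f0 : R2 -> R) : s0 != 0 -> c0 ^+ 2 + s0 ^+ 2 = 1 -> bcf N2 f0 ->
    I2 (f0 \o lin2 c0 s0 (- s0) c0) = I2 f0.
  (* [a] is the tangent of half the angle: the rotation is the shear by [a], then the transposed
     shear by [- s0], then the shear by [a] again. *)
  move=> s0N0 h bf; pose a := (1 - c0) / s0.
  have aS : a * s0 = 1 - c0 by rewrite /a mulfVK.
  have aC : a * (1 + c0) = s0.
    apply: (mulIf s0N0); rewrite mulrAC aS -expr2.
    have -> : s0 ^+ 2 = 1 - c0 ^+ 2 by rewrite -h; ring.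
    by ring.
  have K1 : cancel (lin2 1 a 0 1) (lin2 1 (- a) 0 1).
    by move=> [x y]; rewrite /lin2 /=; congr pair; ring.
  have K2 : cancel (lin2 1 0 (- s0) 1) (lin2 1 0 s0 1).
    by move=> [x y]; rewrite /lin2 /=; congr pair; ring.
  have b1 := bcf_lin2 K1 bf; have b2 := bcf_lin2 K2 b1.
  rewrite -(I2_shear1 a bf) -(I2_shear2 (- s0) b1) -(I2_shear1 a b2).
  congr I2; apply/funext => -[x y]; rewrite /= /lin2 /=; congr (f0 (_, _)).
    have -> : c0 * x + s0 * y = (1 - a * s0) * x + a * (1 + (1 - a * s0)) * y.
      by rewrite aS (_ : 1 - (1 - c0) = c0) ?aC//; ring.
    by ring.
  have -> : - s0 * x + c0 * y = - s0 * x + (1 - a * s0) * y by rewrite aS; ring.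
  by ring.
move=> h bf; have [s0|] := eqVneq s 0; last by move=> sN0; exact: key.
have /eqP : (c - 1) * (c + 1) = 0 by rewrite -[RHS](subrr 1) -[X in _ = X - _]h s0; ring.
rewrite mulf_eq0 => /orP[/eqP c1|/eqP c1].
  have -> : c = 1 by lra.
  rewrite s0; congr I2; apply/funext => -[x y]; rewrite /= /lin2 /=; congr (f (_, _)); ring.
(* The half-turn is the square of the quarter-turn, to which [key] applies since its sine is 1. *)
have -> : c = -1 by lra.
have h1 : (0 : R) ^+ 2 + 1 ^+ 2 = 1 by rewrite expr0n expr1n add0r.
rewrite -(key _ _ _ (oner_neq0 _) h1 bf) -(key _ _ _ (oner_neq0 _) h1 (bcf_rot h1 bf)).
rewrite s0; congr I2; apply/funext => -[x y]; rewrite /= /lin2 /=; congr (f (_, _)); ring.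
Qed.

End lebesgue_plane.

Section continuous_functions.
Context {R : realType}.
Local Notation lambda := (@lebesgue_measure R).
Local Notation R2 := (R * R)%type.

Lemma countable_basis_in_R2 : countable_basis_in (fun A : set R2 => measurable A).
Proof.
apply: countable_basis_in_prod (countable_basis_in_R R) (countable_basis_in_R R) => //.
exact: measurableX.
Qed.

Lemma open_measurable2 (U : set R2) : open U -> measurable U.
Proof.
apply: open_of_countable_basis countable_basis_in_R2 U => // F mF.
exact: bigcup_measurable.
Qed.

Lemma open_measurable3 (U : set (R2 * R)) : open U -> measurable U.
Proof.
apply: (open_of_countable_basis (M := fun A : set (R2 * R) => measurable A)) => //.
  by move=> F mF; exact: bigcup_measurable.
apply: countable_basis_in_prod countable_basis_in_R2 (countable_basis_in_R R) => //.
exact: measurableX.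
Qed.

Lemma open_measurable4 (U : set (R2 * R2)) : open U -> measurable U.
Proof.
apply: (open_of_countable_basis (M := fun A : set (R2 * R2) => measurable A)) => //.
  by move=> F mF; exact: bigcup_measurable.
apply: countable_basis_in_prod countable_basis_in_R2 countable_basis_in_R2 => //.
exact: measurableX.
Qed.

Lemma continuous_measurable2 (f : R2 -> R) : continuous f -> measurable_fun setT f.
Proof.
move=> /continuousP cf; apply: measurable_fun_preimage_open => U oU.
by apply: open_measurable2; exact: cf.
Qed.

Lemma continuous_measurable3 (f : R2 * R -> R) : continuous f -> measurable_fun setT f.
Proof.
move=> /continuousP cf; apply: measurable_fun_preimage_open => U oU.
by apply: open_measurable3; exact: cf.
Qed.

Lemma continuous_measurable4 (f : R2 * R2 -> R) : continuous f -> measurable_fun setT f.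
Proof.
move=> /continuousP cf; apply: measurable_fun_preimage_open => U oU.
by apply: open_measurable4; exact: cf.
Qed.

Lemma compact_bound (T : topologicalType) (K : set T) (f : T -> R) :
  compact K -> {within K, continuous f} -> exists B : R, forall x, K x -> `|f x| <= B.
Proof.
move=> cK cf; have /compact_bounded[B [_ hB]] := continuous_compact cf cK.
by exists (B + 1) => x Kx; apply: hB; [rewrite ltrDl|exists x].
Qed.

Lemma N1_compact (M : R) : compact [set x : R | N1 x <= M].
Proof.
rewrite (_ : [set x | _] = `[- M, M]%classic); first exact: segment_compact.
by apply/seteqP; split=> x /=; rewrite /N1 in_itv /= ler_norml.
Qed.

Lemma gauge_prod_compact (T1 T2 : topologicalType) (m1 : T1 -> R) (m2 : T2 -> R) (M : R) :
  compact [set x | m1 x <= M] -> compact [set x | m2 x <= M] ->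
  compact [set x : T1 * T2 | Num.max (m1 x.1) (m2 x.2) <= M].
Proof.
move=> c1 c2; rewrite (_ : [set x | _] = [set x | m1 x <= M] `*` [set x | m2 x <= M]).
  exact: compact_setX.
by apply/seteqP; split=> -[x y] /=; rewrite ge_max => /andP.
Qed.

Lemma N2_compact (M : R) : compact [set x : R2 | N2 x <= M].
Proof. by apply: gauge_prod_compact; exact: N1_compact. Qed.

Lemma N3_compact (M : R) : compact [set x : R2 * R | N3 x <= M].
Proof. by apply: gauge_prod_compact; [exact: N2_compact|exact: N1_compact]. Qed.

Lemma N4_compact (M : R) : compact [set x : R2 * R2 | N4 x <= M].
Proof. by apply: gauge_prod_compact; exact: N2_compact. Qed.

Lemma continuous_N1_bound (f : R -> R) M : continuous f ->
  exists B : R, forall x, N1 x <= M -> `|f x| <= B.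
Proof.
move=> cf; have [B hB] := @compact_bound _ _ f (@N1_compact M) (continuous_subspaceT cf).
by exists B.
Qed.

Lemma continuous_N2_bound (f : R2 -> R) M : continuous f ->
  exists B : R, forall x, N2 x <= M -> `|f x| <= B.
Proof.
move=> cf; have [B hB] := @compact_bound _ _ f (@N2_compact M) (continuous_subspaceT cf).
by exists B.
Qed.

Lemma continuous_N3_bound (f : R2 * R -> R) M : continuous f ->
  exists B : R, forall x, N3 x <= M -> `|f x| <= B.
Proof.
move=> cf; have [B hB] := @compact_bound _ _ f (@N3_compact M) (continuous_subspaceT cf).
by exists B.
Qed.

Lemma bcf1_continuous (f : R -> R) M : continuous f -> (forall x, M < `|x| -> f x = 0) ->
  bcf N1 f.
Proof.
move=> cf f0; have [B hB] := continuous_N1_bound M cf.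
split; first exact: continuous_measurable_fun.
exists (Num.max M `|B|) => x; split; last by rewrite gt_max => /andP[/f0].
rewrite le_max; apply/orP; right; have [/hB h|/f0 ->] := leP (N1 x) M; last by rewrite normr0.
by rewrite (le_trans h)// ler_norm.
Qed.

Lemma bcf2_continuous (f : R2 -> R) M : continuous f -> (forall x, M < N2 x -> f x = 0) ->
  bcf N2 f.
Proof.
move=> cf f0; have [B hB] := continuous_N2_bound M cf.
split; first exact: continuous_measurable2.
exists (Num.max M `|B|) => x; split; last by rewrite gt_max => /andP[/f0].
rewrite le_max; apply/orP; right; have [/hB h|/f0 ->] := leP (N2 x) M; last by rewrite normr0.
by rewrite (le_trans h)// ler_norm.
Qed.

Lemma bcf3_continuous (f : R2 * R -> R) M : continuous f -> (forall x, M < N3 x -> f x = 0) ->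
  bcf N3 f.
Proof.
move=> cf f0; have [B hB] := continuous_N3_bound M cf.
split; first exact: continuous_measurable3.
exists (Num.max M `|B|) => x; split; last by rewrite gt_max => /andP[/f0].
rewrite le_max; apply/orP; right; have [/hB h|/f0 ->] := leP (N3 x) M; last by rewrite normr0.
by rewrite (le_trans h)// ler_norm.
Qed.

Lemma is_derive_eq0 (Q : R -> R) (q : R) (A : set R) (x : R) : is_derive x 1 Q q -> open A ->
  A x -> (forall y, A y -> Q y = 0) -> q = 0.
Proof.
move=> [_ <-] oA Ax Q0; rewrite (@near_eq_derive _ _ _ Q (cst 0)) ?derive_cst//.
near=> y; rewrite Q0//; near: y; exact: open_nbhs_nbhs.
Unshelve. all: by end_near. Qed.

Lemma Int_derive_eq0 (Q q : R -> R) (M : R) : (forall x : R, is_derive x 1 Q (q x)) ->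
  continuous q -> (forall x, M < `|x| -> Q x = 0) -> \int[lambda]_x q x = 0.
Proof.
move=> dQ cq Q0.
have q0 x : M < `|x| -> q x = 0.
  move=> Mx; apply: (@is_derive_eq0 _ _ [set y : R | M < `|y|] x (dQ x)) => //.
  by apply: (@open_comp _ _ (fun y : R => `|y|) [set y : R | M < y]); [move=> *; exact: norm_continuous|exact: open_gt].
pose A : R := `|M| + 1.
have MA : M < A by rewrite /A (le_lt_trans (ler_norm _))// ltrDl.
have A0 : 0 < A by rewrite /A ltr_wpDl.
rewrite (_ : (fun x => q x) = q \_ `[- A, A]); last first.
  apply/funext => x; rewrite patchE; case: ifPn => //; rewrite notin_setE /= in_itv /=.
  move=> /negP h; apply: q0; rewrite ltNge; apply: contra h => h.
  by rewrite -ler_norml (le_trans h)// ltW.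
rewrite -Rintegral_mkcond /Rintegral (continuous_FTC2 (F := Q)) //.
- by rewrite !Q0 ?normrN ?gtr0_norm//= subrr.
- by move: A0; clearbody A; lra.
- exact: continuous_subspaceT.
- have cQ : continuous Q.
    by move=> x; apply: differentiable_continuous; apply/derivable1_diffP; case: (dQ x).
  split; first by move=> x _; case: (dQ x).
  - by apply: cvg_at_right_filter; exact: cQ.
  - by apply: cvg_at_left_filter; exact: cQ.
- by move=> x _; rewrite derive1E derive_val.
Qed.
End continuous_functions.

(** * Continuously differentiable functions on the plane *)

Section C1_functions.
Context {R : realType}.
Local Notation R2 := (R * R)%type.

Definition dot_grad (a b : R) (v : R2) : R := v.1 * a + v.2 * b.

Lemma dot_grad_is_linear a b : linear (dot_grad a b).
Proof. by move=> k [u1 u2] [v1 v2]; rewrite /dot_grad /= /GRing.scale /=; ring. Qed.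

HB.instance Definition _ a b :=
  GRing.isLinear.Build R R2 R _ (dot_grad a b) (@dot_grad_is_linear a b).

Lemma continuous_dot_grad a b : continuous (dot_grad a b).
Proof.
move=> x; apply: cvgD; apply: cvgM; (try exact: cvg_cst);
  [exact: cvg_fst|exact: cvg_snd].
Qed.

(** The epsilon form transfers between functions that agree near [x], and it yields a chain rule
    when the outer function is differentiable along a subset of the line only ([C1on_comp_in]). *)
Lemma is_diff2P (f : R2 -> R) x a b :
  is_diff x f (dot_grad a b) <->
  forall e, 0 < e -> \forall y \near x, `|f y - f x - dot_grad a b (y - x)| <= e * `|y - x|.
Proof.
have E : f \o shift x = cst (f x) + dot_grad a b +o_ 0 id <->
  forall e, 0 < e -> \forall y \near x, `|f y - f x - dot_grad a b (y - x)| <= e * `|y - x|.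
  have S e : (\forall y \near x, `|f y - f x - dot_grad a b (y - x)| <= e * `|y - x|) <->
      (\forall h \near (0 : R2), `|(f \o shift x - (cst (f x) + dot_grad a b)) h| <= e * `|h|).
    have E2 y : (f \o shift x - (cst (f x) + dot_grad a b)) y =
      f (y + x) - (f x + dot_grad a b y) by [].
    rewrite (near_shift 0 x) /= subr0; split; apply: filterS => y /=.
    rewrite E2 addrK (opprD (f x)) (addrA (f (y + x))).
 by [].
    rewrite E2 addrK (opprD (f x)) (addrA (f (y + x))).
 by [].
  split.
    by move=> /eqaddoP h e e0; apply/S; exact: h.
  by move=> h; apply/eqaddoE => /=; apply/eqaddoP => e e0; apply/S; exact: h.
rewrite -E; split.
  by move=> [df dE]; rewrite -dE; exact: diff_locally.
move=> h; have dE := diff_unique (@continuous_dot_grad a b) h.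
split=> //; apply/diff_locallyP; rewrite dE; split => //.
exact: continuous_dot_grad.
Qed.

(** The partial derivatives are arguments, so that they can be given by formulas and have arbitrary
    values outside [U]. *)
Definition C1on (U : set R2) (f f1 f2 : R2 -> R) :=
  forall x, U x -> [/\ is_diff x f (dot_grad (f1 x) (f2 x)),
    {for x, continuous f1} & {for x, continuous f2}].

Lemma C1on_sub U V f f1 f2 : V `<=` U -> C1on U f f1 f2 -> C1on V f f1 f2.
Proof. by move=> VU h x /VU /h. Qed.

Lemma C1on_setU U V f f1 f2 : C1on U f f1 f2 -> C1on V f f1 f2 -> C1on (U `|` V) f f1 f2.
Proof. by move=> hU hV x [/hU|/hV]. Qed.

Lemma C1on_near_eq U f f1 f2 g g1 g2 : open U ->
  (forall x, U x -> [/\ f x = g x, f1 x = g1 x & f2 x = g2 x]) ->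
  C1on U g g1 g2 -> C1on U f f1 f2.
Proof.
move=> oU fg h x Ux; have [/is_diff2P dg cg1 cg2] := h _ Ux.
have nU : nbhs x U by exact: open_nbhs_nbhs.
have [fx f1x f2x] := fg _ Ux.
split.
- apply/is_diff2P => e /dg; rewrite f1x f2x fx.
  by apply: filter_app; apply: filterS nU => y /fg[->].
- rewrite /prop_for /continuous_at f1x; apply: cvg_trans cg1; apply: near_eq_cvg.
  by apply: filterS nU => y /fg[].
- rewrite /prop_for /continuous_at f2x; apply: cvg_trans cg2; apply: near_eq_cvg.
  by apply: filterS nU => y /fg[].
Qed.

Lemma C1on_cst U k : C1on U (fun=> k) (fun=> 0) (fun=> 0).
Proof.
move=> x _; split; try exact: cvg_cst.
by apply: is_diff_eq; apply/funext => v /=; rewrite /dot_grad !mulr0 addr0.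
Qed.

Lemma C1on_fst U : C1on U fst (fun=> 1) (fun=> 0).
Proof.
move=> x _; split; try exact: cvg_cst.
apply/is_diff2P => e e0; near=> y.
by rewrite /dot_grad /= mulr1 mulr0 addr0 subrr normr0 mulr_ge0// ltW.
Unshelve. all: by end_near. Qed.

Lemma C1on_snd U : C1on U snd (fun=> 0) (fun=> 1).
Proof.
move=> x _; split; try exact: cvg_cst.
apply/is_diff2P => e e0; near=> y.
by rewrite /dot_grad /= mulr1 mulr0 add0r subrr normr0 mulr_ge0// ltW.
Unshelve. all: by end_near. Qed.

Lemma C1onD U f f1 f2 g g1 g2 : C1on U f f1 f2 -> C1on U g g1 g2 ->
  C1on U (fun x => f x + g x) (fun x => f1 x + g1 x) (fun x => f2 x + g2 x).
Proof.
move=> hf hg x Ux; have [df cf1 cf2] := hf _ Ux; have [dg cg1 cg2] := hg _ Ux.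
split; [|exact: cvgD|exact: cvgD].
apply: is_diff_eq; apply/funext => v.
transitivity (dot_grad (f1 x) (f2 x) v + dot_grad (g1 x) (g2 x) v) => //.
by rewrite /dot_grad; ring.
Qed.

Lemma C1onM U f f1 f2 g g1 g2 : C1on U f f1 f2 -> C1on U g g1 g2 ->
  C1on U (fun x => f x * g x) (fun x => f1 x * g x + f x * g1 x) (fun x => f2 x * g x + f x * g2 x).
Proof.
move=> hf hg x Ux; have [df cf1 cf2] := hf _ Ux; have [dg cg1 cg2] := hg _ Ux.
have cf : {for x, continuous f} by apply: differentiable_continuous; case: df.
have cg : {for x, continuous g} by apply: differentiable_continuous; case: dg.
split; [|by apply: cvgD; apply: cvgM|by apply: cvgD; apply: cvgM].
apply: is_diff_eq; apply/funext => v.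
transitivity (f x * dot_grad (g1 x) (g2 x) v + g x * dot_grad (f1 x) (f2 x) v) => //.
by rewrite /dot_grad; ring.
Qed.

Lemma C1on_continuous U f f1 f2 x : C1on U f f1 f2 -> U x -> {for x, continuous f}.
Proof. by move=> hf Ux; have [df _ _] := hf _ Ux; apply: differentiable_continuous; case: df. Qed.

Lemma C1on_compr U f f1 f2 (g g' : R -> R) : C1on U f f1 f2 ->
  (forall x, U x -> is_derive (f x) 1 g (g' (f x)) /\ {for f x, continuous g'}) ->
  C1on U (g \o f) (fun x => g' (f x) * f1 x) (fun x => g' (f x) * f2 x).
Proof.
move=> hf hg x Ux; have [df cf1 cf2] := hf _ Ux; have [dg cg'] := hg _ Ux.
have cf := C1on_continuous hf Ux.
split; [|by apply: cvgM => //; apply: continuous_comp|by apply: cvgM => //; apply: continuous_comp].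
have dg2 : is_diff (f x) g (fun v : R => v * g' (f x)).
  have [dg1 dgE] := dg; have dgg : differentiable g (f x) by apply/derivable1_diffP.
  by split => //; rewrite deriv1E// derive1E dgE.
by apply: is_diff_eq; apply/funext => v /=; rewrite /dot_grad; ring.
Qed.

Lemma C1on_comp2 U W f f1 f2 (a a1 a2 b b1 b2 : R2 -> R) : C1on W f f1 f2 ->
  C1on U a a1 a2 -> C1on U b b1 b2 -> (forall x, U x -> W (a x, b x)) ->
  C1on U (fun x => f (a x, b x))
    (fun x => f1 (a x, b x) * a1 x + f2 (a x, b x) * b1 x)
    (fun x => f1 (a x, b x) * a2 x + f2 (a x, b x) * b2 x).
Proof.
move=> hf ha hb UW x Ux; have [da ca1 ca2] := ha _ Ux; have [db cb1 cb2] := hb _ Ux.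
have [df cf1 cf2] := hf _ (UW _ Ux).
have cab : {for x, continuous (fun x => (a x, b x))}.
  by apply: differentiable_continuous; apply: differentiable_pair; [case: da|case: db].
split; last 2 first.
- by apply: cvgD; apply: cvgM => //; apply: (continuous_comp cab).
- by apply: cvgD; apply: cvgM => //; apply: (continuous_comp cab).
apply: (@is_diff_eq _ _ _ (f \o (fun x => (a x, b x)))).
by apply/funext => v /=; rewrite /dot_grad /=; ring.
Qed.

Lemma C1onV U f f1 f2 : C1on U f f1 f2 -> (forall x, U x -> f x != 0) ->
  C1on U (fun x => (f x)^-1) (fun x => - (f x) ^- 2 * f1 x) (fun x => - (f x) ^- 2 * f2 x).
Proof.
move=> hf f0; apply: (C1on_compr (g := fun y => y^-1) (g' := fun y => - y ^- 2) hf) => x /f0 fx0.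
split.
  by apply: (is_derive_eq (is_deriveV (f := id) fx0 _)); rewrite /GRing.scale /= mulr1.
apply: cvgN; apply: cvgV; first by rewrite expf_neq0.
exact: exprn_continuous.
Qed.

Lemma C1on_derive U f f1 f2 v x : C1on U f f1 f2 -> U x ->
  derivable f x v /\ 'D_v f x = v.1 * f1 x + v.2 * f2 x.
Proof.
move=> hf Ux; have [[df dfE] _ _] := hf _ Ux; split; first exact: diff_derivable.
by rewrite deriveE// dfE.
Qed.

Lemma is_derive_section1 (f : R2 -> R) x y : derivable f (x, y) (e1 : R2) ->
  is_derive x 1 (fun s => f (s, y)) ('D_(e1 : R2) f (x, y)).
Proof.
have E : (fun h : R => h^-1 *: (f (h *: (e1 : R2) + (x, y)) - f (x, y))) =
         (fun h : R => h^-1 *: (f (h *: (1 : R) + x, y) - f (x, y))).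
  apply/funext => h; congr (_ *: (f _ - _)).
  rewrite -[LHS]/(h * 1 + x, h * 0 + y); congr pair; by rewrite mulr0 add0r.
by move=> df; split; rewrite /derivable /derive /= -E.
Qed.

Lemma is_derive_section2 (f : R2 -> R) x y : derivable f (x, y) (e2 : R2) ->
  is_derive y 1 (fun s => f (x, s)) ('D_(e2 : R2) f (x, y)).
Proof.
have E : (fun h : R => h^-1 *: (f (h *: (e2 : R2) + (x, y)) - f (x, y))) =
         (fun h : R => h^-1 *: (f (x, h *: (1 : R) + y) - f (x, y))).
  apply/funext => h; congr (_ *: (f _ - _)).
  rewrite -[LHS]/(h * 0 + x, h * 1 + y); congr pair; by rewrite mulr0 add0r.
by move=> df; split; rewrite /derivable /derive /= -E.
Qed.

Lemma C1on_section1 U f f1 f2 (x y : R) : C1on U f f1 f2 -> U (x, y) ->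
  is_derive x 1 (fun s => f (s, y)) (f1 (x, y)).
Proof.
move=> hf Ux; have [df dE] := C1on_derive (e1 : R2) hf Ux.
by apply: (is_derive_eq (is_derive_section1 df)); rewrite dE /= mul1r mul0r addr0.
Qed.

Lemma C1on_section2 U f f1 f2 (x y : R) : C1on U f f1 f2 -> U (x, y) ->
  is_derive y 1 (fun s => f (x, s)) (f2 (x, y)).
Proof.
move=> hf Ux; have [df dE] := C1on_derive (e2 : R2) hf Ux.
by apply: (is_derive_eq (is_derive_section2 df)); rewrite dE /= mul1r mul0r add0r.
Qed.

Lemma C1on_eq U f f1 f2 g g1 g2 : (forall x, f x = g x) ->
  (forall x, f1 x = g1 x) -> (forall x, f2 x = g2 x) ->
  C1on U g g1 g2 -> C1on U f f1 f2.
Proof. by move=> /funext -> /funext -> /funext ->. Qed.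
Lemma C1onN U f f1 f2 : C1on U f f1 f2 ->
  C1on U (fun x => - f x) (fun x => - f1 x) (fun x => - f2 x).
Proof.
move=> hf; apply: C1on_eq (C1onM (@C1on_cst U (-1)) hf) => x; ring.
Qed.

Lemma C1onB U f f1 f2 g g1 g2 : C1on U f f1 f2 -> C1on U g g1 g2 ->
  C1on U (fun x => f x - g x) (fun x => f1 x - g1 x) (fun x => f2 x - g2 x).
Proof. by move=> hf hg; apply: C1onD hf (C1onN hg). Qed.

End C1_functions.

(** * Cut-offs, weak forms and their localization *)

Section test_functions.
Context {R : realType}.
Local Notation R2 := (R * R)%type.

Lemma N2E (x : R2) : N2 x = `|x|.
Proof. by rewrite prod_normE. Qed.

Lemma C1on_zero U f f1 f2 (x : R2) : C1on setT f f1 f2 -> open U -> U x ->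
  (forall y, U y -> f y = 0) -> f1 x = 0 /\ f2 x = 0.
Proof.
move=> hf oU Ux f0; have [df _ _] := hf x I.
have nU : nbhs x U by exact: open_nbhs_nbhs.
have dD v : dot_grad (f1 x) (f2 x) v = 0.
  have [dfx dfE] := df; rewrite -dfE -deriveE//.
  rewrite (@near_eq_derive _ _ _ f (cst 0)) ?derive_cst//.
  by apply: filterS nU => y /f0 ->.
by split; [rewrite -(dD e1)|rewrite -(dD e2)]; rewrite /dot_grad /=; ring.
Qed.

Lemma N2_gt_open M : open [set x : R2 | M < N2 x].
Proof.
rewrite (_ : [set x | _] = [set x : R2 | M < `|x|]).
  apply: (@open_comp _ _ (fun y : R2 => `|y|) [set y : R | M < y]); last exact: open_gt.
  by move=> *; exact: norm_continuous.
by apply/seteqP; split=> x /=; rewrite N2E.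
Qed.

Lemma C1on_zero_far f f1 f2 M : C1on setT f f1 f2 ->
  (forall x : R2, M < N2 x -> f x = 0) -> forall x : R2, M < N2 x -> f1 x = 0 /\ f2 x = 0.
Proof. by move=> hf f0 x Mx; exact: (C1on_zero hf (@N2_gt_open M) Mx f0). Qed.

Lemma C1on_bcf f f1 f2 M : C1on setT f f1 f2 -> (forall x : R2, M < N2 x -> f x = 0) ->
  [/\ bcf N2 f, bcf N2 f1 & bcf N2 f2].
Proof.
move=> hf f0; have z := C1on_zero_far hf f0.
split; apply: (@bcf2_continuous _ _ M) => //.
- by move=> x; exact: C1on_continuous hf I.
- by move=> x; have [] := hf x I.
- by move=> x /z[].
- by move=> x; have [] := hf x I.
- by move=> x /z[].
Qed.

Lemma continuous_pairl (y : R) : continuous (fun s : R => (s, y)).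
Proof.
by move=> x; apply: (@differentiable_continuous _ _ _ x (fun s : R => (s, y))); apply: differentiable_pair.
Qed.

Lemma continuous_pairr (x : R) : continuous (fun s : R => (x, s)).
Proof.
by move=> y; apply: (@differentiable_continuous _ _ _ y (fun s : R => (x, s))); apply: differentiable_pair.
Qed.

Lemma I2_grad1 f f1 f2 M : C1on setT f f1 f2 -> (forall x : R2, M < N2 x -> f x = 0) ->
  I2 f1 = 0.
Proof.
move=> hf f0; have [bf bf1 bf2] := C1on_bcf hf f0.
rewrite (I2_Fubini2 bf1) -[RHS](Int0 (@lebesgue_measure R)); apply: eq_Rintegral => y _.
apply: (@Int_derive_eq0 _ (fun x => f (x, y)) _ M).
- by move=> x; exact: (C1on_section1 hf).
- move=> x; apply: (continuous_comp (f := fun s => (s, y)) (g := f1)).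
    exact: continuous_pairl.
  by have [_ ? _] := hf (x, y) I.
- by move=> x Mx; apply: f0; rewrite (lt_le_trans Mx)//; exact: (N2_fst (x, y)).
Qed.

Lemma I2_grad2 f f1 f2 M : C1on setT f f1 f2 -> (forall x : R2, M < N2 x -> f x = 0) ->
  I2 f2 = 0.
Proof.
move=> hf f0; have [bf bf1 bf2] := C1on_bcf hf f0.
rewrite (I2_Fubini1 bf2) -[RHS](Int0 (@lebesgue_measure R)); apply: eq_Rintegral => x _.
apply: (@Int_derive_eq0 _ (fun y => f (x, y)) _ M).
- by move=> y; exact: (C1on_section2 hf).
- move=> y; apply: (continuous_comp (f := fun s => (x, s)) (g := f2)).
    exact: continuous_pairr.
  by have [_ _ ?] := hf (x, y) I.
- by move=> y My; apply: f0; rewrite (lt_le_trans My)//; exact: (N2_snd (x, y)).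
Qed.

Definition sqpos (t : R) : R := (Num.max 0 t) ^+ 2.

Lemma is_derive_sqpos (t : R) : is_derive t 1 sqpos (2 * Num.max 0 t).
Proof.
have [t0|t0|->] := ltrgtP t 0.
- apply: (@near_eq_is_derive _ _ _ (cst 0)).
    have := open_nbhs_nbhs (conj (@open_lt R 0) t0).
    by apply: filterS => y /= y0; rewrite /sqpos max_l ?expr0n// ltW.
  by apply: is_derive_eq; rewrite mulr0.
- apply: (@near_eq_is_derive _ _ _ (fun y : R => y ^+ 2)).
    have := open_nbhs_nbhs (conj (@open_gt R 0) t0).
    by apply: filterS => y /= y0; rewrite /sqpos max_r// ltW.
  apply: (is_derive_eq (is_deriveX (f := id : R -> R) 2 (is_derive_id t (1 : R)))).
  by rewrite /= /GRing.scale /=; ring.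
- have H : h^-1 *: (sqpos (h *: 1 + 0) - sqpos 0) @[h --> (0 : R)^'] --> (0 : R).
    apply/cvgr0Pnorm_le => e e0; near=> h.
    have h0 : h != 0 by near: h; exact: nbhs_dnbhs_neq.
    rewrite /sqpos /GRing.scale /= mulr1 addr0 maxxx expr0n subr0 normrM normfV.
    have hm : `|Num.max 0 h| <= `|h|.
      by have [h1|h1] := leP 0 h => //; rewrite normr0.
    rewrite ler_pdivrMl ?normr_gt0// normrX expr2 ler_pM ?normr_ge0//.
    rewrite (le_trans hm)//; near: h.
    by apply: dnbhs0_le.
    by rewrite mulr0; split; [apply/cvg_ex; exists 0|exact: cvg_lim].
Unshelve. all: by end_near. Qed.

(** On [[0, 1]] this is [1 - (1 - t^2)^2], whose derivative vanishes at both ends. One continuous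
    derivative is enough, since the weak forms are tested with C^1 functions. *)
Definition step (t : R) : R := 1 - sqpos (1 - sqpos t).
Definition step' (t : R) : R := 4 * Num.max 0 (1 - sqpos t) * Num.max 0 t.

Lemma continuous_max0 : continuous (fun t : R => Num.max 0 t).
Proof.
move=> t; apply/cvgrPdist_le => e e0; near=> s.
have : `|t - s| <= e by near: s; exact: cvgr_dist_le.
rewrite !ler_norml => /andP[h1 h2].
by have [h3|h3] := leP 0 t; have [h4|h4] := leP 0 s; apply/andP; split; lra.
Unshelve. all: by end_near. Qed.

Lemma is_derive_step (t : R) : is_derive t 1 step (step' t).
Proof.
have d1 := is_derive_sqpos t.
have d2 : is_derive t 1 (fun t => 1 - sqpos t) (0 - 2 * Num.max 0 t) by apply: is_deriveB.
have d3 := @is_derive1_comp _ sqpos (fun t => 1 - sqpos t) t _ _ (is_derive_sqpos (1 - sqpos t)) d2.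
by apply: (is_derive_eq (is_deriveB (is_derive_cst (1 : R) t 1) d3)); rewrite /step'; ring.
Qed.

Lemma continuous_step' : continuous step'.
Proof.
move=> t; apply: cvgM; last exact: continuous_max0.
apply: cvgM; first exact: cvg_cst.
apply: (@continuous_comp _ _ _ (fun x => 1 - sqpos x) (fun t : R => Num.max 0 t) t); last exact: continuous_max0.
apply: cvgB; first exact: cvg_cst.
apply: differentiable_continuous; apply/derivable1_diffP; by case: (is_derive_sqpos t).
Qed.

Lemma sqpos_ge0 t : 0 <= sqpos t. Proof. exact: sqr_ge0. Qed.

Lemma step_le0 t : t <= 0 -> step t = 0.
Proof. by move=> t0; rewrite /step /sqpos (max_l t0) expr0n subr0 max_r// expr1n subrr. Qed.

Lemma step_ge1 t : 1 <= t -> step t = 1.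
Proof.
move=> t1; rewrite /step /sqpos (max_r (le_trans ler01 t1)) max_l ?expr0n ?subr0//.
by rewrite subr_le0 expr_ge1// (le_trans ler01).
Qed.

Lemma step_itv t : 0 <= step t <= 1.
Proof.
rewrite /step; have := sqpos_ge0 t; set u := sqpos t => u0.
rewrite subr_ge0 lerBlDr lerDl sqpos_ge0 andbT /sqpos expr_le1//.
  by rewrite ge_max ler01 lerBlDr lerDl.
by rewrite le_max lexx.
Qed.

(** The factor 2 brings the argument of [step] to at least 1 as soon as [2 t^2 <= r^2], hence for
    [|t| <= r / 2]. *)
Definition hat (r t : R) : R := step (2 * (r ^+ 2 - t ^+ 2) / r ^+ 2).

Lemma hat_out r t : 0 < r -> r <= `|t| -> hat r t = 0.
Proof.
move=> r0 rt; apply: step_le0; rewrite pmulr_lle0 ?invr_gt0 ?exprn_gt0//.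
rewrite pmulr_rle0// subr_le0 -[leRHS]real_normK ?num_real//.
by rewrite ler_sqr ?nnegrE// ltW.
Qed.

Lemma hat_in r t : 0 < r -> `|t| <= r / 2 -> hat r t = 1.
Proof.
move=> r0 rt; apply: step_ge1; rewrite ler_pdivlMr ?exprn_gt0// mul1r.
have : `|t| ^+ 2 <= (r / 2) ^+ 2 by rewrite ler_sqr ?nnegrE// ltW// divr_gt0.
rewrite real_normK ?num_real//; have : 0 <= r ^+ 2 by exact: sqr_ge0.
rewrite exprMn exprVn; set a := r ^+ 2; set b := t ^+ 2; lra.
Qed.

Definition cutoff (a : R2) (r : R) (x : R2) : R := hat r (x.1 - a.1) * hat r (x.2 - a.2).

Lemma cutoff_out a r x : 0 < r -> r <= N2 (x - a) -> cutoff a r x = 0.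
Proof.
move=> r0; rewrite /N2 /gauge_prod le_max => /orP[] h; rewrite /cutoff.
  by rewrite hat_out ?mul0r.
by rewrite [X in _ * X]hat_out ?mulr0.
Qed.

Lemma cutoff_in a r x : 0 < r -> N2 (x - a) <= r / 2 -> cutoff a r x = 1.
Proof.
move=> r0; rewrite /N2 /gauge_prod ge_max => /andP[h1 h2].
by rewrite /cutoff !hat_in// mulr1.
Qed.

Lemma cutoff_C1 a r : exists c1 c2, C1on setT (cutoff a r) c1 c2.
Proof.
have C U (f f1 f2 : R2 -> R) : C1on U f f1 f2 -> C1on U (fun x => hat r (f x))
   (fun x => step' (2 * (r ^+ 2 - f x ^+ 2) / r ^+ 2) * ((2 * (0 - (f1 x * f x + f x * f1 x))) / r ^+ 2))
   (fun x => step' (2 * (r ^+ 2 - f x ^+ 2) / r ^+ 2) * ((2 * (0 - (f2 x * f x + f x * f2 x))) / r ^+ 2)).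
  move=> hf.
  have h1 := C1onB (@C1on_cst R U (r ^+ 2)) (C1onM hf hf).
  have h2 := C1onM (C1onM (@C1on_cst R U 2) h1) (@C1on_cst R U (r ^+ 2)^-1).
  have h3 : C1on U (fun x => 2 * (r ^+ 2 - f x ^+ 2) / r ^+ 2)
    (fun x => (2 * (0 - (f1 x * f x + f x * f1 x))) / r ^+ 2) (fun x => (2 * (0 - (f2 x * f x + f x * f2 x))) / r ^+ 2).
    by apply: C1on_eq h2 => x; ring.
  by apply: C1on_compr h3 _ => x _; split; [exact: is_derive_step|exact: continuous_step'].
have d1 := C _ _ _ _ (C1onB (@C1on_fst R setT) (@C1on_cst R setT a.1)).
have d2 := C _ _ _ _ (C1onB (@C1on_snd R setT) (@C1on_cst R setT a.2)).
by eexists; eexists; exact: (C1onM d1 d2).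
Qed.

Lemma N2_ball_open (a : R2) r : open [set x : R2 | N2 (x - a) < r].
Proof.
rewrite (_ : [set x | _] = [set x : R2 | `|x - a| < r]).
  apply: (@open_comp _ _ (fun y : R2 => `|y - a|) [set y : R | y < r]); last exact: open_lt.
  move=> x _; apply: (@continuous_comp _ _ _ (fun y : R2 => y - a) (fun y : R2 => `|y|)).
    by apply: (@differentiable_continuous _ _ _ x (fun y : R2 => y - a)).
  exact: norm_continuous.
by apply/seteqP; split=> x /=; rewrite N2E.
Qed.

(** Its vanishing expresses [div A = b]; the functions [f1], [f2] stand for the gradient of the test
    [f]. *)
Definition weak_form (A1 A2 b f f1 f2 : R2 -> R) : R :=
  I2 (fun x => A1 x * f1 x + A2 x * f2 x + b x * f x).

(** For fields extended by zero from a domain this also says that the normal flux vanishes on the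
    boundary, which [weak_identity_in] does not see. *)
Definition weak_identity (A1 A2 b : R2 -> R) : Prop := forall f f1 f2 M,
  C1on setT f f1 f2 -> (forall x, M < N2 x -> f x = 0) -> weak_form A1 A2 b f f1 f2 = 0.

Definition weak_identity_in (Omega : set R2) (A1 A2 b : R2 -> R) : Prop := forall f f1 f2,
  C1on setT f f1 f2 ->
  (exists K, [/\ compact K, K `<=` Omega & forall x, f x != 0 -> K x]) ->
  weak_form A1 A2 b f f1 f2 = 0.

Section localization.
Variables (A1 A2 b : R2 -> R).
Hypotheses (bA1 : bcf N2 A1) (bA2 : bcf N2 A2) (bb : bcf N2 b).

Lemma bcf_mul_continuous (A f : R2 -> R) : bcf N2 A -> continuous f ->
  bcf N2 (fun x => A x * f x).
Proof.
move=> bA cf.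
have -> : (fun x => A x * f x) = (fun x => f x * A x) by apply/funext => x; rewrite mulrC.
apply: bcf_bounded_mul => //; first exact: continuous_measurable2.
by move=> M; exact: continuous_N2_bound.
Qed.

Lemma weak_form_bcf f f1 f2 : C1on setT f f1 f2 ->
  bcf N2 (fun x => A1 x * f1 x + A2 x * f2 x + b x * f x).
Proof.
move=> hf; apply: bcfD; [apply: bcfD|]; apply: bcf_mul_continuous => // x.
- by have [] := hf x I.
- by have [] := hf x I.
- exact: C1on_continuous hf I.
Qed.

Lemma weak_formD f f1 f2 g g1 g2 : C1on setT f f1 f2 -> C1on setT g g1 g2 ->
  weak_form A1 A2 b (fun x => f x + g x) (fun x => f1 x + g1 x) (fun x => f2 x + g2 x)
  = weak_form A1 A2 b f f1 f2 + weak_form A1 A2 b g g1 g2.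
Proof.
move=> hf hg; rewrite /weak_form /I2 -(IntD lf2) //; try exact: weak_form_bcf.
by apply: eq_Rintegral => x _; ring.
Qed.

Definition weak_in_ball (p : R2 * R) := forall f f1 f2, C1on setT f f1 f2 ->
  (forall x, p.2 <= N2 (x - p.1) -> f x = 0) -> weak_form A1 A2 b f f1 f2 = 0.

(** This takes the place of a partition of unity. Writing [f = c f + (1 - c) f], with a cut-off [c]
    equal to 1 on the half ball, peels off one ball at a time, and the remainder vanishes on that
    half ball. *)
Lemma weak_form_cover (s : seq (R2 * R)) :
  (forall p, p \in s -> 0 < p.2 /\ weak_in_ball p) ->
  forall f f1 f2, C1on setT f f1 f2 ->
  (forall x, f x != 0 -> exists2 p, p \in s & N2 (x - p.1) < p.2 / 2) ->
  weak_form A1 A2 b f f1 f2 = 0.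
Proof.
elim: s => [_ f f1 f2 hf f0|p s IH hs f f1 f2 hf f0].
  have fz x : f x = 0 by apply/eqP/negP => /negP /f0[].
  have fz1 (x : R2) : f1 x = 0 /\ f2 x = 0 := C1on_zero hf openT (I : setT x) (fun y _ => fz y).
  rewrite /weak_form -[RHS](Int0 (@mu2 R)); apply: eq_Rintegral => x _.
  by have [-> ->] := fz1 x; rewrite fz !mulr0 !addr0.
have [p0 hp] := hs p (mem_head _ _).
have [c1 [c2 hc]] := cutoff_C1 p.1 p.2.
have h1 := C1onM hc hf; have h2 := C1onM (C1onB (@C1on_cst R setT 1) hc) hf.
have z1 := hp _ _ _ h1 _.
have z2 := IH _ _ _ _ h2 _.
have E : weak_form A1 A2 b f f1 f2 = 0 + 0.
  rewrite -[X in X + _]z1; last by move=> x hx; rewrite cutoff_out// mul0r.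
  rewrite -[X in _ + X]z2 -?weak_formD//.
  - rewrite /weak_form; apply: eq_Rintegral => x _; ring.
  - by move=> q qs; apply: hs; rewrite in_cons qs orbT.
  - move=> x; rewrite mulf_eq0 negb_or => /andP[cx /f0[q]].
    rewrite in_cons => /orP[/eqP ->|]; last by exists q.
    by move=> h; move: cx; rewrite cutoff_in ?subrr ?eqxx// ltW.
by rewrite E addr0.
Qed.

Lemma weak_form_local (K : set R2) : compact K ->
  (forall x, K x -> exists2 r, 0 < r & weak_in_ball (x, r)) ->
  forall f f1 f2, C1on setT f f1 f2 -> (forall x, f x != 0 -> K x) ->
  weak_form A1 A2 b f f1 f2 = 0.
Proof.
move=> cK Kb f f1 f2 hf fK.
pose good (s : seq (R2 * R)) := forall p, p \in s -> 0 < p.2 /\ weak_in_ball p.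
(* [F] is the filter of tails of the good finite lists ordered by inclusion. With it, the
   [near_covering] form of compactness yields a single list whose half balls cover [K]. *)
pose F (A : set (seq (R2 * R))) := exists2 s, good s &
  forall s', good s' -> {subset s <= s'} -> A s'.
have FF : Filter F.
  split; first by exists [::].
  - move=> A B [s gs sA] [t gt tB]; exists (s ++ t).
      by move=> p; rewrite mem_cat => /orP[/gs|/gt].
    move=> u gu su; split; [apply: sA|apply: tB] => // p ps; apply: su.
      by rewrite mem_cat ps.
    by rewrite mem_cat ps orbT.
  - by move=> A B AB [s gs sA]; exists s => // s' gs' /(sA _ gs')/AB.
have near_cov : near_covering K by apply/compact_near_coveringP.
have [|s gs /(_ s gs (fun=> id)) sK] := near_cov _ F
  (fun s x => exists2 p, p \in s & N2 (x - p.1) < p.2 / 2) FF.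
  move=> x Kx; have [r r0 hr] := Kb _ Kx.
  exists ([set y | N2 (y - x) < r / 2], [set s | good s /\ (x, r) \in s]).
    split; last first.
      exists [:: (x, r)]; first by move=> p; rewrite inE => /eqP ->.
      by move=> s' gs' h; split => //; apply: h; rewrite mem_head.
    apply: open_nbhs_nbhs; split; first exact: N2_ball_open.
    by rewrite /= subrr /N2 /gauge_prod /N1 /= normr0 maxxx divr_gt0.
  by move=> [y s] [/= yx [gs xs]]; exists (x, r).
by apply: (@weak_form_cover s) hf _ => // x /fK /sK.
Qed.
End localization.
End test_functions.

(** * Mollification *)

Section flat_exponential.
Context {R : realType}.
Implicit Types (q : {poly R}) (s t u : R).

(* The derivatives of [exp (- 1 / t)], extended by zero, are all of this form. *)
Definition flat q t : R := if 0 < t then q.[t^-1] * expR (- t^-1) else 0.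

(** With [u = 1 / t], the derivative of [q(u) exp(- u)] in [t] is [u^2 (q - q')(u) exp(- u)]. *)
Definition flat_next q : {poly R} := 'X^2 * (q - q^`()).

Lemma poly_bound q : exists2 C : R, 0 <= C & forall u, 1 <= u -> `|q.[u]| <= C * u ^+ size q.
Proof.
exists (\sum_(i < size q) `|q`_i|); first exact: sumr_ge0.
move=> u u1; rewrite horner_coef (le_trans (ler_norm_sum _ _ _))// mulr_suml ler_sum// => i _.
rewrite normrM ler_wpM2l// normrX ger0_norm ?(le_trans ler01)//.
by rewrite ler_weXn2l// ltnW.
Qed.

(** This is [exp(u / n) >= u / n] raised to the power [n = m.+1] and inverted. *)
Lemma expRN_bound (m : nat) u : 0 < u -> expR (- u) <= m.+1%:R ^+ m.+1 * u ^- m.+1.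
Proof.
move=> u0; rewrite expRN -exprVn -exprMn -[leRHS]invrK.
rewrite lef_pV2 ?posrE ?expR_gt0 ?invr_gt0 ?exprn_gt0 ?mulr_gt0 ?invr_gt0//.
have -> : expR u = expR (u / m.+1%:R) ^+ m.+1 by rewrite -expRM_natl mulrC divfK.
rewrite -exprVn ler_pXn2r ?nnegrE ?expR_ge0 ?invr_ge0 ?mulr_ge0 ?invr_ge0 ?(ltW u0)//.
by rewrite invfM invrK mulrC (le_trans _ (expR_ge1Dx _))// lerDr.
Qed.

(** The exponential beats the growth of [q] with two powers of [t] to spare. One would give
    continuity at 0; two give the derivative 0 there. *)
Lemma flat_bound q : exists2 C : R, 0 <= C & forall t, `|t| <= 1 -> `|flat q t| <= C * t ^+ 2.
Proof.
have [C C0 hC] := poly_bound q; set n := size q in hC.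
exists (C * n.+2%:R ^+ n.+2) => [|t]; first by rewrite mulr_ge0// exprn_ge0.
rewrite /flat; case: ifPn => [t0|_ _]; last by rewrite normr0 mulr_ge0 ?sqr_ge0// mulr_ge0// exprn_ge0.
rewrite gtr0_norm// => t1; rewrite normrM (ger0_norm (expR_ge0 _)).
have u0 : 0 < t^-1 by rewrite invr_gt0.
have u1 : 1 <= t^-1 by rewrite invf_ge1.
apply: le_trans (ler_pM (normr_ge0 _) (expR_ge0 _) (hC _ u1) (expRN_bound n.+1 u0)) _.
set N := n.+2%:R ^+ n.+2; rewrite -(addn2 n) exprD.
have aN0 : t^-1 ^+ n != 0 by rewrite expf_neq0// gt_eqF.
have tN0 : t != 0 by rewrite gt_eqF.
suff -> : C * t^-1 ^+ n * (N / (t^-1 ^+ n * t^-1 ^+ 2)) = C * N * t ^+ 2 by [].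
by set a := t^-1 ^+ n in aN0 *; field; rewrite aN0 tN0.
Qed.

Lemma is_derive_flat q t : is_derive t 1 (flat q) (flat (flat_next q) t).
Proof.
have [t0|t0|->] := ltrgtP t 0.
- apply: (@near_eq_is_derive _ _ _ (cst 0)).
    have := open_nbhs_nbhs (conj (@open_lt R 0) t0).
    by apply: filterS => y /= y0; rewrite /flat ltNge ltW.
  by apply: is_derive_eq; rewrite /flat ltNge ltW.
- apply: (@near_eq_is_derive _ _ _ (fun y : R => q.[y^-1] * expR (- y^-1))).
    have := open_nbhs_nbhs (conj (@open_gt R 0) t0).
    by apply: filterS => y /= y0; rewrite /flat y0.
  have tN0 : t != 0 by rewrite gt_eqF.
  have dV : is_derive t 1 (fun y : R => y^-1) (- t ^- 2).
    by apply: (is_derive_eq (is_deriveV (f := id) tN0 _)); rewrite /GRing.scale /= mulr1.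
  have dq : is_derive t 1 (fun y : R => q.[y^-1]) (q^`().[t^-1] * - t ^- 2).
    by apply: (@is_derive1_comp _ (horner q) (fun y : R => y^-1)); exact: is_derive_poly.
  have de : is_derive t 1 (fun y : R => expR (- y^-1)) (expR (- t^-1) * - (- t ^- 2)).
    by apply: (@is_derive1_comp _ expR (fun y : R => - y^-1)).
  apply: (is_derive_eq (is_deriveM dq de)).
  rewrite /flat t0 /flat_next hornerM hornerXn hornerD hornerN /GRing.scale /= -exprVn; ring.
- have [C C0 hC] := flat_bound q.
  have H : h^-1 *: (flat q (h *: 1 + 0) - flat q 0) @[h --> (0 : R)^'] --> (0 : R).
    apply/cvgr0Pnorm_le => e e0; near=> h.
    have h0 : h != 0 by near: h; exact: nbhs_dnbhs_neq.
    have h1 : `|h| <= 1 by near: h; exact: dnbhs0_le.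
    have h2 : `|h| <= e / (C + 1) by near: h; apply: dnbhs0_le; rewrite divr_gt0// ltr_wpDl.
    rewrite /GRing.scale /= mulr1 addr0 {2}/flat ltxx subr0 normrM normfV.
    rewrite ler_pdivrMl ?normr_gt0// (le_trans (hC _ h1))//.
    rewrite -(real_normK (num_real h)) expr2 mulrCA ler_wpM2l//.
    have : (C + 1) * `|h| <= e by rewrite mulrC -ler_pdivlMr// ltr_wpDl.
    by apply: le_trans; rewrite ler_wpM2r// lerDl.
  by rewrite {2}/flat ltxx; split; [apply/cvg_ex; exists 0|exact: cvg_lim].
Unshelve. all: by end_near. Qed.

Lemma continuous_flat q : continuous (flat q).
Proof.
by move=> t; apply: differentiable_continuous; apply/derivable1_diffP; case: (is_derive_flat q t).
Qed.

End flat_exponential.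

Section smooth_functions.
Context {R : realType}.
Local Notation R2 := (R * R)%type.

(* Stable under partial derivatives, hence made of smooth functions. *)
Inductive elementary : (R2 -> R) -> Prop :=
| elementary_cst k : elementary (fun=> k)
| elementary_fst : elementary fst
| elementary_snd : elementary snd
| elementaryD f g : elementary f -> elementary g -> elementary (fun x => f x + g x)
| elementaryM f g : elementary f -> elementary g -> elementary (fun x => f x * g x)
| elementary_flat q f : elementary f -> elementary (fun x => flat q (f x)).

Lemma elementary_C1 f : elementary f ->
  exists f1 f2, [/\ C1on setT f f1 f2, elementary f1 & elementary f2].
Proof.
elim=> {f} [k|||f g ef [f1 [f2 [hf ef1 ef2]]] eg [g1 [g2 [hg eg1 eg2]]]
  |f g ef [f1 [f2 [hf ef1 ef2]]] eg [g1 [g2 [hg eg1 eg2]]]|q f ef [f1 [f2 [hf ef1 ef2]]]].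
- by do 2 eexists; split; [exact: C1on_cst|constructor|constructor].
- by do 2 eexists; split; [exact: C1on_fst|constructor|constructor].
- by do 2 eexists; split; [exact: C1on_snd|constructor|constructor].
- by do 2 eexists; split; [exact: C1onD hf hg|exact: elementaryD|exact: elementaryD].
- by do 2 eexists; split; [exact: C1onM hf hg|..]; apply: elementaryD; exact: elementaryM.
- have h := @C1on_compr _ setT f f1 f2 (flat q) (flat (flat_next q)) hf
    (fun x _ => conj (is_derive_flat q (f x)) (@continuous_flat _ (flat_next q) (f x))).
  by do 2 eexists; split; [exact: h|..]; apply: elementaryM => //; exact: elementary_flat.
Qed.

Lemma elementary_derive f v : elementary f -> elementary (fun x => 'D_v f x).
Proof.
move=> ef; have [f1 [f2 [hf ef1 ef2]]] := elementary_C1 ef.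
have -> : (fun x => 'D_v f x) = (fun x => v.1 * f1 x + v.2 * f2 x).
  by apply/funext => x; have [_ ->] := C1on_derive v hf (I : setT x).
by apply: elementaryD; apply: elementaryM => //; constructor.
Qed.

Lemma elementary_smooth f : elementary f -> smooth f.
Proof.
move=> ef vs x; suff : elementary (Defs.iterD vs f).
  by move=> /elementary_C1[f1 [f2 [hf _ _]]]; have [[]] := hf x I.
by elim: vs => //= v vs IH; exact: elementary_derive.
Qed.

Definition bump1 (r t : R) : R := flat 1 (r ^+ 2 - t ^+ 2).
Definition bump1' (r t : R) : R := flat (flat_next 1) (r ^+ 2 - t ^+ 2) * (- 2 * t).

(** Centred at [y] and not normalized: its mass is divided out only when the radius tends to 0. As a
    product of functions of one variable it is supported in a ball of [N2]. *)
Definition bump (r : R) (y x : R2) : R := bump1 r (x.1 - y.1) * bump1 r (x.2 - y.2).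
Definition bump_1 (r : R) (y x : R2) : R := bump1' r (x.1 - y.1) * bump1 r (x.2 - y.2).
Definition bump_2 (r : R) (y x : R2) : R := bump1 r (x.1 - y.1) * bump1' r (x.2 - y.2).

Lemma bump1_ge0 r t : 0 <= bump1 r t.
Proof. by rewrite /bump1 /flat hornerC mul1r; case: ifP => // _; exact: expR_ge0. Qed.

Lemma bump1_out r t : 0 < r -> r <= `|t| -> bump1 r t = 0 /\ bump1' r t = 0.
Proof.
move=> r0 rt; have h : (0 < r ^+ 2 - t ^+ 2) = false.
  apply/negbTE; rewrite -leNgt subr_le0 -[leRHS]real_normK ?num_real//.
  by rewrite ler_sqr ?nnegrE// ltW.
by rewrite /bump1 /bump1' /flat h mul0r.
Qed.

Lemma bump_ge0 r y x : 0 <= bump r y x.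
Proof. by rewrite /bump mulr_ge0// bump1_ge0. Qed.

Lemma bump_out r y x : 0 < r -> r <= N2 (x - y) ->
  [/\ bump r y x = 0, bump_1 r y x = 0 & bump_2 r y x = 0].
Proof.
move=> r0; rewrite /N2 /gauge_prod le_max /bump /bump_1 /bump_2 => /orP[] /(bump1_out r0)[h1 h2].
  by rewrite -![(x - y).1]/(x.1 - y.1) in h1 h2; rewrite h1 h2 !mul0r.
by rewrite -![(x - y).2]/(x.2 - y.2) in h1 h2; rewrite h1 h2 !mulr0.
Qed.

Lemma bump1_C1 r U f f1 f2 : C1on U f f1 f2 ->
  C1on U (fun x => bump1 r (f x)) (fun x => bump1' r (f x) * f1 x) (fun x => bump1' r (f x) * f2 x).
Proof.
move=> hf; have h1 := C1onB (@C1on_cst R U (r ^+ 2)) (C1onM hf hf).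
have h2 := @C1on_compr _ U _ _ _ (flat 1) (flat (flat_next 1)) h1
    (fun x _ => conj (is_derive_flat _ _) (@continuous_flat _ _ _)).
by apply: C1on_eq h2 => x; rewrite /= /bump1 /bump1' ?expr2 //; ring.
Qed.

Lemma bump_C1 r y : C1on setT (bump r y) (bump_1 r y) (bump_2 r y).
Proof.
have h1 := bump1_C1 r (C1onB (@C1on_fst R setT) (@C1on_cst R setT y.1)).
have h2 := bump1_C1 r (C1onB (@C1on_snd R setT) (@C1on_cst R setT y.2)).
by apply: C1on_eq (C1onM h1 h2) => x; rewrite /bump_1 /bump_2 //; ring.
Qed.

Lemma bump_elementary r y : elementary (bump r y).
Proof.
have e1 f k : elementary f -> elementary (fun x => bump1 r (f x - k)).
  move=> ef; apply: elementary_flat; apply: elementaryD; first by constructor.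
  have -> : (fun x => - (f x - k) ^+ 2) = (fun x => (-1) * ((f x + - k) * (f x + - k))).
    by apply/funext => x; rewrite expr2 mulN1r.
  apply: elementaryM; first by constructor.
  by apply: elementaryM; apply: elementaryD => //; constructor.
by apply: elementaryM; apply: e1; constructor.
Qed.

(** Bumps are the only tests to which the distributional equation is applied; all C^1 tests are
    reached from them by convolution. *)
Lemma bump_test (U : set R2) r y : 0 < r -> (forall x, N2 (x - y) <= r -> U x) ->
  test_function U (bump r y).
Proof.
move=> r0 hU.
have cB : closed [set x : R2 | N2 (x - y) <= r].
  rewrite (_ : [set x | _] = ~` [set x | r < N2 (x - y)]); last first.
    by apply/seteqP; split=> x /=; rewrite leNgt => /negP.
  apply: open_closedC.
  have := @open_comp _ _ (fun x : R2 => x - y) [set z | r < N2 z].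
  apply; last exact: N2_gt_open.
  by move=> x _; apply: (@differentiable_continuous _ _ _ x (fun y0 : R2 => y0 - y)).
have sub : tsupport (bump r y) `<=` [set x : R2 | N2 (x - y) <= r].
  rewrite [X in _ `<=` X]((closure_id _).1 cB); apply: closureS => x /= /eqP h.
  by rewrite leNgt; apply/negP => h2; apply: h; have [] := bump_out r0 (ltW h2).
split.
- exact/elementary_smooth/bump_elementary.
- apply: (@subclosed_compact _ _ [set x : R2 | N2 x <= r + N2 y]); first exact: closed_closure.
    exact: N2_compact.
  move=> x /sub /=; rewrite !N2E => h.
  by rewrite -(subrK y x) (le_trans (ler_normD _ _))// lerD2r.
- by move=> x /sub/hU.
Qed.
End smooth_functions.

Section mollification.
Context {R : realType}.
Local Notation R2 := (R * R)%type.
Local Notation lambda := (@lebesgue_measure R).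

Lemma bcf_tensor d1 d2 (T1 : measurableType d1) (T2 : measurableType d2)
    (n1 : T1 -> R) (n2 : T2 -> R) f g : bcf n1 f -> bcf n2 g ->
  bcf (gauge_prod n1 n2) (fun p => f p.1 * g p.2).
Proof.
move=> [mf [M fM]] [mg [M' gM]]; split.
  by apply: measurable_funM; apply: measurableT_comp.
have M0 : 0 <= M by rewrite (le_trans _ (proj1 (fM point))).
have M0' : 0 <= M' by rewrite (le_trans _ (proj1 (gM point))).
exists (M * M' + M + M') => -[x y] /=; have [f1 f2] := fM x; have [g1 g2] := gM y; split.
  by rewrite normrM (le_trans (ler_pM _ _ f1 g1))// -addrA lerDl addr_ge0.
have MM : 0 <= M * M' by rewrite mulr_ge0.
rewrite /gauge_prod /= lt_max => /orP[] h; first by rewrite f2 ?mul0r//; lra.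
by rewrite g2 ?mulr0//; lra.
Qed.

Lemma I2_translation (a : R2) f : bcf N2 f -> I2 (fun x => f (x + a)) = I2 f.
Proof.
move=> bf; have ba : bcf N2 (f \o (fun x => x + a)).
  have [mf [M fM]] := bf; split.
    apply: measurableT_comp => //.
    by apply: measurable_fun_pair; apply: measurable_funD => //; exact: measurable_fst || exact: measurable_snd.
  exists (M + N2 a) => x; have [f1 f2] := fM (x + a); split.
    by rewrite (le_trans f1)// lerDl N2_ge0.
  move=> h; apply: f2; move: h; rewrite !N2E => h.
  by have := ler_normB (x + a) a; rewrite addrK; lra.
rewrite -[LHS]/(I2 (f \o (fun x => x + a))) (I2_Fubini1 ba) (I2_Fubini1 bf).
rewrite -(Int_translation a.1 (bcf_int1 (locally_finite_lebesgue) (locally_finite_lebesgue) bf)).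
apply: eq_Rintegral => x _.
by rewrite -(Int_translation a.2 (bcf_section1 bf (x + a.1))).
Qed.

Lemma bump1_even r (t : R) : bump1 r (- t) = bump1 r t.
Proof. by rewrite /bump1 sqrrN. Qed.

Lemma bump1'_odd r (t : R) : bump1' r (- t) = - bump1' r t.
Proof. by rewrite /bump1' sqrrN; ring. Qed.

Lemma bumpC r (x y : R2) : bump r y x = bump r x y.
Proof. by rewrite /bump -!(opprB y.1) -!(opprB y.2) !bump1_even. Qed.

Lemma bump_1C r (x y : R2) : bump_1 r y x = - bump_1 r x y.
Proof. by rewrite /bump_1 -!(opprB y.1) -!(opprB y.2) bump1'_odd bump1_even mulNr. Qed.

Lemma bump_2C r (x y : R2) : bump_2 r y x = - bump_2 r x y.
Proof. by rewrite /bump_2 -!(opprB y.1) -!(opprB y.2) bump1'_odd bump1_even mulrN. Qed.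

Lemma bump_far r (x y : R2) : 0 < r -> r + N2 x < N2 y -> bump r x y = 0.
Proof.
move=> r0; rewrite !N2E => h; have [] // := @bump_out R r x y r0.
by rewrite N2E; have := ler_normB (y - x) (- x); rewrite opprK subrK normrN; lra.
Qed.

Lemma bump_bcf r (x : R2) : 0 < r -> [/\ bcf N2 (bump r x), bcf N2 (bump_1 r x) & bcf N2 (bump_2 r x)].
Proof. by move=> r0; apply: C1on_bcf (bump_C1 r x) _ => y; exact: bump_far. Qed.

Definition bump_mass (r : R) : R := I2 (bump r 0).

Lemma I2_bump r (x : R2) : 0 < r -> I2 (bump r x) = bump_mass r.
Proof.
move=> r0; rewrite -(I2_translation x); last by have [] := bump_bcf x r0.
by congr I2; apply/funext => y; rewrite /bump /= !addrK !subr0.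
Qed.

Lemma bump1_bcf (r : R) : 0 < r -> bcf (@N1 R) (bump1 r).
Proof.
move=> r0; apply: (@bcf1_continuous _ _ r) => [x|x h]; last by have [] := bump1_out r0 (ltW h).
apply: (@continuous_comp _ _ _ (fun t : R => r ^+ 2 - t ^+ 2) (flat 1)); last exact: continuous_flat.
by apply: cvgB; [exact: cvg_cst|exact: exprn_continuous].
Qed.

Lemma bump1_int_gt0 (r : R) : 0 < r -> 0 < \int[lambda]_t bump1 r t.
Proof.
(* [m] is the value of the bump where [r ^+ 2 - t ^+ 2] equals [r ^+ 2 / 2], hence a lower bound for
   it on the half interval. *)
move=> r0; pose m := expR (- (r ^+ 2 / 2) ^-1).
pose D := `[- (r / 2), r / 2]%classic : set R.
have q0 : 0 < r ^+ 2 by rewrite exprn_gt0.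
have h t : (cst m \_ D) t <= bump1 r t.
  rewrite patchE; case: ifPn => [|_]; last exact: bump1_ge0.
  rewrite inE /D /= in_itv /= -ler_norml => tr.
  have : `|t| ^+ 2 <= (r / 2) ^+ 2 by rewrite ler_sqr ?nnegrE// divr_ge0// ltW.
  rewrite real_normK ?num_real// expr_div_n => t2.
  have h2 : r ^+ 2 / 2 <= r ^+ 2 - t ^+ 2 by set a := r ^+ 2 in q0 t2 *; set b := t ^+ 2 in t2 *; lra.
  have h3 : 0 < r ^+ 2 - t ^+ 2 by apply: lt_le_trans h2; rewrite divr_gt0.
  rewrite /bump1 /flat h3 hornerC mul1r /m ler_expR lerN2 lef_pV2// posrE// divr_gt0//.
have mD : measurable D by exact: measurable_itv.
apply: lt_le_trans (_ : \int[lambda]_t (cst m \_ D) t <= _); last first.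
  apply: (le_Int locally_finite_lebesgue) => //; last exact: bump1_bcf.
  apply: bcf_le (bump1_bcf r0) _ => [|x].
    by apply/measurable_restrict => //; exact: measurable_cst.
  rewrite (ger0_norm (bump1_ge0 _ _)) ger0_norm//.
  by rewrite patchE; case: ifPn => // _; exact: expR_ge0.
rewrite -Rintegral_mkcond Rintegral_cst// mulr_gt0 ?expR_gt0//.
have h3 : 0 < fine (lambda [set` `[- (r / 2), r / 2]]).
  by rewrite lebesgue_measure_itv /= lte_fin ifT /= ?subr_gt0; lra.
exact: h3.
Qed.

Lemma bump_mass_gt0 (r : R) : 0 < r -> 0 < bump_mass r.
Proof.
move=> r0; rewrite /bump_mass I2_Fubini1; last by have [] := bump_bcf 0 r0.
have J0 := bump1_int_gt0 r0; set J := (X in 0 < X) in J0.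
suff -> : \int[lambda]_x \int[lambda]_y bump r 0 (x, y) = J * J by rewrite mulr_gt0.
rewrite -(IntZ locally_finite_lebesgue J (bump1_bcf r0)); apply: eq_Rintegral => x _.
rewrite mulrC -(IntZ locally_finite_lebesgue _ (bump1_bcf r0)); apply: eq_Rintegral => y _.
by rewrite /bump /= !subr0.
Qed.

Definition conv (r : R) (g : R2 -> R) (x : R2) : R := I2 (fun y => g y * bump r y x).

Lemma conv_bcf r (g : R2 -> R) x : 0 < r -> bcf N2 g -> bcf N2 (fun y => g y * bump r y x).
Proof.
move=> r0 bg; apply: bcfM => //.
by have [bb _ _] := bump_bcf x r0; under eq_fun do rewrite bumpC.
Qed.

Lemma conv_bound r (g : R2 -> R) B x : 0 < r -> bcf N2 g -> (forall y, `|g y| <= B) ->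
  `|conv r g x| <= B * bump_mass r.
Proof.
move=> r0 bg gB; have [bb _ _] := bump_bcf x r0.
rewrite -(I2_bump x r0) /I2 -(IntZ lf2 _ bb).
apply: (Int_norm_le lf2); [exact: conv_bcf|exact: bcfZ|move=> y].
by rewrite bumpC normrM (ger0_norm (bump_ge0 _ _ _)) ler_wpM2r// bump_ge0.
Qed.

Lemma conv_cvg r_ (g : R2 -> R) x : (forall n : nat, 0 < r_ n) ->
  r_ n @[n --> \oo] --> (0 : R) -> continuous g -> bcf N2 g ->
  (bump_mass (r_ n))^-1 * conv (r_ n) g x @[n --> \oo] --> g x.
Proof.
move=> r0 r_cvg cg bg; apply/cvgrPdist_le => e e0.
have /cvgrPdist_le /(_ _ e0) /nbhs_ballP[d /= d0 hd] := cg x.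
near=> n; have rn := r0 n; have m0 := bump_mass_gt0 rn.
have [bb _ _] := bump_bcf x rn.
have -> : g x = (bump_mass (r_ n))^-1 * (g x * bump_mass (r_ n)) by rewrite mulrCA mulVf ?mulr1// gt_eqF.
rewrite -mulrBr normrM gtr0_norm ?invr_gt0// ler_pdivrMl//.
rewrite -[in X in X <= _](I2_bump x rn) /I2 -(IntZ lf2 _ bb) /conv /I2.
rewrite -(IntB lf2 (bcfZ _ bb) (conv_bcf x rn bg)) mulrC.
rewrite -[in leRHS](I2_bump x rn) /I2 -(IntZ lf2 _ bb).
apply: (Int_norm_le lf2) => [||y]; [|exact: bcfZ|].
  by apply: bcfB; [exact: bcfZ|exact: conv_bcf].
rewrite (bumpC _ x y) -mulrBl normrM (ger0_norm (bump_ge0 _ _ _)).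
have [h|h] := leP (r_ n) (N2 (y - x)); first by have [-> _ _] := bump_out rn h; rewrite !mulr0.
rewrite ler_wpM2r ?bump_ge0//; apply: hd; rewrite -ball_normE /= -normrN opprB -N2E.
rewrite (lt_trans h)//.
have : `|0 - r_ n| < d by near: n; exact: cvgr_dist_lt.
by rewrite sub0r normrN gtr0_norm.
Unshelve. all: by end_near. Qed.

Lemma continuous_bump r : [/\ continuous (fun p : R2 * R2 => bump r p.2 p.1),
  continuous (fun p : R2 * R2 => bump_1 r p.2 p.1) &
  continuous (fun p : R2 * R2 => bump_2 r p.2 p.1)].
Proof.
have c1 : continuous (fun p : R2 * R2 => p.1.1 - p.2.1).
  by move=> p; apply: cvgB; apply: cvg_comp; (exact: cvg_fst || exact: cvg_snd).
have c2 : continuous (fun p : R2 * R2 => p.1.2 - p.2.2).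
  by move=> p; apply: cvgB; apply: cvg_comp; (exact: cvg_fst || exact: cvg_snd).
have cq : continuous (fun t : R => r ^+ 2 - t ^+ 2).
  by move=> t; apply: cvgB; [exact: cvg_cst|exact: exprn_continuous].
have cb : continuous (bump1 r).
  by move=> t; apply: (continuous_comp (cq t)); exact: continuous_flat.
have cb' : continuous (bump1' r).
  move=> t; apply: cvgM; last by apply: cvgM; [exact: cvg_cst|exact: cvg_id].
  by apply: (continuous_comp (cq t)); exact: continuous_flat.
have cc f (g : R -> R) : continuous f -> continuous g -> continuous (fun p : R2 * R2 => g (f p)).
  by move=> cf cg p; exact: (continuous_comp (cf p) (cg _)).
by split=> p; apply: cvgM; apply: cc.
Qed.

Lemma bcf_kernel (k : R2 * R2 -> R) (A g : R2 -> R) : continuous k -> bcf N2 A -> bcf N2 g ->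
  bcf (@N4 R) (fun p : R2 * R2 => k p * (A p.1 * g p.2)).
Proof.
move=> ck bA bg; apply: bcf_bounded_mul; first exact: bcf_tensor.
  exact: continuous_measurable4.
by move=> B; have [B' hB] := compact_bound (@N4_compact R B) (continuous_subspaceT ck); exists B'.
Qed.

Lemma bcf_mul_conv r (A g : R2 -> R) : 0 < r -> bcf N2 A -> bcf N2 g ->
  bcf N2 (fun x => A x * conv r g x).
Proof.
move=> r0 bA bg; have [c0 _ _] := continuous_bump r.
have -> : (fun x => A x * conv r g x) =
    (fun x => \int[lam2]_y (bump r y x * (A x * g y))).
  apply/funext => x; rewrite /conv /I2 -(IntZ lf2 _ (conv_bcf x r0 bg)).
  by apply: eq_Rintegral => y _; ring.
exact: (bcf_int1 lf2 lf2 (bcf_kernel c0 bA bg)).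
Qed.

Section weak_form_bumps.
Variables (A1 A2 b : R2 -> R).
Hypotheses (bA1 : bcf N2 A1) (bA2 : bcf N2 A2) (bb : bcf N2 b).
Variables (phi phi1 phi2 : R2 -> R) (M r0 : R).
Hypotheses (hphi : C1on setT phi phi1 phi2) (phi0 : forall x, M < N2 x -> phi x = 0).
Hypothesis r0_gt0 : 0 < r0.
Hypothesis weak_bump : forall y r, phi y != 0 -> 0 < r < r0 ->
  weak_form A1 A2 b (bump r y) (bump_1 r y) (bump_2 r y) = 0.

Let bphi : bcf N2 phi. Proof. by have [] := C1on_bcf hphi phi0. Qed.
Let bphi1 : bcf N2 phi1. Proof. by have [] := C1on_bcf hphi phi0. Qed.
Let bphi2 : bcf N2 phi2. Proof. by have [] := C1on_bcf hphi phi0. Qed.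

(** The sign changes twice: once in the integration by parts, and once because [bump_1] is odd under
    the exchange of centre and argument. *)
Let conv1 r x : 0 < r -> conv r phi1 x = I2 (fun y => phi y * bump_1 r y x).
Proof.
move=> rp; have [b0 b1 _] := bump_bcf x rp.
have h := C1onM hphi (bump_C1 r x).
have : I2 (fun y => phi1 y * bump r x y + phi y * bump_1 r x y) = 0.
  by apply: (I2_grad1 h (M := M)) => y My; rewrite phi0// mul0r.
rewrite /I2 (IntD lf2 (bcfM bphi1 b0) (bcfM bphi b1)) => /eqP; rewrite addr_eq0 => /eqP E.
rewrite /conv /I2; under eq_Rintegral do rewrite bumpC.
rewrite E -(IntN lf2 (bcfM bphi b1)); apply: eq_Rintegral => y _.
by rewrite (bump_1C r x y) mulrN.
Qed.

Let conv2 r x : 0 < r -> conv r phi2 x = I2 (fun y => phi y * bump_2 r y x).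
Proof.
move=> rp; have [b0 _ b1] := bump_bcf x rp.
have h := C1onM hphi (bump_C1 r x).
have : I2 (fun y => phi2 y * bump r x y + phi y * bump_2 r x y) = 0.
  by apply: (I2_grad2 h (M := M)) => y My; rewrite phi0// mul0r.
rewrite /I2 (IntD lf2 (bcfM bphi2 b0) (bcfM bphi b1)) => /eqP; rewrite addr_eq0 => /eqP E.
rewrite /conv /I2; under eq_Rintegral do rewrite bumpC.
rewrite E -(IntN lf2 (bcfM bphi b1)); apply: eq_Rintegral => y _.
by rewrite (bump_2C r x y) mulrN.
Qed.

Let G r (p : R2 * R2) : R :=
  bump_1 r p.2 p.1 * (A1 p.1 * phi p.2) + bump_2 r p.2 p.1 * (A2 p.1 * phi p.2)
  + bump r p.2 p.1 * (b p.1 * phi p.2).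

Let G_bcf r : bcf (@N4 R) (G r).
Proof.
have [c0 c1 c2] := continuous_bump r.
by apply: bcfD; [apply: bcfD|]; apply: bcf_kernel.
Qed.

(** By [conv1], [conv2] and Fubini, the left side is the integral over [y] of [phi y] times the weak
    form of the bump centred at [y], and this vanishes wherever [phi y] does not. *)
Lemma weak_form_conv r : 0 < r < r0 ->
  I2 (fun x => A1 x * conv r phi1 x + A2 x * conv r phi2 x + b x * conv r phi x) = 0.
Proof.
move=> /andP[rp rr0].
have E1 := Fubini1 lf2 lf2 (G_bcf r); have E2 := Fubini2 lf2 lf2 (G_bcf r).
transitivity (\int[product_measure1 lam2 lam2]_p G r p).
  rewrite E1; apply: eq_Rintegral => x _.
  have [b0 b1 b2] := bump_bcf x rp.
  have b1' : bcf N2 (fun y => phi y * bump_1 r y x).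
    by apply: bcfM => //; under eq_fun do rewrite bump_1C; exact: bcfN.
  have b2' : bcf N2 (fun y => phi y * bump_2 r y x).
    by apply: bcfM => //; under eq_fun do rewrite bump_2C; exact: bcfN.
  have b0' := conv_bcf x rp bphi.
  rewrite conv1// conv2// /conv /I2 -!(IntZ lf2)//.
  rewrite -!(IntD lf2)//; try by do ?[apply: bcfD|apply: bcfZ].
  by apply: eq_Rintegral => y _; rewrite /G /=; ring.
rewrite E2 -[RHS](Int0 lam2); apply: eq_Rintegral => y _.
have [py|py] := eqVneq (phi y) 0.
  by rewrite -[RHS](Int0 lam2); apply: eq_Rintegral => x _; rewrite /G /= py !mulr0 !addr0.
have wb := weak_bump py (introT andP (conj rp rr0)).
rewrite -(mulr0 (phi y)) -wb /weak_form /I2 -(IntZ lf2); last first.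
  by apply: weak_form_bcf => //; exact: bump_C1.
by apply: eq_Rintegral => x _; rewrite /G /=; ring.
Qed.

(** [A1], [A2] and [b] are only bounded and measurable, so the mollification acts on the test
    function, whose gradient is continuous and therefore a pointwise limit. *)
Lemma weak_form_of_bumps : weak_form A1 A2 b phi phi1 phi2 = 0.
Proof.
(* With [n.+2] every radius is strictly below [r0], as [weak_bump] demands. *)
pose r_ (n : nat) : R := r0 / n.+2%:R.
have rp n : 0 < r_ n by rewrite divr_gt0.
have rr0 n : r_ n < r0 by rewrite ltr_pdivrMr// ltr_pMr// ltr1n.
have r_cvg : r_ n @[n --> \oo] --> (0 : R).
  rewrite -(mulr0 r0); apply: cvgM; first exact: cvg_cst.
  have := @cvg_harmonic R; rewrite -cvg_shiftS; exact.
pose h_ n x := (bump_mass (r_ n))^-1 *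
  (A1 x * conv (r_ n) phi1 x + A2 x * conv (r_ n) phi2 x + b x * conv (r_ n) phi x).
have bh n : bcf N2 (fun x => A1 x * conv (r_ n) phi1 x + A2 x * conv (r_ n) phi2 x
    + b x * conv (r_ n) phi x).
  by apply: bcfD; [apply: bcfD|]; apply: bcf_mul_conv.
have hz n : I2 (h_ n) = 0.
  by rewrite /I2 /h_ (IntZ lf2 _ (bh n)) [X in _ * X]weak_form_conv ?mulr0// rp rr0.
have B (g : R2 -> R) : bcf N2 g -> exists B : R, forall y, `|g y| <= B.
  by move=> [_ [B hB]]; exists B => y; case: (hB y).
have [B0 hB0] := B _ bphi; have [B1 hB1] := B _ bphi1; have [B2 hB2] := B _ bphi2.
have [_ [M1 hM1]] := bA1; have [_ [M2 hM2]] := bA2; have [_ [M3 hM3]] := bb.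
have pos (f : R2 -> R) B' : (forall y, `|f y| <= B') -> 0 <= B'.
  by move=> h; exact: le_trans (h 0).
have [B00 B10 B20] := And3 (pos _ _ hB0) (pos _ _ hB1) (pos _ _ hB2).
have M10 := pos _ _ (fun x => proj1 (hM1 x)).
have M20 := pos _ _ (fun x => proj1 (hM2 x)).
have M30 := pos _ _ (fun x => proj1 (hM3 x)).
have cv n x g B' : bcf N2 g -> (forall y, `|g y| <= B') ->
    `|(bump_mass (r_ n))^-1 * conv (r_ n) g x| <= B'.
  move=> bg gB; have m0 := bump_mass_gt0 (rp n).
  rewrite normrM gtr0_norm ?invr_gt0// ler_pdivrMl// mulrC.
  exact: conv_bound.
pose C := M1 * B1 + M2 * B2 + M3 * B0.
have C0 : 0 <= C by rewrite !addr_ge0// mulr_ge0.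
have [|||_ cvgI] := @Int_cvg _ _ _ lam2 _ lf2 h_
    (fun x => A1 x * phi1 x + A2 x * phi2 x + b x * phi x) (C + M1 + M2 + M3).
- by move=> n; apply: bcf_meas; apply: (bcfZ _ (bh n)).
- move=> n x; split.
    apply: (@le_trans _ _ C); last by rewrite -2!(addrA C) lerDl !addr_ge0.
    rewrite /h_ /C mulrDr mulrDr !(mulrCA (bump_mass _)^-1).
    have tm A (M' B' g : R) : `|A| <= M' -> `|g| <= B' -> `|A * g| <= M' * B'.
      by move=> h1 h2; rewrite normrM ler_pM.
    apply: le_trans (ler_normD _ _) _; apply: lerD.
      apply: le_trans (ler_normD _ _) _; apply: lerD.
        by apply: tm; [exact: (proj1 (hM1 x))|exact: cv].
      by apply: tm; [exact: (proj1 (hM2 x))|exact: cv].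
    by apply: tm; [exact: (proj1 (hM3 x))|exact: cv].
  by move=> h; rewrite /h_ (proj2 (hM1 x)) ?(proj2 (hM2 x)) ?(proj2 (hM3 x)) ?mul0r ?addr0 ?mulr0//; lra.
- move=> x; rewrite /h_.
  under eq_fun do rewrite mulrDr mulrDr !(mulrCA (bump_mass _)^-1).
  have ct (f : R2 -> R) : continuous f -> bcf N2 f -> forall A : R,
      A * ((bump_mass (r_ n))^-1 * conv (r_ n) f x) @[n --> \oo] --> A * f x.
    by move=> cf bf A; apply: cvgM; [exact: cvg_cst|exact: conv_cvg].
  have cp1 : continuous phi1 by move=> y; have [] := hphi (I : setT y).
  have cp2 : continuous phi2 by move=> y; have [] := hphi (I : setT y).
  have cp : continuous phi by move=> y; exact: (C1on_continuous hphi (I : setT y)).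
  by apply: cvgD; [apply: cvgD|]; [exact: (ct _ cp1)|exact: (ct _ cp2)|exact: (ct _ cp)].
rewrite /weak_form; apply: (cvg_unique _ cvgI) => //.
have -> : (fun n => \int[lam2]_x h_ n x) = (fun=> 0) by apply/funext => n; exact: hz.
exact: cvg_cst.
Qed.
End weak_form_bumps.
End mollification.

(** * Domain variations of the energy *)

Section continuity.
Context {R : realType} {T : topologicalType}.
Implicit Types f g : T -> R.

Lemma continuous_add f g : continuous f -> continuous g -> continuous (fun x => f x + g x).
Proof. by move=> cf cg x; exact: (cvgD (cf x) (cg x)). Qed.

Lemma continuous_mul f g : continuous f -> continuous g -> continuous (fun x => f x * g x).
Proof. by move=> cf cg x; exact: (cvgM (cf x) (cg x)). Qed.

Lemma continuous_opp f : continuous f -> continuous (fun x => - f x).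
Proof. by move=> cf x; exact: (cvgN (cf x)). Qed.

Lemma continuous_sub f g : continuous f -> continuous g -> continuous (fun x => f x - g x).
Proof. by move=> cf cg; apply: continuous_add => //; exact: continuous_opp. Qed.

Lemma continuous_const (k : R) : continuous (fun _ : T => k).
Proof. by move=> x; exact: cvg_cst. Qed.

Lemma continuous_after (T' T'' : topologicalType) (phi : T' -> T'') (g : T -> T') :
  continuous g -> continuous phi -> continuous (fun x => phi (g x)).
Proof. by move=> cg cphi x; exact: (continuous_comp (cg x) (cphi _)). Qed.
End continuity.

Section local_convergence.
Context {R : realType}.
Local Notation R2 := (R * R)%type.

(** Convergence with bounds uniform in [n] on bounded sets. It is stable under sums and products, so
    the limit of a long expression can be assembled from its factors, and it allows dominated
    convergence once the supports lie in a fixed ball. *)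
Definition lbcvg (g_ : nat -> R2 -> R) (g : R2 -> R) :=
  [/\ forall n, measurable_fun setT (g_ n),
      forall B : R, exists M : R, forall n x, N2 x <= B -> `|g_ n x| <= M &
      forall x, g_ n x @[n --> \oo] --> g x].

Lemma lbcvg_cst (g : R2 -> R) : measurable_fun setT g ->
  (forall B : R, exists M : R, forall x, N2 x <= B -> `|g x| <= M) -> lbcvg (fun=> g) g.
Proof.
move=> mg bg; split=> [//|B|x]; last exact: cvg_cst.
by have [M hM] := bg B; exists M.
Qed.

Lemma lbcvg_continuous (g : R2 -> R) : continuous g -> lbcvg (fun=> g) g.
Proof.
move=> cg; apply: lbcvg_cst; first exact: continuous_measurable2.
by move=> B; exact: continuous_N2_bound.
Qed.

Lemma lbcvgD f_ f g_ g : lbcvg f_ f -> lbcvg g_ g ->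
  lbcvg (fun n x => f_ n x + g_ n x) (fun x => f x + g x).
Proof.
move=> [mf bf cf] [mg bg cg]; split=> [n|B|x].
- exact: measurable_funD.
- have [M hM] := bf B; have [M' hM'] := bg B; exists (M + M') => n x xB.
  by rewrite (le_trans (ler_normD _ _))// lerD ?hM ?hM'.
- by apply: cvgD; [exact: cf|exact: cg].
Qed.

Lemma lbcvgM f_ f g_ g : lbcvg f_ f -> lbcvg g_ g ->
  lbcvg (fun n x => f_ n x * g_ n x) (fun x => f x * g x).
Proof.
move=> [mf bf cf] [mg bg cg]; split=> [n|B|x].
- exact: measurable_funM.
- have [M hM] := bf B; have [M' hM'] := bg B; exists (M * M') => n x xB.
  by rewrite normrM ler_pM ?hM ?hM'.
- by apply: cvgM; [exact: cf|exact: cg].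
Qed.

Lemma lbcvgN f_ f : lbcvg f_ f -> lbcvg (fun n x => - f_ n x) (fun x => - f x).
Proof.
move=> [mf bf cf]; split=> [n|B|x].
- exact: measurableT_comp.
- by have [M hM] := bf B; exists M => n x xB; rewrite normrN hM.
- by apply: cvgN; exact: cf.
Qed.

Lemma lbcvg_eq f_ f g_ g : (forall n x, g_ n x = f_ n x) -> (forall x, g x = f x) ->
  lbcvg f_ f -> lbcvg g_ g.
Proof.
move=> e1 e2; have -> : g = f by exact/funext.
by have -> : g_ = f_ by apply/funext => n; exact/funext.
Qed.

Lemma lbcvg_I2 g_ g (B : R) : lbcvg g_ g -> (forall n x, B < N2 x -> g_ n x = 0) ->
  bcf N2 g /\ I2 (g_ n) @[n --> \oo] --> I2 g.
Proof.
move=> [mg bg cg] g0; have [M hM] := bg B.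
apply: (Int_cvg (M := Num.max B `|M|) lf2 mg _ cg) => n x; split.
  rewrite le_max; apply/orP; right; have [xB|xB] := leP (N2 x) B.
    by rewrite (le_trans (hM n x xB))// ler_norm.
  by rewrite g0// normr0.
by rewrite gt_max => /andP[h _]; exact: g0.
Qed.
End local_convergence.

Section domain_variation.
Context {R : realType}.
Local Notation R2 := (R * R)%type.
Local Notation lambda := (@lebesgue_measure R).

Lemma primitive (G : R -> R) : continuous G -> bcf (@N1 R) G ->
  exists P : R -> R, forall x : R, is_derive x 1 P (G x).
Proof.
move=> cG bG; exists (fun x => \int[lambda]_(t in [set` `]-oo, x]]) G t) => x.
have x1 : x < x + 1 by rewrite ltrDl.
have iG : lambda.-integrable [set` `]-oo, x + 1]] (EFin \o G).
  by apply: integrableS (bcf_integrable locally_finite_lebesgue bG).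
have [d dE] := continuous_FTC1 x1 iG (ltNyr x) (cG x).
split; first exact: d.
by rewrite -derive1E dE.
Qed.

Variables (alpha alpha1 alpha2 : R2 -> R) (M : R).
Hypotheses (halpha : C1on setT alpha alpha1 alpha2)
  (alpha0 : forall x, M < N2 x -> alpha x = 0).

Definition shift1 (t : R) (x : R2) : R2 := (x.1 + t * alpha x, x.2).

Lemma shift1_C1 t : C1on setT (fun x => (shift1 t x).1)
  (fun x => 1 + t * alpha1 x) (fun x => t * alpha2 x).
Proof.
by apply: C1on_eq (C1onD (@C1on_fst R setT) (C1onM (@C1on_cst R setT t) halpha)) => x; rewrite /shift1 /=; ring.
Qed.

Lemma C1on_shift1 t f f1 f2 : C1on setT f f1 f2 ->
  C1on setT (fun x => f (shift1 t x))
    (fun x => f1 (shift1 t x) * (1 + t * alpha1 x))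
    (fun x => f1 (shift1 t x) * (t * alpha2 x) + f2 (shift1 t x)).
Proof.
move=> hf; have := @C1on_comp2 R setT setT f f1 f2 _ _ _ _ _ _ hf (shift1_C1 t) (@C1on_snd R setT) (fun _ _ => I).
by apply: C1on_eq => x; rewrite /shift1 /=; ring.
Qed.

Lemma continuous_shift1 t : continuous (shift1 t).
Proof.
move=> x; apply: (@differentiable_continuous _ _ _ x (shift1 t)).
apply: differentiable_pair; first by have [[]] := shift1_C1 t (I : setT x).
by have [[]] := @C1on_snd R setT x I.
Qed.

Let z1 x : M < N2 x -> alpha1 x = 0.
Proof. by move=> /(C1on_zero_far halpha alpha0)[]. Qed.

Let calpha1 : continuous alpha1.
Proof. by move=> x; have [] := halpha (I : setT x). Qed.

Let calpha : continuous alpha.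
Proof. by move=> x; exact: C1on_continuous halpha (I : setT x). Qed.

(* On each horizontal line the integrand is the derivative of [P (x + t alpha) - P x],
   with [P] a primitive of [G]: the change of variables needs no inverse map. *)
Lemma I2_shift1 t (G : R2 -> R) (M' : R) : continuous G -> (forall x, M' < N2 x -> G x = 0) ->
  I2 (fun x => G (shift1 t x) * (1 + t * alpha1 x) - G x) = 0.
Proof.
move=> cG G0; set g := (fun x => _).
have cg : continuous g.
  apply: continuous_sub => //; apply: continuous_mul.
    by apply: continuous_after cG; exact: continuous_shift1.
  by apply: continuous_add; [exact: continuous_const|apply: continuous_mul => //; exact: continuous_const].
have g0 x : M < N2 x -> g x = 0.
  move=> Mx; rewrite /g /shift1 alpha0// z1// !mulr0 !addr0 mulr1.
  by case: x {Mx} => a b; rewrite subrr.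
rewrite (I2_Fubini2 (bcf2_continuous cg g0)) -[RHS](Int0 lambda); apply: eq_Rintegral => y _.
have cGy : continuous (fun x => G (x, y)).
  exact: continuous_after (continuous_pairl (y := y)) cG.
have bGy : bcf (@N1 R) (fun x => G (x, y)).
  apply: (@bcf1_continuous _ _ M') => // x Mx; apply: G0.
  by rewrite (lt_le_trans Mx)//; exact: (N2_fst (x, y)).
have [P dP] := primitive cGy bGy.
apply: (@Int_derive_eq0 _ (fun x => P (x + t * alpha (x, y)) - P x) _ M).
- move=> x; have d1 := C1on_section1 (shift1_C1 t) (I : setT (x, y)).
  have d2 := @is_derive1_comp _ P _ x _ _ (dP _) d1.
  exact: (is_deriveB d2 (dP x)).
- exact: continuous_after (continuous_pairl (y := y)) cg.
- move=> x Mx; rewrite alpha0 ?mulr0 ?addr0 ?subrr//.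
  by rewrite (lt_le_trans Mx)//; exact: (N2_fst (x, y)).
Qed.

(** Gives the bound, uniform in [n], of the difference quotients in [lbcvg_quotient]. *)
Lemma mean_value1 k k1 k2 (x : R2) (s : R) : C1on setT k k1 k2 ->
  exists2 c : R, `|c| <= `|s| & k (x.1 + s, x.2) - k x = k1 (x.1 + c, x.2) * s.
Proof.
move=> hk; have d (z : R) : is_derive z 1 (fun z => k (z, x.2)) (k1 (z, x.2)).
  exact: (C1on_section1 hk).
have cz : continuous (fun z => k (z, x.2)).
  by apply: continuous_after (continuous_pairl (y := x.2)) _ => y; exact: C1on_continuous hk I.
have -> : k x = k (x.1, x.2) by case: x {d cz}.
have [s0|s0] := leP 0 s.
  have [||c] := @MVT_segment R (fun z => k (z, x.2)) (fun z => k1 (z, x.2)) x.1 (x.1 + s) _ (fun z _ => d z).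
  - by rewrite lerDl.
  - exact: continuous_subspaceT.
  rewrite in_itv /= => /andP[c1 c2] ->; exists (c - x.1).
    by rewrite !ger0_norm ?subr_ge0// lerBlDl.
  by have -> : x.1 + (c - x.1) = c; [ring|congr (_ * _); ring].
have [||c] := @MVT_segment R (fun z => k (z, x.2)) (fun z => k1 (z, x.2)) (x.1 + s) x.1 _ (fun z _ => d z).
- by rewrite gerDl ltW.
- exact: continuous_subspaceT.
rewrite in_itv /= => /andP[c1 c2] E; exists (c - x.1).
  by rewrite !ler0_norm ?subr_le0// ?(ltW s0)//; lra.
have -> : x.1 + (c - x.1) = c by ring.
by rewrite -opprB E; ring.
Qed.

Variable eps : R.
Hypothesis eps1 : `|eps| = 1.

(** Displacements tending to 0 with the sign of [eps]; [energy_variation1] uses both signs. *)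
Let t_ (n : nat) : R := eps / n.+1%:R.

Let t_neq0 n : t_ n != 0.
Proof. by rewrite mulf_neq0// -normr_eq0 eps1 oner_neq0. Qed.

Let t_le1 n : `|t_ n| <= 1.
Proof. by rewrite normrM eps1 mul1r ger0_norm ?invr_ge0// invf_le1 ?ltr0n// ler1n. Qed.

Let t_cvg : t_ n @[n --> \oo] --> (0 : R).
Proof. by rewrite -(mulr0 eps); apply: cvgM; [exact: cvg_cst|exact: cvg_harmonic]. Qed.

Let lbcvg_t : lbcvg (fun n (_ : R2) => t_ n) (fun=> 0).
Proof. by split=> [n|B|x] //; exists 1 => n x _. Qed.

Let alpha_bound : exists Ba : R, forall x, `|alpha x| <= Ba.
Proof. by have [[_ [Ba hBa]] _ _] := C1on_bcf halpha alpha0; exists Ba => x; case: (hBa x). Qed.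

Let N2_shift1 Ba n (s : R) (x : R2) : (forall x, `|alpha x| <= Ba) -> `|s| <= `|t_ n * alpha x| ->
  N2 (x.1 + s, x.2) <= N2 x + Ba.
Proof.
move=> hBa sB; have Ba0 : 0 <= Ba := le_trans (normr_ge0 _) (hBa x).
have sBa : `|s| <= Ba.
  by rewrite (le_trans sB)// normrM (le_trans _ (hBa x))// ler_piMl.
apply: N2_le => /=.
  by rewrite (le_trans (ler_normD _ _))// lerD// N2_fst.
by rewrite (le_trans (N2_snd x))// lerDl.
Qed.

Lemma lbcvg_shift1 a : continuous a -> lbcvg (fun n x => a (shift1 (t_ n) x)) a.
Proof.
move=> ca; have [Ba hBa] := alpha_bound; split=> [n|B|x].
- by apply: continuous_measurable2; exact: continuous_after (@continuous_shift1 (t_ n)) ca.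
- have [M' hM'] := continuous_N2_bound (B + Ba) ca; exists M' => n x xB.
  by apply: hM'; apply: le_trans (N2_shift1 hBa (lexx _)) _; rewrite lerD2r.
- have c : {for 0, continuous (fun t : R => a (shift1 t x))}.
    have h : continuous (fun t : R => (x.1 + t * alpha x, x.2)).
      have ct : continuous (fun t : R => x.1 + t * alpha x).
        apply: continuous_add; first exact: continuous_const.
        by apply: continuous_mul; [move=> ?; exact: cvg_id|exact: continuous_const].
      exact: (continuous_after ct (continuous_pairl (y := x.2))).
    exact: (continuous_after h ca).
  have := cvg_comp _ _ t_cvg c; rewrite /shift1 mul0r addr0.
  by case: x {c}.
Qed.

Lemma lbcvg_quotient k k1 k2 : C1on setT k k1 k2 ->
  lbcvg (fun n x => (t_ n)^-1 * (k (shift1 (t_ n) x) - k x)) (fun x => k1 x * alpha x).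
Proof.
move=> hk; have [Ba hBa] := alpha_bound.
have ck : continuous k by move=> x; exact: C1on_continuous hk (I : setT x).
have ck1 : continuous k1 by move=> x; have [] := hk x I.
split=> [n|B|x].
- apply: continuous_measurable2; apply: continuous_mul; first exact: continuous_const.
  by apply: continuous_sub => //; exact: continuous_after (@continuous_shift1 (t_ n)) ck.
- have [M' hM'] := continuous_N2_bound (B + Ba) ck1; exists (M' * Ba) => n x xB.
  have [c cs ->] := mean_value1 x (t_ n * alpha x) hk.
  rewrite mulrCA mulKf// normrM ler_pM// hM'//.
  by apply: le_trans (N2_shift1 hBa cs) _; rewrite lerD2r.
- have [ax|ax] := eqVneq (alpha x) 0.
    rewrite ax mulr0 (_ : (fun n => _) = (fun=> 0)); first exact: cvg_cst.
    by apply/funext => n; rewrite /shift1 ax mulr0 addr0; case: x {ax} => a b; rewrite subrr mulr0.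
  pose v : R2 := (alpha x, 0).
  have [dk dkE] := C1on_derive v hk (I : setT x).
  have -> : k1 x * alpha x = 'D_v k x by rewrite dkE /= mul0r addr0 mulrC.
  have dk' : (fun h => h^-1 *: (k (h *: v + x) - k x)) h @[h --> (0 : R)^'] --> 'D_v k x := dk.
  have := (cvgr_dnbhsP _ _ _).1 dk' t_ (conj t_neq0 t_cvg).
  have -> // : (fun n => (t_ n)^-1 *: (k (t_ n *: v + x) - k x)) =
    (fun n => (t_ n)^-1 * (k (shift1 (t_ n) x) - k x)).
  apply/funext => n; congr (_ * (k _ - _)).
  rewrite -[LHS]/(t_ n * alpha x + x.1, t_ n * 0 + x.2) /shift1.
  by rewrite mulr0 add0r addrC.
Qed.

Variables (k11 k11_1 k11_2 k12 k12_1 k12_2 k22 k22_1 k22_2 : R2 -> R).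
Hypotheses (hk11 : C1on setT k11 k11_1 k11_2) (hk12 : C1on setT k12 k12_1 k12_2)
  (hk22 : C1on setT k22 k22_1 k22_2).
Hypothesis psd : forall x v1 v2,
  0 <= k11 x * v1 ^+ 2 + 2 * k12 x * v1 * v2 + k22 x * v2 ^+ 2.
Variables (psi psi1 psi2 f : R2 -> R).
Hypotheses (hpsi : C1on setT psi psi1 psi2) (psi0 : forall x, M < N2 x -> psi x = 0).
Hypothesis bf : bcf N2 f.
(** A test that vanishes with [alpha] lives where the equation is known, and
    [psi (x + t alpha e1) - psi x] is such a test. *)
Hypothesis weak : forall phi phi1 phi2, C1on setT phi phi1 phi2 ->
  (forall x, alpha x = 0 -> phi x = 0) ->
  weak_form (fun x => k11 x * psi1 x + k12 x * psi2 x)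
    (fun x => k12 x * psi1 x + k22 x * psi2 x) f phi phi1 phi2 = 0.

(* With [psi_t x = psi (x + t alpha e1)], the integrand of the derivative at [t = 0] of
   [int K grad psi_t . grad psi_t + 2 f psi_t], once the change of variables has moved the
   derivative off [grad psi] onto [K] and [alpha]. *)
Definition stress1 (x : R2) : R :=
  - ((k11_1 x * alpha x + k11 x * alpha1 x) * (psi1 x * psi1 x)
     + 2 * ((k12_1 x * alpha x + k12 x * alpha1 x) * (psi1 x * psi2 x))
     + (k22_1 x * alpha x + k22 x * alpha1 x) * (psi2 x * psi2 x))
  + 2 * (psi1 x * ((k11 x * psi1 x + k12 x * psi2 x) * alpha1 x
                   + (k12 x * psi1 x + k22 x * psi2 x) * alpha2 x))
  + 2 * (f x * (psi1 x * alpha x)).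

Let cont (k k1 k2 : R2 -> R) : C1on setT k k1 k2 -> [/\ continuous k, continuous k1 & continuous k2].
Proof.
move=> hk; split=> x; have [? ? ?] := hk x I => //; exact: C1on_continuous hk (I : setT x).
Qed.

Let ca2 : continuous alpha2. Proof. by have [] := cont halpha. Qed.
Let cp1 : continuous psi1. Proof. by have [] := cont hpsi. Qed.
Let cp2 : continuous psi2. Proof. by have [] := cont hpsi. Qed.

(** The difference quotient of the energy density along [t_ n], minus terms of integral zero. The
    increments of products of [psi1] and [psi2] could not be divided by [t_ n], as these functions
    are merely continuous. Subtracting the integrands of [I2_shift1] for the products of [k11],
    [k12], [k22] with these functions replaces them by difference quotients of C^1 functions. *)
Let g_ n x : R :=
  let p1 := psi1 (shift1 (t_ n) x) in let p2 := psi2 (shift1 (t_ n) x) in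
  let S k := (t_ n)^-1 * (k (shift1 (t_ n) x) - k x) + k (shift1 (t_ n) x) * alpha1 x in
  - (S k11 * (p1 * p1) + 2 * (S k12 * (p1 * p2)) + S k22 * (p2 * p2))
  + 2 * (p1 * ((k11 x * p1 + k12 x * p2) * alpha1 x + (k12 x * p1 + k22 x * p2) * alpha2 x))
  + 2 * (f x * ((t_ n)^-1 * (psi (shift1 (t_ n) x) - psi x)))
  + t_ n * (p1 * p1 * (k11 x * (alpha1 x * alpha1 x) + 2 * (k12 x * (alpha1 x * alpha2 x))
                       + k22 x * (alpha2 x * alpha2 x))).

Let lbcvg_g : lbcvg g_ stress1.
Proof.
have lc (k : R2 -> R) : continuous k -> lbcvg (fun=> k) k by exact: lbcvg_continuous.
have l2 : lbcvg (fun n (_ : R2) => 2) (fun=> 2) by apply: lc; exact: continuous_const.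
have lp1 := lbcvg_shift1 cp1; have lp2 := lbcvg_shift1 cp2.
have lS (k k1 k2 : R2 -> R) : C1on setT k k1 k2 -> lbcvg
    (fun n x => (t_ n)^-1 * (k (shift1 (t_ n) x) - k x) + k (shift1 (t_ n) x) * alpha1 x)
    (fun x => k1 x * alpha x + k x * alpha1 x).
  move=> hk; apply: lbcvgD; first exact: lbcvg_quotient hk.
  by apply: lbcvgM; [apply: lbcvg_shift1; have [] := cont hk|exact: lc].
have lk (k k1 k2 : R2 -> R) : C1on setT k k1 k2 -> lbcvg (fun=> k) k.
  by move=> hk; apply: lc; have [] := cont hk.
have lf : lbcvg (fun=> f) f.
  have [mf [Mf hMf]] := bf; apply: lbcvg_cst => // B.
  by exists Mf => x _; case: (hMf x).
have lall := lbcvgD (lbcvgD (lbcvgD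
  (lbcvgN (lbcvgD (lbcvgD (lbcvgM (lS _ _ _ hk11) (lbcvgM lp1 lp1))
    (lbcvgM l2 (lbcvgM (lS _ _ _ hk12) (lbcvgM lp1 lp2)))) (lbcvgM (lS _ _ _ hk22) (lbcvgM lp2 lp2))))
  (lbcvgM l2 (lbcvgM lp1 (lbcvgD
    (lbcvgM (lbcvgD (lbcvgM (lk _ _ _ hk11) lp1) (lbcvgM (lk _ _ _ hk12) lp2)) (lc _ calpha1))
    (lbcvgM (lbcvgD (lbcvgM (lk _ _ _ hk12) lp1) (lbcvgM (lk _ _ _ hk22) lp2)) (lc _ ca2))))))
  (lbcvgM l2 (lbcvgM lf (lbcvg_quotient hpsi))))
  (lbcvgM lbcvg_t (lbcvgM (lbcvgM lp1 lp1) (lbcvgD (lbcvgD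
    (lbcvgM (lk _ _ _ hk11) (lbcvgM (lc _ calpha1) (lc _ calpha1)))
    (lbcvgM l2 (lbcvgM (lk _ _ _ hk12) (lbcvgM (lc _ calpha1) (lc _ ca2)))))
    (lbcvgM (lk _ _ _ hk22) (lbcvgM (lc _ ca2) (lc _ ca2)))))).
by apply: lbcvg_eq lall => [n x|x]; rewrite /g_ /stress1 //; ring.
Qed.

(** With [phi] the increment of [psi], the integral of [g_ n] reduces to that of
    [K grad phi . grad phi] divided by [t_ n]: the first order part [W] vanishes by the equation,
    and the terms [D] vanish by the change of variables. A nonnegative form over [t_ n] has the sign
    of [eps]. *)
Lemma stress1_sign : bcf N2 stress1 /\ 0 <= eps * I2 stress1.
Proof.
have a2z x : M < N2 x -> alpha2 x = 0 by move=> /(C1on_zero_far halpha alpha0)[].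
have sh n x : M < N2 x -> shift1 (t_ n) x = x.
  by move=> Mx; rewrite /shift1 alpha0// mulr0 addr0; case: x {Mx}.
have g0 n x : M < N2 x -> g_ n x = 0.
  by move=> Mx; rewrite /g_ sh// z1// a2z// !subrr; ring.
have [bs cvgI] := lbcvg_I2 lbcvg_g g0; split=> //.
have pos n : 0 <= eps * I2 (g_ n).
  pose t := t_ n; have t0 : t != 0 := t_neq0 n.
  have psiz x : M < N2 x -> psi1 x = 0 /\ psi2 x = 0 := C1on_zero_far hpsi psi0 (x := x).
  have hphi := C1onB (C1on_shift1 t hpsi) hpsi.
  set phi := (fun x => psi (shift1 t x) - psi x) in hphi.
  set phi1 := (fun x => psi1 (shift1 t x) * (1 + t * alpha1 x) - psi1 x) in hphi.
  set phi2 := (fun x => psi1 (shift1 t x) * (t * alpha2 x) + psi2 (shift1 t x) - psi2 x) in hphi.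
  have phiz x : alpha x = 0 -> phi x = 0.
    by move=> ax; rewrite /phi /shift1 ax mulr0 addr0; case: x {ax} => a b; rewrite subrr.
  have [b0 b1 b2] := C1on_bcf hphi (fun x Mx => phiz x (alpha0 Mx)).
  pose W x := (k11 x * psi1 x + k12 x * psi2 x) * phi1 x
    + (k12 x * psi1 x + k22 x * psi2 x) * phi2 x + f x * phi x.
  have W0 : I2 W = 0 := weak hphi phiz.
  have [[c11 _ _] [c12 _ _] [c22 _ _]] := And3 (cont hk11) (cont hk12) (cont hk22).
  pose D (k : R2 -> R) a x := k (shift1 t x) * a (shift1 t x) * (1 + t * alpha1 x) - k x * a x.
  have Dk (k a : R2 -> R) : continuous k -> continuous a -> (forall x, M < N2 x -> a x = 0) ->
      bcf N2 (D k a) /\ I2 (D k a) = 0.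
    move=> ck ca az; split; last first.
      apply: (@I2_shift1 t (fun x => k x * a x) M); first exact: continuous_mul.
      by move=> x Mx; rewrite az// mulr0.
    apply: (@bcf2_continuous _ _ M); last first.
      by move=> x Mx; rewrite /D sh// z1// mulr0 addr0 mulr1 subrr.
    have cs := @continuous_shift1 t.
    apply: continuous_sub; last exact: continuous_mul.
    apply: continuous_mul.
      by apply: continuous_mul; exact: (continuous_after cs).
    by apply: continuous_add; [exact: continuous_const|apply: continuous_mul => //; exact: continuous_const].
  have a12 (u v : R2 -> R) : continuous u -> continuous v -> (forall x, M < N2 x -> u x = 0) ->
      continuous (fun x => u x * v x) /\ (forall x, M < N2 x -> u x * v x = 0).
    by move=> cu cv uz; split; [exact: continuous_mul|move=> x Mx; rewrite uz// mul0r].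
  have pz1 x : M < N2 x -> psi1 x = 0 by move=> /psiz[].
  have pz2 x : M < N2 x -> psi2 x = 0 by move=> /psiz[].
  have [ca11 z11] := a12 _ _ cp1 cp1 pz1.
  have [ca12 z12] := a12 _ _ cp1 cp2 pz1.
  have [ca22 z22] := a12 _ _ cp2 cp2 pz2.
  have [bD11 D11] := Dk _ _ c11 ca11 z11.
  have [bD12 D12] := Dk _ _ c12 ca12 z12.
  have [bD22 D22] := Dk _ _ c22 ca22 z22.
  have bW : bcf N2 W.
    by apply: weak_form_bcf => //; apply: bcfD; apply: bcf_bounded_mul;
      (try exact: continuous_measurable2); (try by move=> B; exact: continuous_N2_bound);
      apply: (@bcf2_continuous _ _ M).
  pose Q x := k11 x * phi1 x ^+ 2 + 2 * k12 x * phi1 x * phi2 x + k22 x * phi2 x ^+ 2.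
  have bQ : bcf N2 Q.
    have e : Q = (fun x => k11 x * (phi1 x * phi1 x) + (2 * k12 x) * (phi1 x * phi2 x)
                           + k22 x * (phi2 x * phi2 x)).
      by apply/funext => x; rewrite /Q; ring.
    rewrite e; have bk (k u : R2 -> R) : continuous k -> bcf N2 u -> bcf N2 (fun x => k x * u x).
      move=> ck bu; apply: bcf_bounded_mul => //; first exact: continuous_measurable2.
      by move=> B; exact: continuous_N2_bound.
    apply: bcfD; [apply: bcfD|]; apply: bk; try exact: bcfM; try exact: c11; try exact: c22.
    by apply: continuous_mul => //; exact: continuous_const.
  have gE x : g_ n x = t^-1 * (- (D k11 (fun x => (psi1 x * psi1 x)%R) x
      + 2 * D k12 (fun x => (psi1 x * psi2 x)%R) x
      + D k22 (fun x => (psi2 x * psi2 x)%R) x) + Q x + 2 * W x).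
    by rewrite /g_ -/t /D /Q /W /phi /phi1 /phi2; field.
  have -> : I2 (g_ n) = t^-1 * I2 Q.
    have bD := bcfD (bcfD bD11 (bcfZ 2 bD12)) bD22.
    have bS := bcfD (bcfD (bcfN bD) bQ) (bcfZ 2 bW).
    have gE' : g_ n = _ := funext gE.
    rewrite gE'.
    rewrite /I2 (IntZ lf2 _ bS) (IntD lf2 (bcfD (bcfN bD) bQ) (bcfZ 2 bW)).
    rewrite (IntD lf2 (bcfN bD) bQ) (IntN lf2 bD) (IntZ lf2 _ bW) [X in 2 * X]W0.
    rewrite (IntD lf2 (bcfD bD11 (bcfZ 2 bD12)) bD22) (IntD lf2 bD11 (bcfZ 2 bD12)) (IntZ lf2 _ bD12).
    rewrite [X in - (X + _ + _)]D11 [X in - (_ + 2 * X + _)]D12 [X in - (_ + _ + X)]D22.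
    by rewrite !mulr0 !addr0 oppr0 add0r.
  (* The factor [eps / t] is [n.+1], so only the sign of the quadratic form matters. *)
  rewrite mulrA; apply: mulr_ge0; last by apply: Rintegral_ge0 => x _; exact: psd.
  have e0 : eps != 0 by rewrite -normr_eq0 eps1 oner_neq0.
  by rewrite /t /t_ invf_div mulrC -mulrA mulVf ?mulr1.
have cI : eps * I2 (g_ n) @[n --> \oo] --> eps * I2 stress1.
  by apply: cvgM; [exact: cvg_cst|exact: cvgI].
rewrite -(cvg_lim _ cI)//; apply: limr_ge; first by apply/cvg_ex; exists (eps * I2 stress1).
exact: nearW.
Qed.
End domain_variation.

Section swapped_coordinates.
Context {R : realType}.
Local Notation R2 := (R * R)%type.

Definition swapped (f : R2 -> R) (x : R2) : R := f (x.2, x.1).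

Lemma swappedK f : swapped (swapped f) = f.
Proof. by apply/funext => -[]. Qed.

Lemma N2_swap (a b : R) : N2 (b, a) = N2 (a, b).
Proof. by rewrite /N2 /gauge_prod /= maxC. Qed.

Lemma bcf_swapped f : bcf N2 f -> bcf N2 (swapped f).
Proof.
move=> [mf [M fM]]; split.
  apply: (measurableT_comp mf); apply: measurable_fun_pair => //.
by exists M => -[a b]; have := fM (b, a); rewrite /swapped /= N2_swap.
Qed.

Lemma I2_swapped f : bcf N2 f -> I2 (swapped f) = I2 f.
Proof. by move=> bf; rewrite (I2_Fubini1 (bcf_swapped bf)) (I2_Fubini2 bf). Qed.

Lemma C1on_swapped f f1 f2 : C1on setT f f1 f2 ->
  C1on setT (swapped f) (swapped f2) (swapped f1).
Proof.
move=> hf; have := @C1on_comp2 R setT setT f f1 f2 _ _ _ _ _ _ hf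
  (@C1on_snd R setT) (@C1on_fst R setT) (fun _ _ => I).
by apply: C1on_eq => x; rewrite /swapped; ring.
Qed.

Lemma weak_form_swapped A1 A2 b f f1 f2 :
  bcf N2 A1 -> bcf N2 A2 -> bcf N2 b -> C1on setT f f1 f2 ->
  weak_form (swapped A2) (swapped A1) (swapped b) (swapped f) (swapped f2) (swapped f1)
  = weak_form A1 A2 b f f1 f2.
Proof.
move=> b1 b2 b0 hf; rewrite /weak_form -[RHS]I2_swapped; last exact: weak_form_bcf.
by congr I2; apply/funext => x; rewrite /swapped; ring.
Qed.
End swapped_coordinates.

Section energy_variation.
Context {R : realType}.
Local Notation R2 := (R * R)%type.
Variables (k11 k11_1 k11_2 k12 k12_1 k12_2 k22 k22_1 k22_2 : R2 -> R).
Hypotheses (hk11 : C1on setT k11 k11_1 k11_2) (hk12 : C1on setT k12 k12_1 k12_2)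
  (hk22 : C1on setT k22 k22_1 k22_2).
Hypothesis psd : forall x v1 v2,
  0 <= k11 x * v1 ^+ 2 + 2 * k12 x * v1 * v2 + k22 x * v2 ^+ 2.
Variables (psi psi1 psi2 f : R2 -> R) (M : R).
Hypotheses (hpsi : C1on setT psi psi1 psi2) (psi0 : forall x, M < N2 x -> psi x = 0).
Hypothesis bf : bcf N2 f.
Variables (alpha alpha1 alpha2 : R2 -> R).
Hypotheses (halpha : C1on setT alpha alpha1 alpha2)
  (alpha0 : forall x, M < N2 x -> alpha x = 0).
Hypothesis weak : forall phi phi1 phi2, C1on setT phi phi1 phi2 ->
  (forall x, alpha x = 0 -> phi x = 0) ->
  weak_form (fun x => k11 x * psi1 x + k12 x * psi2 x)
    (fun x => k12 x * psi1 x + k22 x * psi2 x) f phi phi1 phi2 = 0.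

(* By convexity of the energy, testing with [psi (x + t alpha e1) - psi x] gives an
   inequality whose first order term has the sign of [t]: it vanishes. *)
Lemma energy_variation1 :
  let s := stress1 alpha alpha1 alpha2 k11 k11_1 k12 k12_1 k22 k22_1 psi1 psi2 f in
  bcf N2 s /\ I2 s = 0.
Proof.
have [b1 p1] := stress1_sign halpha alpha0 (normr1 R) hk11 hk12 hk22 psd hpsi psi0 bf weak.
have [_ p2] := stress1_sign halpha alpha0 (normrN1 R) hk11 hk12 hk22 psd hpsi psi0 bf weak.
split=> //; apply/eqP; rewrite eq_le; apply/andP; split; lra.
Qed.
End energy_variation.

Section energy_variation_swapped.
Context {R : realType}.
Local Notation R2 := (R * R)%type.
Variables (k11 k11_1 k11_2 k12 k12_1 k12_2 k22 k22_1 k22_2 : R2 -> R).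
Hypotheses (hk11 : C1on setT k11 k11_1 k11_2) (hk12 : C1on setT k12 k12_1 k12_2)
  (hk22 : C1on setT k22 k22_1 k22_2).
Hypothesis psd : forall x v1 v2,
  0 <= k11 x * v1 ^+ 2 + 2 * k12 x * v1 * v2 + k22 x * v2 ^+ 2.
Variables (psi psi1 psi2 f : R2 -> R) (M : R).
Hypotheses (hpsi : C1on setT psi psi1 psi2) (psi0 : forall x, M < N2 x -> psi x = 0).
Hypothesis bf : bcf N2 f.
Variables (alpha alpha1 alpha2 : R2 -> R).
Hypotheses (halpha : C1on setT alpha alpha1 alpha2)
  (alpha0 : forall x, M < N2 x -> alpha x = 0).
Hypothesis weak : forall phi phi1 phi2, C1on setT phi phi1 phi2 ->
  (forall x, alpha x = 0 -> phi x = 0) ->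
  weak_form (fun x => k11 x * psi1 x + k12 x * psi2 x)
    (fun x => k12 x * psi1 x + k22 x * psi2 x) f phi phi1 phi2 = 0.

(** [energy_variation1] for the data with exchanged coordinates. The exchange also interchanges
    [k11] with [k22] and the two partial derivatives. *)
Lemma energy_variation2 :
  let s := stress1 alpha alpha2 alpha1 k22 k22_2 k12 k12_2 k11 k11_2 psi2 psi1 f in
  bcf N2 s /\ I2 s = 0.
Proof.
have bk (k u : R2 -> R) k1 k2 : C1on setT k k1 k2 -> bcf N2 u -> bcf N2 (fun x => k x * u x).
  move=> hk bu; have ck : continuous k by move=> x; exact: C1on_continuous hk (I : setT x).
  by apply: bcf_bounded_mul; [|exact: continuous_measurable2|move=> B; exact: continuous_N2_bound].
have [_ bp1 bp2] := C1on_bcf hpsi psi0.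
have bA1 : bcf N2 (fun x => k11 x * psi1 x + k12 x * psi2 x).
  by apply: bcfD; [exact: bk hk11 bp1|exact: bk hk12 bp2].
have bA2 : bcf N2 (fun x => k12 x * psi1 x + k22 x * psi2 x).
  by apply: bcfD; [exact: bk hk12 bp1|exact: bk hk22 bp2].
have far (u : R2 -> R) : (forall x, M < N2 x -> u x = 0) -> forall x, M < N2 x -> swapped u x = 0.
  by move=> uz [a b] Mx; apply: uz; rewrite N2_swap.
have [||bs sz] := energy_variation1
  (C1on_swapped hk22) (C1on_swapped hk12) (C1on_swapped hk11) _
  (C1on_swapped hpsi) (far _ psi0) (bcf_swapped bf)
  (C1on_swapped halpha) (far _ alpha0).
- move=> x v1 v2; have := psd (x.2, x.1) v2 v1; rewrite /swapped.
  by congr (0 <= _); ring.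
- move=> phi phi1 phi2 hphi phiz.
  rewrite -[RHS](@weak (swapped phi) (swapped phi2) (swapped phi1)); last 2 first.
  + exact: C1on_swapped.
  + by move=> [a b] h; apply: phiz.
  rewrite -(weak_form_swapped bA1 bA2 bf (C1on_swapped hphi)) !swappedK.
  by rewrite /weak_form; congr I2; apply/funext => x; rewrite /swapped /=; ring.
have e : swapped (stress1 alpha alpha2 alpha1 k22 k22_2 k12 k12_2 k11 k11_2 psi2 psi1 f) =
  stress1 (swapped alpha) (swapped alpha2) (swapped alpha1) (swapped k22)
      (swapped k22_2) (swapped k12) (swapped k12_2) (swapped k11)
      (swapped k11_2) (swapped psi2) (swapped psi1) (swapped f).
  by apply/funext => x.
by rewrite /= -(swappedK (stress1 _ _ _ _ _ _ _ _ _ _ _ _)) e; split;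
  [exact: bcf_swapped|rewrite I2_swapped].
Qed.
End energy_variation_swapped.

(** * The boundary *)

Lemma C1on_continuousT (R : realType) (f f1 f2 : R * R -> R) : C1on setT f f1 f2 ->
  [/\ continuous f, continuous f1 & continuous f2].
Proof.
move=> hf; split=> x; have [? ? ?] := hf x I => //.
exact: C1on_continuous hf (I : setT x).
Qed.

Lemma mean_value_cc (R : realType) (F D : R -> R) (a b : R) : a <= b ->
  (forall t : R, t \in `[a, b] -> is_derive t 1 F (D t)) ->
  exists2 t, t \in `[a, b] & F b - F a = D t * (b - a).
Proof.
move=> ab dF.
have dF' (t : R) : t \in `]a, b[ -> is_derive t 1 F (D t).
  by move=> ht; apply: dF; exact: subset_itv_oo_cc.
have cF : {within `[a, b], continuous F}.
  by apply: derivable_within_continuous => t ht; case: (dF t ht).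
exact: MVT_segment ab dF' cF.
Qed.

Section charts.
Context {R : realType}.
Local Notation R2 := (R * R)%type.
Variables (theta : R) (g : R -> R).
Hypothesis hg : C2_line g.

(* Positive exactly on the domain near a boundary point, by [C2_boundary]. *)
Definition chart_fun (x : R2) : R := (rot2 theta x).2 - g (rot2 theta x).1.
Definition chart_fun1 (x : R2) : R := - sin theta - derive1 g (rot2 theta x).1 * cos theta.
Definition chart_fun2 (x : R2) : R := cos theta - derive1 g (rot2 theta x).1 * sin theta.

Lemma is_derive_chart (t : R) : is_derive t 1 g (derive1 g t).
Proof. by have [dg _ _] := hg; rewrite derive1E; exact: derivableP. Qed.

Lemma continuous_chart' : continuous (derive1 g).
Proof.
by have [_ dg _] := hg => t; apply: differentiable_continuous; apply/derivable1_diffP.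
Qed.

Lemma rot2_C1 U : C1on U (fun x : R2 => (rot2 theta x).1) (fun=> cos theta) (fun=> sin theta) /\
  C1on U (fun x : R2 => (rot2 theta x).2) (fun=> - sin theta) (fun=> cos theta).
Proof.
have h (a b : R) : C1on U (fun x : R2 => a * x.1 + b * x.2) (fun=> a) (fun=> b).
  apply: C1on_eq (C1onD (C1onM (@C1on_cst R U a) (@C1on_fst R U))
    (C1onM (@C1on_cst R U b) (@C1on_snd R U))) => x; ring.
by split; exact: h.
Qed.

Lemma chart_fun_C1 U : C1on U chart_fun chart_fun1 chart_fun2.
Proof.
have [h1 h2] := rot2_C1 U.
have h3 := C1on_compr h1 (fun x _ => conj (is_derive_chart _) (@continuous_chart' _)).
by apply: C1on_eq (C1onB h2 h3) => x; rewrite /chart_fun /chart_fun1 /chart_fun2.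
Qed.

Definition unrot (y : R2) : R2 := lin2 (cos theta) (- sin theta) (sin theta) (cos theta) y.

Lemma cs1 : cos theta ^+ 2 + sin theta ^+ 2 = 1 :> R.
Proof. exact: cos2Dsin2. Qed.

Lemma rot2_lin2 (x : R2) : rot2 theta x = lin2 (cos theta) (sin theta) (- sin theta) (cos theta) x.
Proof. by []. Qed.

Lemma unrotK y : rot2 theta (unrot y) = y.
Proof.
have h : cos theta ^+ 2 + (- sin theta) ^+ 2 = 1 :> R by rewrite sqrrN cs1.
by have := lin2_rot_cancel h y; rewrite !opprK.
Qed.

Lemma rot2K x : unrot (rot2 theta x) = x.
Proof. by rewrite rot2_lin2; apply: lin2_rot_cancel; exact: cs1. Qed.

Lemma chart_fun_graph t s : chart_fun (unrot (t, g t + s)) = s.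
Proof. by rewrite /chart_fun unrotK /= addrC addKr. Qed.

Lemma continuous_graph : continuous (fun z : R2 => unrot (z.1, g z.1 + z.2)).
Proof.
move=> z.
have hgf := C1on_compr (@C1on_fst R setT) (fun x _ => conj (is_derive_chart x.1) (@continuous_chart' _)).
have h2 := C1onD hgf (@C1on_snd R setT).
have h1 := @C1on_fst R setT.
apply: (@differentiable_continuous _ _ _ z (fun z : R2 => unrot (z.1, g z.1 + z.2))).
have l (a b : R) := C1onD (C1onM (@C1on_cst R setT a) h1) (C1onM (@C1on_cst R setT b) h2).
apply: differentiable_pair.
  by have [[]] := l (cos theta) (- sin theta) z I.
by have [[]] := l (sin theta) (cos theta) z I.
Qed.

Section tangential.
Variables (Omega : set R2) (psi G1 G2 : R2 -> R) (x0 : R2).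
Hypothesis oOmega : open Omega.
Hypothesis near_chart : \forall x \near x0, Omega x <-> 0 < chart_fun x.
Hypothesis cpsi : {within closure Omega, continuous psi}.
Hypotheses (cG1 : {within closure Omega, continuous G1})
  (cG2 : {within closure Omega, continuous G2}).
Hypothesis hpsi : C1on Omega psi G1 G2.
Hypothesis psi0 : forall x, frontier Omega x -> psi x = 0.
Hypothesis fx0 : frontier Omega x0.

Lemma frontier_open x : frontier Omega x <-> closure Omega x /\ ~ Omega x.
Proof. by rewrite /frontier (interior_id Omega).1. Qed.

(** Coordinates in which the boundary is the line [z.2 = 0]; the second one is the value of
    [chart_fun]. *)
Let graph (z : R2) : R2 := unrot (z.1, g z.1 + z.2).

Lemma chart_fun_frontier x : (\forall y \near x, Omega y <-> 0 < chart_fun y) ->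
  closure Omega x -> 0 <= chart_fun x.
Proof.
move=> nx cx; rewrite leNgt; apply/negP => dx.
have cd : {for x, continuous chart_fun} by have [cd _ _] := C1on_continuousT (@chart_fun_C1 setT); exact: cd.
have nd : \forall y \near x, chart_fun y < 0 := cd _ (open_nbhs_nbhs (conj (@open_lt R 0) dx)).
have [y [Oy [yx yd]]] := cx _ (filterI nx nd).
by have := yx.1 Oy; rewrite ltNge ltW.
Qed.

Lemma graph_frontier t : (\forall y \near graph (t, 0), Omega y <-> 0 < chart_fun y) ->
  frontier Omega (graph (t, 0)).
Proof.
move=> ny; apply/frontier_open; split; last first.
  by move/(nbhs_singleton ny).1; rewrite /graph /= chart_fun_graph ltxx.
move=> V nV.
have c0 : graph (t, s) @[s --> (0 : R)] --> graph (t, 0).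
  exact: (continuous_after (@continuous_pairr R t) continuous_graph (x := 0)).
have /nbhs_ballP[e /= e0 he] : \forall s \near (0 : R), (V `&` [set y | Omega y <-> 0 < chart_fun y]) (graph (t, s)).
  exact: (c0 _ (filterI nV ny)).
have [|Vy yO] := he (e / 2); first by rewrite /ball /= sub0r normrN gtr0_norm ?divr_gt0// ltr_pdivrMr// ltr_pMr// ltr1n.
exists (graph (t, e / 2)); split=> //.
by apply/yO; rewrite /graph /= chart_fun_graph divr_gt0.
Qed.

(** The derivative of [psi] along [(1, g')], rotated back to the original axes; at [x0] this vector
    is tangent to the boundary. *)
Let tang (x : R2) : R := G1 x * (cos theta - sin theta * derive1 g (rot2 theta x).1)
  + G2 x * (sin theta + cos theta * derive1 g (rot2 theta x).1).

Let graph_C1 : exists a1 a2 b1 b2, [/\ C1on setT (fun z => (graph z).1) a1 a2,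
  C1on setT (fun z => (graph z).2) b1 b2,
  forall z, a1 z = cos theta - sin theta * derive1 g z.1 &
  forall z, b1 z = sin theta + cos theta * derive1 g z.1].
Proof.
have hgf := C1on_compr (@C1on_fst R setT) (fun x _ => conj (is_derive_chart x.1) (@continuous_chart' _)).
have h2 := C1onD hgf (@C1on_snd R setT).
have h1 := @C1on_fst R setT.
have l (a b : R) := C1onD (C1onM (@C1on_cst R setT a) h1) (C1onM (@C1on_cst R setT b) h2).
exists (fun z => cos theta - sin theta * derive1 g z.1), (fun=> - sin theta),
  (fun z => sin theta + cos theta * derive1 g z.1), (fun=> cos theta).
split=> //.
  by apply: C1on_eq (l (cos theta) (- sin theta)) => x; rewrite /graph /unrot /lin2 /=; ring.
by apply: C1on_eq (l (sin theta) (cos theta)) => x; rewrite /graph /unrot /lin2 /=; ring.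
Qed.

(* The curves parallel to the boundary carry nearly the boundary values of [psi], so the
   derivative of [psi] along them cannot stay away from zero. *)
Lemma tangential_eq0 : tang x0 = 0.
Proof.
have [cx0 nx0] := (frontier_open x0).1 fx0.
have gx0 : graph ((rot2 theta x0).1, 0) = x0.
  rewrite /graph /= addr0.
  have d0 : chart_fun x0 = 0.
    apply/eqP; rewrite eq_le chart_fun_frontier// andbT leNgt; apply/negP => h.
    by apply: nx0; apply/(nbhs_singleton near_chart).
  rewrite -[RHS](rot2K x0); congr unrot; rewrite [RHS]surjective_pairing; congr pair.
  by apply/eqP; rewrite eq_sym -subr_eq0; apply/eqP.
set y1 := (rot2 theta x0).1 in gx0.
apply/eqP/negP => /negP tN0.
pose e := `|tang x0| / 2.
have e0 : 0 < e by rewrite divr_gt0// normr_gt0.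
have ctang : tang x @[x --> within (closure Omega) (nbhs x0)] --> tang x0.
  have [c1 _ _] := C1on_continuousT (rot2_C1 setT).1.
  have cg := continuous_after c1 (@continuous_chart').
  have cw (f : R2 -> R) : continuous f -> f x @[x --> within (closure Omega) (nbhs x0)] --> f x0.
    by move=> cf; apply: cvg_within_filter; exact: cf.
  have wG1 := (subspace_continuousP _ _).1 cG1 _ cx0.
  have wG2 := (subspace_continuousP _ _).1 cG2 _ cx0.
  apply: cvgD; apply: cvgM; [exact: wG1| |exact: wG2|]; apply: cw.
    by apply: continuous_sub; [exact: continuous_const|apply: continuous_mul => //; exact: continuous_const].
  by apply: continuous_add; [exact: continuous_const|apply: continuous_mul => //; exact: continuous_const].
have ntang : \forall x \near x0, closure Omega x -> `|tang x0 - tang x| < e.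
  by have /cvgrPdist_lt /(_ _ e0) := ctang.
have cg0 : {for ((y1, 0) : R2), continuous graph} := @continuous_graph (y1, 0).
have : \forall z \near ((y1, 0) : R2), (closure Omega (graph z) -> `|tang x0 - tang (graph z)| < e)
    /\ (\forall y \near graph z, Omega y <-> 0 < chart_fun y).
  have nn : nbhs (graph (y1, 0)) [set x | (closure Omega x -> `|tang x0 - tang x| < e)
      /\ (\forall y \near x, Omega y <-> 0 < chart_fun y)].
    by rewrite gx0; exact: (filterI ntang (near_join near_chart)).
  exact: (cg0 _ nn).
move=> /nbhs_ballP[r /= r0 hr].
pose rho := r / 2.
have rho0 : 0 < rho by rewrite divr_gt0.
have rhor : rho < r by rewrite ltr_pdivrMr// ltr_pMr// ltr1n.
have inball t s : `|t| <= rho -> `|s| <= rho -> ball ((y1, 0) : R2) r (y1 + t, s).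
  move=> ht hs; split; rewrite /ball /=.
    by rewrite opprD addNKr normrN (le_lt_trans ht).
  by rewrite sub0r normrN (le_lt_trans hs).
have [a1 [a2 [b1 [b2 [ha hb a1E b1E]]]]] := graph_C1.
have inO t s : `|t| <= rho -> 0 < s <= rho -> Omega (graph (y1 + t, s)).
  move=> ht /andP[s0 sr]; have [|_ ny] := hr _ (inball t s ht _); first by rewrite gtr0_norm.
  by apply/(nbhs_singleton ny); rewrite /graph /= chart_fun_graph.
have bd t : `|t| <= rho -> frontier Omega (graph (y1 + t, 0)).
  move=> ht; have [|_ ny] := hr _ (inball t 0 ht _); first by rewrite normr0 ltW.
  exact: graph_frontier.
(* On the curve at height [s] the values of [tang] are within [e], half of [|tang x0|], of
   [tang x0]. By the mean value theorem [psi] varies by at least [e * rho] along it. *)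
have big s : 0 < s <= rho -> e * rho <= `|psi (graph (y1 + rho, s)) - psi (graph (y1 + 0, s))|.
  move=> srho; have /andP[s0 sr] := srho.
  have hf := C1on_comp2 (U := [set z | Omega (graph z)]) hpsi
    (C1on_sub (@subsetT _ _) ha) (C1on_sub (@subsetT _ _) hb) (fun _ h => h).
  pose D t := G1 (graph (t, s)) * a1 (t, s) + G2 (graph (t, s)) * b1 (t, s).
  have dom t : t \in `[y1, y1 + rho] -> `|t - y1| <= rho.
    by rewrite in_itv /= => /andP[h1 h2]; rewrite ger0_norm ?subr_ge0// lerBlDl.
  have inO' t : t \in `[y1, y1 + rho] -> Omega (graph (t, s)).
    by move=> /dom h; have := inO (t - y1) s h srho; rewrite addrC subrK.
  have df t : t \in `[y1, y1 + rho] -> is_derive t 1 (fun t => psi (graph (t, s))) (D t).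
    by move=> ht; exact: (C1on_section1 hf (inO' t ht)).
  have y1rho : y1 <= y1 + rho by rewrite lerDl ltW.
  have [t ht] := mean_value_cc y1rho df.
  rewrite addr0 => ->; rewrite (addrC y1) addrK normrM (gtr0_norm rho0) ler_wpM2r ?ltW//.
  have -> : D t = tang (graph (t, s)) by rewrite /D a1E b1E /tang /graph unrotK.
  have [|h _] := hr _ (inball (t - y1) s (dom t ht) _); first by rewrite gtr0_norm.
  have {h} := h (subset_closure (inO (t - y1) s (dom t ht) srho)).
  rewrite (_ : y1 + (t - y1) = t); last by ring.
  move=> h; have := ler_normD (tang x0 - tang (graph (t, s))) (tang (graph (t, s))).
  by rewrite subrK; rewrite /e in h *; lra.
(* As [s] tends to 0 the end points of these curves tend to boundary points, where [psi] is 0; this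
   contradicts [big]. *)
have small t : `|t| <= rho -> psi (graph (y1 + t, s)) @[s --> 0^'+] --> (0 : R).
  move=> ht; have fz := bd t ht.
  suff : psi (graph (y1 + t, s)) @[s --> (0 : R)^'+] --> psi (graph (y1 + t, 0)) by rewrite (psi0 fz).
  have [cz _] := (frontier_open _).1 fz.
  have wpsi := (subspace_continuousP _ _).1 cpsi _ cz.
  apply/cvgrPdist_lt => d d0.
  have nd : \forall x \near graph (y1 + t, 0), closure Omega x -> `|psi (graph (y1 + t, 0)) - psi x| < d.
    by have /cvgrPdist_lt /(_ _ d0) := wpsi.
  have cgt := continuous_after (@continuous_pairr R (y1 + t)) continuous_graph (x := 0).
  have nd' : \forall s \near (0 : R)^'+, closure Omega (graph (y1 + t, s)) ->
      `|psi (graph (y1 + t, 0)) - psi (graph (y1 + t, s))| < d.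
    by apply: cvg_at_right_filter cgt _ nd.
  near=> s.
  have hs : closure Omega (graph (y1 + t, s)) -> `|psi (graph (y1 + t, 0)) - psi (graph (y1 + t, s))| < d.
    by near: s.
  apply: hs; apply: subset_closure; apply: inO => //; apply/andP; split; near: s.
    exact: nbhs_right_gt.
  exact: nbhs_right_le.
have rr : `|rho| <= rho by rewrite gtr0_norm.
have r00 : `|0 : R| <= rho by rewrite normr0 ltW.
have nb := (cvgr0Pnorm_lt _).1 (eq_ind _ (fun l => _ --> l) (cvgB (small _ rr) (small _ r00)) _ (subr0 0)) _ (mulr_gt0 e0 rho0).
have {}nb : \forall s \near (0 : R)^'+, `|psi (graph (y1 + rho, s)) - psi (graph (y1 + 0, s))| < e * rho.
  by apply: nb; typeclasses eauto.
near (0 : R)^'+ => s.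
have : e * rho <= `|psi (graph (y1 + rho, s)) - psi (graph (y1 + 0, s))|.
  by apply: big; apply/andP; split; near: s; [exact: nbhs_right_gt|exact: nbhs_right_le].
have : `|psi (graph (y1 + rho, s)) - psi (graph (y1 + 0, s))| < e * rho by near: s.
by rewrite ltNge => /negP.
Unshelve. all: by end_near. Qed.
End tangential.
End charts.

(** * Boundary layers and tests meeting the boundary *)

Section boundary.
Context {R : realType}.
Local Notation R2 := (R * R)%type.
Local Notation lambda := (@lebesgue_measure R).

Lemma Int_interval (a b : R) : a <= b ->
  bcf (@N1 R) (fun t => if (a < t) && (t <= b) then 1 else 0) /\
  \int[lambda]_t (if (a < t) && (t <= b) then 1 else 0) = b - a.
Proof.
move=> ab; have e : (fun t : R => if (a < t) && (t <= b) then 1 else 0) = (cst (1 : R)) \_ `]a, b].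
  by apply/funext => t; rewrite patchE mem_setE in_itv.
have mD : measurable (`]a, b]%classic : set R) by exact: measurable_itv.
split.
  split; first by rewrite e; apply/measurable_restrict => //; exact: measurable_cst.
  exists (1 + `|a| + `|b|) => t; case: ifPn => [/andP[h1 h2]|_]; last by rewrite normr0; split=> //; rewrite !addr_ge0.
  rewrite normr1; split; first by rewrite -addrA lerDl addr_ge0.
  move=> h; exfalso; have : `|t| <= `|a| + `|b|.
    rewrite ler_norml; have := ler_norm b; have := ler_norm (- a); rewrite normrN.
    have := normr_ge0 a; have := normr_ge0 b; move=> *; apply/andP; split; lra.
  by rewrite /N1 in h; lra.
rewrite e -Rintegral_mkcond Rintegral_cst// mul1r.
have : fine (lambda [set` `]a, b]]) = b - a.
  rewrite lebesgue_measure_itv /= lte_fin; case: ltP => [_|ba]; first by rewrite -EFinB.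
  by rewrite /=; apply/eqP; rewrite eq_sym subr_eq0 eq_le ab ba.
by [].
Qed.

(** The indicator of a boundary layer whose thickness is measured along the vertical axis of the
    rotated chart. *)
Definition strip (theta : R) (g : R -> R) (B d : R) (x : R2) : R :=
  if (N2 x <= B) && ((0 < chart_fun theta g x) && (chart_fun theta g x <= d)) then 1 else 0.

Lemma bcf_strip theta g B d : C2_line g -> 0 <= B -> bcf N2 (strip theta g B d).
Proof.
move=> hg B0; have [cd _ _] := C1on_continuousT (@chart_fun_C1 R theta g hg setT).
have md := continuous_measurable2 cd.
split.
  apply: measurable_fun_ifT => //; apply: measurable_and.
    by apply: measurable_fun_ler => //; exact: (gauge_meas lf2).
  apply: measurable_and; first exact: measurable_fun_ltr.
  exact: measurable_fun_ler.
exists (1 + B) => x; rewrite /strip; case: ifPn => [/andP[h _]|_].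
  rewrite normr1 lerDl; split=> // h2; exfalso.
  by have := lt_le_trans h2 h; lra.
by rewrite normr0; split=> //; rewrite addr_ge0.
Qed.

(** After the rotation every vertical line meets the layer in at most an interval of length [d], and
    only abscissas of modulus at most [2 * B] occur. *)
Lemma I2_strip theta g B d : C2_line g -> 0 <= B -> 0 <= d ->
  I2 (strip theta g B d) <= (4 * B + 1) * d.
Proof.
move=> hg B0 d0.
pose c := cos theta; pose s := sin theta.
have cs : c ^+ 2 + s ^+ 2 = 1 := cs1 theta.
have cs' : c ^+ 2 + (- s) ^+ 2 = 1 by rewrite sqrrN.
have bS := bcf_strip theta d hg B0.
rewrite -(I2_rot cs' bS).
have bS' := bcf_rot cs' bS.
rewrite (I2_Fubini1 bS').
(* The interval of [Int_interval] is open on the left; lengthening it by one there includes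
   [- (2 * B)], whence the constant [4 * B + 1]. *)
have ab : - (2 * B) - 1 <= 2 * B by lra.
have [bJ IJ] := Int_interval ab.
have -> : (4 * B + 1) * d = d * (2 * B - (- (2 * B) - 1)) by ring.
rewrite -IJ -(IntZ locally_finite_lebesgue _ bJ).
apply: (le_Int locally_finite_lebesgue).
- exact: (bcf_int1 locally_finite_lebesgue locally_finite_lebesgue bS').
- exact: bcfZ.
move=> x; have E y : (strip theta g B d \o lin2 c (- s) (- - s) c) (x, y) = strip theta g B d (unrot theta (x, y)).
  by rewrite /= opprK.
have dE y : chart_fun theta g (unrot theta (x, y)) = y - g x by rewrite /chart_fun unrotK.
case: ifPn => hx.
  have ab' : g x <= g x + d by rewrite lerDl.
  have [bK IK] := Int_interval ab'.
  have -> : d * 1 = g x + d - g x by ring.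
  rewrite -IK; apply: (le_Int locally_finite_lebesgue) => //; first exact: (bcf_section1 bS' x).
  move=> y; rewrite E /strip dE subr_gt0 lerBlDl; case: ifPn => [/andP[_ ->]//|_].
  by case: ifP.
rewrite mulr0 -[leRHS](Int0 lambda); apply: (le_Int locally_finite_lebesgue).
- exact: (bcf_section1 bS' x).
- exact: bcf0.
move=> y; rewrite E /strip; case: ifPn => // /andP[h _]; exfalso; move/negP: hx; apply.
have := unrotK theta (x, y); set u := unrot theta (x, y) in h *; rewrite /rot2 => -[ex _].
have hc : `|c| <= 1 by rewrite ler_norml cos_geN1 cos_le1.
have hs : `|s| <= 1 by rewrite ler_norml sin_geN1 sin_le1.
have : `|x| <= 2 * B.
  rewrite -ex (le_trans (ler_normD _ _))// !normrM (_ : 2 * B = 1 * B + 1 * B); last by ring.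
  by rewrite lerD// ler_pM//; [exact: le_trans (N2_fst u) h|exact: le_trans (N2_snd u) h].
by rewrite ler_norml => /andP[h1 h2]; apply/andP; split=> //; lra.
Qed.

Lemma step'_bound (t : R) : `|step' t| <= 4 /\ (~~ (0 < t <= 1) -> step' t = 0).
Proof.
rewrite /step' /sqpos; have [t0|t0] := leP t 0.
  by rewrite !mulr0 normr0.
rewrite /=; have [t1|t1] := leP t 1; last first.
  have -> : Num.max 0 (1 - t ^+ 2) = 0.
    by apply/max_idPl; rewrite subr_le0 exprn_ege1// ltW.
  by rewrite mulr0 mul0r normr0.
split=> //; have h : 0 <= 1 - t ^+ 2 <= 1.
  by apply/andP; split; nra.
have -> : Num.max 0 (1 - t ^+ 2) = 1 - t ^+ 2 by apply/max_idPr; case/andP: h.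
have /andP[h0 h1] := h.
rewrite ger0_norm; last by rewrite mulr_ge0// ?mulr_ge0// ltW.
have : (1 - t ^+ 2) * t <= 1 by rewrite mulr_ile1// ltW.
by rewrite -mulrA; lra.
Qed.

Lemma N2_ball_closed (a : R2) r : closed [set x : R2 | N2 (x - a) <= r].
Proof.
have -> : [set x : R2 | N2 (x - a) <= r] = ~` [set x | r < N2 (x - a)].
  by apply/seteqP; split => x; rewrite /= leNgt => /negP.
apply: open_closedC; apply: (@open_comp _ _ (fun x : R2 => x - a) [set y | r < N2 y]) => [x _|].
  by apply: cvgD; [exact: cvg_id|exact: cvg_cst].
exact: N2_gt_open.
Qed.

Lemma N2_ball_le (a : R2) r x : N2 (x - a) <= r -> N2 x <= r + N2 a.
Proof. by rewrite !N2E => h; rewrite -(subrK a x) (le_trans (ler_normD _ _))// lerD2r. Qed.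

Lemma N2_ball_compact (a : R2) r : compact [set x : R2 | N2 (x - a) <= r].
Proof.
apply: (subclosed_compact (@N2_ball_closed a r) (N2_compact (R := R) (M := r + N2 a))).
by move=> x; exact: N2_ball_le.
Qed.

Section boundary_ball.
Variables (Omega : set R2) (A1 A2 b B1 B2 : R2 -> R).
Hypothesis oOmega : open Omega.
Hypotheses (bA1 : bcf N2 A1) (bA2 : bcf N2 A2) (bb : bcf N2 b).
Hypothesis A_out : forall x, ~ Omega x -> [/\ A1 x = 0, A2 x = 0 & b x = 0].
(* [B1], [B2] are the continuous extensions of [A1], [A2] to the closure. *)
Hypotheses (cB1 : {within closure Omega, continuous B1})
  (cB2 : {within closure Omega, continuous B2}).
Hypothesis AB : forall x, Omega x -> A1 x = B1 x /\ A2 x = B2 x.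
Hypothesis interior : weak_identity_in Omega A1 A2 b.
Variables (x0 : R2) (theta : R) (g : R -> R).
Hypothesis hg : C2_line g.
Hypothesis near_chart : \forall x \near x0, Omega x <-> 0 < chart_fun theta g x.
Hypothesis normal0 : \forall x \near x0, frontier Omega x ->
  B1 x * chart_fun1 theta g x + B2 x * chart_fun2 theta g x = 0.

Let d := chart_fun theta g.
Let nu x := B1 x * chart_fun1 theta g x + B2 x * chart_fun2 theta g x.

Let cd : [/\ continuous d, continuous (chart_fun1 theta g) & continuous (chart_fun2 theta g)].
Proof. exact: C1on_continuousT (@chart_fun_C1 R theta g hg setT). Qed.

(** Compactness makes the bound uniform. A point outside the closure has a neighbourhood that misses
    [Omega]; near a point with [0 < d x] the depth exceeds [d0] once [d0] is small; at a frontier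
    point [nu] is zero and continuous along the closure. *)
Let small_normal (K : set R2) e : compact K ->
  (forall x, K x -> (\forall y \near x, Omega y <-> 0 < d y) /\ (frontier Omega x -> nu x = 0)) ->
  0 < e -> exists2 d0, 0 < d0 & forall x, K x -> Omega x -> d x <= d0 -> `|nu x| <= e.
Proof.
move=> cK hK e0; have [cd0 cd1 cd2] := cd.
have near_cov : near_covering K by apply/compact_near_coveringP.
have nK := near_cov _ (0 : R)^'+ (fun d0 x => Omega x -> d x <= d0 -> `|nu x| <= e) _.
have : \forall d0 \near (0 : R)^'+, K `<=` (fun x => Omega x -> d x <= d0 -> `|nu x| <= e).
  apply: nK => x Kx; have [nx fx] := hK x Kx.
  have [Ox|nOx] := pselect (closure Omega x); last first.
    have nC : \forall y \near x, ~ closure Omega y.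
      apply: open_nbhs_nbhs; split=> //; apply: closed_openC; exact: closed_closure.
    exists ([set y | ~ closure Omega y], setT); first by split => //; exact: filterT.
    by move=> [y d0] [/= h _] Oy; exfalso; apply: h; exact: subset_closure.
  have [dx|dx] := ltP 0 (d x).
    have nd : \forall y \near x, d x / 2 < d y.
      by apply: (cd0 x [set z | d x / 2 < z]); apply: (open_nbhs_nbhs (conj (@open_gt R _) _)); rewrite /= ltr_pdivrMr// ltr_pMr// ltr1n.
    exists ([set y | d x / 2 < d y], [set d0 | d0 <= d x / 2]).
      by split => //=; apply: nbhs_right_le; rewrite divr_gt0.
    by move=> [y d0] [/= h1 h2] _ h3; have := lt_le_trans h1 (le_trans h3 h2); rewrite ltxx.
  have fxx : frontier Omega x.
    by apply/(frontier_open oOmega); split=> // Oxx; have := (nbhs_singleton nx).1 Oxx; rewrite ltNge dx.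
  have cnu : nu y @[y --> within (closure Omega) (nbhs x)] --> nu x.
    have wB1 := (subspace_continuousP _ _).1 cB1 _ Ox.
    have wB2 := (subspace_continuousP _ _).1 cB2 _ Ox.
    have cw (f : R2 -> R) : continuous f -> f y @[y --> within (closure Omega) (nbhs x)] --> f x.
      by move=> cf; apply: cvg_within_filter; exact: cf.
    by apply: cvgD; apply: cvgM; [exact: wB1|exact: cw|exact: wB2|exact: cw].
  have nn : \forall y \near x, closure Omega y -> `|nu x - nu y| < e.
    by have /cvgrPdist_lt /(_ _ e0) := cnu.
  exists ([set y | closure Omega y -> `|nu x - nu y| < e], setT); first by split => //; exact: filterT.
  move=> [y d0] [/= h _] Oy _; have := h (subset_closure Oy).
  by rewrite fx// sub0r normrN => /ltW.
move=> hN; near (0 : R)^'+ => d0; exists d0 => //.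
suff : K `<=` (fun x => Omega x -> d x <= d0 -> `|nu x| <= e) by [].
by near: d0.
Unshelve. all: by end_near. Qed.
Lemma boundary_ball : exists2 r, 0 < r & weak_in_ball A1 A2 b (x0, r).
Proof.
have [cd0 cd1 cd2] := cd.
have : \forall x \near x0, (\forall y \near x, Omega y <-> 0 < d y) /\ (frontier Omega x -> nu x = 0).
  exact: (filterI (near_join near_chart) normal0).
move=> /nbhs_ballP[R0 /= R00 hR0].
pose r := R0 / 2; have r0 : 0 < r by rewrite divr_gt0.
have rR : r < R0 by rewrite ltr_pdivrMr// ltr_pMr// ltr1n.
exists r => // f f1 f2 hf f0 /=; rewrite /= in f0.
pose K := [set x : R2 | N2 (x - x0) <= r].
have clK : closed K := @N2_ball_closed x0 r.
have NK x : K x -> N2 x <= r + N2 x0 := @N2_ball_le x0 r x.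
have cK : compact K := @N2_ball_compact x0 r.
have hK x : K x -> (\forall y \near x, Omega y <-> 0 < d y) /\ (frontier Omega x -> nu x = 0).
  move=> Kx; apply: hR0; have {}Kx := le_lt_trans Kx rR.
  by split; rewrite /ball /= distrC; [exact: le_lt_trans (N2_fst (x - x0)) Kx|exact: le_lt_trans (N2_snd (x - x0)) Kx].
have hO x : K x -> (Omega x <-> 0 < d x) by move=> /hK[/nbhs_singleton].
have fK x : ~ K x -> [/\ f x = 0, f1 x = 0 & f2 x = 0].
  move=> nK; have fz y : ~ K y -> f y = 0 by move=> /negP; rewrite -ltNge => /ltW/f0.
  by have [] := C1on_zero hf (closed_openC clK) nK fz; rewrite (fz _ nK).
pose L x := A1 x * f1 x + A2 x * f2 x + b x * f x.
have bL : bcf N2 L := weak_form_bcf bA1 bA2 bb hf.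
have Lout x : ~ (K x /\ 0 < d x) -> L x = 0.
  move=> nx; have [Kx|/fK[h1 h2 h3]] := pselect (K x); last by rewrite /L h1 h2 h3 !mulr0 !addr0.
  have [|h1 h2 h3] := A_out (x := x); first by move/(hO x Kx) => dx; apply: nx.
  by rewrite /L h1 h2 h3 !mul0r !addr0.
(* Zero for [d x <= de] and 1 for [d x >= 2 * de]: the gap next to the boundary makes the support of
   [f * th de] a compact subset of the domain. *)
pose th de x := step (d x / de - 1).
have hth de : C1on setT (th de) (fun x => step' (d x / de - 1) * (de^-1 * chart_fun1 theta g x))
   (fun x => step' (d x / de - 1) * (de^-1 * chart_fun2 theta g x)).
  have h1 := C1onB (C1onM (@C1on_cst R setT de^-1) (@chart_fun_C1 R theta g hg setT)) (@C1on_cst R setT 1).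
  have h2 := C1on_compr h1 (fun x _ => conj (is_derive_step _) (@continuous_step' R _)).
  by apply: C1on_eq h2 => x; rewrite /th /d /= [_ / de]mulrC//; congr (_ * _); ring.
have [Cf hCf] := continuous_N2_bound (r + N2 x0) (let: And3 h _ _ := C1on_continuousT hf in h).
pose Cf' := `|Cf|.
have fCf x : `|f x| <= Cf'.
  have [Kx|/fK[-> _ _]] := pselect (K x); last by rewrite normr0 normr_ge0.
  exact: le_trans (hCf x (NK x Kx)) (ler_norm _).
have Bge0 : 0 <= r + N2 x0 by apply: addr_ge0; [exact: ltW|exact: N2_ge0].
(* The part of the tested integrand in which the derivative falls on the cut-off. It contains the
   fields only through their normal component. *)
pose E de x := (f x * (step' (d x / de - 1) / de)) * (A1 x * chart_fun1 theta g x + A2 x * chart_fun2 theta g x).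
(* The 8 is the bound 4 of [step'] times the 2 in the width [2 * de] of the layer; the last factor
   is the constant of [I2_strip]. *)
pose C0 := 8 * Cf' * (4 * (r + N2 x0) + 1).
have C00 : 0 <= C0 by rewrite /C0 mulr_ge0// ?mulr_ge0// /Cf' ?normr_ge0// addr_ge0// mulr_ge0.
have main de : 0 < de -> bcf N2 (fun x => th de x * L x) /\ bcf N2 (E de) /\
    I2 (fun x => th de x * L x) + I2 (E de) = 0.
  move=> de0; have hft := C1onM hf (hth de).
  have bL' : bcf N2 (fun x => th de x * L x).
    have cth : continuous (th de) by have [h _ _] := C1on_continuousT (hth de).
    apply: bcf_bounded_mul => //; first exact: continuous_measurable2.
    move=> M; exact: continuous_N2_bound.
  have bW := weak_form_bcf bA1 bA2 bb hft.
  have bE : bcf N2 (E de).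
    have e : E de = (fun x => (A1 x * (f1 x * th de x + f x * (step' (d x / de - 1) * (de^-1 * chart_fun1 theta g x)))
       + A2 x * (f2 x * th de x + f x * (step' (d x / de - 1) * (de^-1 * chart_fun2 theta g x)))
       + b x * (f x * th de x)) - th de x * L x).
      by apply/funext => x; rewrite /E /L; ring.
    by rewrite e; apply: bcfB.
  split=> //; split=> //; rewrite -(IntD lf2 bL' bE) -[RHS](interior hft).
    by rewrite /weak_form /I2; congr Rintegral; apply/funext => x; rewrite /E /L; ring.
  exists (K `&` [set x | de <= d x]); split.
  - have cld : closed [set x | de <= d x].
      by apply: (@preimage_closed _ _ d [set t | de <= t]) => [x _|]; [exact: cd0|exact: closed_ge].
    by apply: (subclosed_compact (closedI clK cld) cK) => x [].
  - by move=> x [Kx dx]; apply/(hO x Kx); exact: lt_le_trans dx.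
  move=> x; have [Kx|/fK[-> _ _]] := pselect (K x); last by rewrite mul0r eqxx.
  move=> h; split=> //; rewrite /= leNgt; apply: contraNN h => dx.
  by rewrite /th step_le0 ?mulr0// subr_le0 ler_pdivrMr// mul1r ltW.
have Ebound e de : 0 < e -> 0 < de -> (forall x, K x -> Omega x -> d x <= 2 * de -> `|nu x| <= e) ->
    `|I2 (E de)| <= C0 * e.
  move=> e0 de0 hnu; have [_ [bE _]] := main de de0.
  have de2 : 0 <= 2 * de by rewrite mulr_ge0// ltW.
  have bS := bcf_strip theta (2 * de) hg Bge0.
  pose k := Cf' * (4 / de) * e.
  have k0 : 0 <= k.
    by apply: mulr_ge0; [apply: mulr_ge0; [exact: normr_ge0|apply: ltW; exact: divr_gt0]|exact: ltW].
  have bkS := bcfZ k bS.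
  have h1 : `|I2 (E de)| <= I2 (fun x => k * strip theta g (r + N2 x0) (2 * de) x).
    apply: (Int_norm_le lf2 bE bkS) => x.
    have h0 : 0 <= k * strip theta g (r + N2 x0) (2 * de) x.
      by rewrite mulr_ge0// /strip; case: ifP.
    have [Kx|/fK[fz _ _]] := pselect (K x); last by rewrite /E fz mul0r mul0r normr0.
    have [Ox|/A_out[a1 a2 _]] := pselect (Omega x); last by rewrite /E a1 a2 !mul0r addr0 mulr0 normr0.
    have [s4 sz] := step'_bound (d x / de - 1).
    case: (boolP (0 < d x / de - 1 <= 1)) => [/andP[dx1 dx2]|/sz sz']; last by rewrite /E sz' mul0r mulr0 mul0r normr0.
    have dx2' : d x <= 2 * de by rewrite -ler_pdivrMr//; lra.
    have dx0 : 0 < d x by apply/hO.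
    rewrite /strip NK// -/d dx0 dx2' /= mulr1 /E; have [-> ->] := AB Ox.
    have := hnu x Kx Ox dx2'; rewrite /nu => hn.
    have hs : `|step' (d x / de - 1) / de| <= 4 / de.
      by rewrite normrM normfV (gtr0_norm de0); apply: ler_wpM2r s4; rewrite invr_ge0 ltW.
    rewrite normrM /k; apply: ler_pM hn => //.
    by rewrite normrM; apply: ler_pM.
  apply: (le_trans h1); rewrite /I2 (IntZ lf2 k bS).
  have h2 := I2_strip theta hg Bge0 de2; rewrite /I2 in h2.
  apply: (le_trans (ler_wpM2l k0 h2)).
  have -> : k * ((4 * (r + N2 x0) + 1) * (2 * de)) = C0 * e.
    by rewrite /k /C0; field; rewrite gt_eqF.
  by [].
have den (n : nat) : 0 < (n.+1%:R : R)^-1 by rewrite invr_gt0.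
have lim : I2 (fun x => th n.+1%:R^-1 x * L x) @[n --> \oo] --> I2 L.
  have [M hM] := bL.2.
  apply: (Int_cvg lf2 (f_ := fun n x => th n.+1%:R^-1 x * L x) (f := L) (M := M) _ _ _).2.
  - by move=> n; have [[]] := main _ (den n).
  - move=> n x; have [hx hx'] := hM x; split; last by move=> /hx' ->; rewrite mulr0.
    rewrite normrM (le_trans _ hx)// ler_piMl// ler_norml.
    by have /andP[s0 ->] := step_itv (d x / n.+1%:R^-1 - 1); rewrite andbT (le_trans _ s0)// oppr_le0.
  move=> x; have [h|h] := pselect (K x /\ 0 < d x); last first.
    by rewrite Lout//; under eq_fun do rewrite mulr0; exact: cvg_cst.
  have [Kx dx] := h; apply: cvg_near_cst; near=> n.
  rewrite /th step_ge1 ?mul1r// invrK lerBrDr -ler_pdivrMl//.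
  apply: (@le_trans _ _ n%:R); last by rewrite ler_nat.
  by near: n; exact: nbhs_infty_ger.
have small e : 0 < e -> `|I2 L| <= (C0 + 1) * e.
  move=> e0; have [d0 d00 hd0] := small_normal cK hK e0.
  have nlim : \forall n \near \oo, `|I2 L - I2 (fun x => th n.+1%:R^-1 x * L x)| < e.
    by have /cvgrPdist_lt /(_ _ e0) := lim.
  near \oo => n.
  have h1 : `|I2 L - I2 (fun x => th n.+1%:R^-1 x * L x)| < e by near: n.
  have h2 : 2 * n.+1%:R^-1 <= d0.
    rewrite ler_pdivrMr// mulrC -ler_pdivrMr//.
    apply: (@le_trans _ _ n%:R); last by rewrite ler_nat.
    by near: n; exact: nbhs_infty_ger.
  have h3 := Ebound e _ e0 (den n) (fun x Kx Ox dx => hd0 x Kx Ox (le_trans dx h2)).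
  have [_ [_ h4]] := main _ (den n).
  have h5 := ler_normD (I2 L - I2 (fun x => th n.+1%:R^-1 x * L x)) (I2 (fun x => th n.+1%:R^-1 x * L x)).
  rewrite subrK -[X in _ <= _ + X]normrN in h5.
  have h6 : - I2 (fun x => th n.+1%:R^-1 x * L x) = I2 (E n.+1%:R^-1) by apply/eqP; rewrite eqr_oppLR -addr_eq0 h4.
  apply: (le_trans h5); rewrite mulrDl mul1r [leRHS]addrC.
  by apply: lerD; [exact: ltW|rewrite h6].
have [|nz'] := leP `|I2 L| 0; first by rewrite normr_le0 => /eqP h; exact: h.
(* Choosing [e] as [|I2 L|] over this constant gives [|I2 L| <= |I2 L| / 2]. *)
have C1 : 0 < 2 * (C0 + 1) by rewrite mulr_gt0// ltr_wpDl.
have := small _ (divr_gt0 nz' C1).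
have -> : (C0 + 1) * (`|I2 L| / (2 * (C0 + 1))) = `|I2 L| / 2.
  by field; rewrite gt_eqF// ltr_wpDl.
lra.
Unshelve. all: by end_near. Qed.
End boundary_ball.

(** By localization one point at a time is enough: off the closure the fields vanish, inside the
    domain the interior identity applies, and frontier points are the case of [boundary_ball]. *)
Lemma weak_form_up_to_boundary (Omega : set R2) (A1 A2 b B1 B2 : R2 -> R) :
  open Omega -> C2_boundary Omega -> bcf N2 A1 -> bcf N2 A2 -> bcf N2 b ->
  (forall x, ~ Omega x -> [/\ A1 x = 0, A2 x = 0 & b x = 0]) ->
  {within closure Omega, continuous B1} -> {within closure Omega, continuous B2} ->
  (forall x, Omega x -> A1 x = B1 x /\ A2 x = B2 x) ->
  weak_identity_in Omega A1 A2 b ->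
  (forall theta g x, C2_line g -> (\forall y \near x, Omega y <-> 0 < chart_fun theta g y) ->
    frontier Omega x -> B1 x * chart_fun1 theta g x + B2 x * chart_fun2 theta g x = 0) ->
  weak_identity A1 A2 b.
Proof.
move=> oO hO bA1 bA2 bb A_out cB1 cB2 AB int nrm f f1 f2 M hf f0.
apply: (weak_form_local bA1 bA2 bb (N2_compact (R := R) (M := M))) hf _; last first.
  by move=> x /= fx; rewrite leNgt; apply: contraNN fx => /f0 ->.
have N2ball (x y : R2) r : N2 (y - x) < r -> ball x r y.
  by move=> h; split; rewrite /ball /= distrC; [exact: le_lt_trans (N2_fst (y - x)) h|exact: le_lt_trans (N2_snd (y - x)) h].
move=> {f f1 f2 f0} x _; have [cx|ncx] := pselect (closure Omega x); last first.
  have : \forall y \near x, ~ Omega y.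
    suff : \forall y \near x, ~ closure Omega y by apply: filterS => y h1 h2; apply: h1; exact: subset_closure.
    apply: open_nbhs_nbhs; split=> //; apply: closed_openC; exact: closed_closure.
  move=> /nbhs_ballP[r /= r0 hr]; exists (r / 2); first exact: divr_gt0.
  move=> f f1 f2 hf /= f0; rewrite /weak_form -[RHS](Int0 (@lam2 R)); congr Rintegral.
  apply/funext => y; have [h|h] := ltP (N2 (y - x)) r.
    by have [-> -> ->] := A_out _ (hr y (N2ball _ _ _ h)); rewrite !mul0r !addr0.
  have hr2 : r / 2 < r by rewrite ltr_pdivrMr// ltr_pMr// ltr1n.
  have [||-> ->] := C1on_zero (x := y) hf (closed_openC (@N2_ball_closed x (r / 2))).
  - by apply/negP; rewrite -ltNge (lt_le_trans hr2).
  - by move=> z /negP; rewrite -ltNge => /ltW; exact: f0.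
  by rewrite f0 ?(le_trans (ltW hr2))// !mulr0 !addr0.
have [Ox|nOx] := pselect (Omega x).
  have /nbhs_ballP[r /= r0 hr] := open_nbhs_nbhs (conj oO Ox).
  exists (r / 2); first exact: divr_gt0.
  move=> f f1 f2 hf /= f0; apply: int => //; exists [set y | N2 (y - x) <= r / 2]; split.
  - exact: N2_ball_compact.
  - move=> y /= h; by apply/hr/N2ball; apply: (le_lt_trans h); rewrite ltr_pdivrMr// ltr_pMr// ltr1n.
  by move=> y /= fy; rewrite leNgt; apply: contraNN fy => /ltW/f0 ->.
have fx : frontier Omega x by apply/(frontier_open oO).
have [theta [g [hg nx]]] := hO _ fx.
have nx' : \forall y \near x, Omega y <-> 0 < chart_fun theta g y.
  by apply: filterS nx => y; rewrite subr_gt0.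
apply: (boundary_ball (B1 := B1) (B2 := B2) oO bA1 bA2 bb A_out cB1 cB2 AB int hg nx').
by apply: filterS (near_join nx') => y ny; exact: nrm.
Qed.
End boundary.

(** * Planar weak identities *)

Section interior_tools.
Context {R : realType}.
Local Notation R2 := (R * R)%type.

(** [U] and the complement of [K] are open and cover the plane. On the latter [a] and its gradient
    vanish, whatever [f], [f1], [f2] are there. *)
Lemma C1on_mul_supported (K U : set R2) (f f1 f2 a a1 a2 : R2 -> R) :
  C1on U f f1 f2 -> C1on setT a a1 a2 -> open U -> closed K -> K `<=` U ->
  (forall x, ~ K x -> a x = 0) ->
  C1on setT (fun x => a x * f x) (fun x => a1 x * f x + a x * f1 x)
    (fun x => a2 x * f x + a x * f2 x).
Proof.
move=> hf ha oU cK KU a0; have oK : open (~` K) by exact: closed_openC.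
have h1 := C1onM (C1on_sub (@subsetT _ U) ha) hf.
have h2 : C1on (~` K) (fun x => a x * f x) (fun x => a1 x * f x + a x * f1 x)
    (fun x => a2 x * f x + a x * f2 x).
  apply: (C1on_near_eq oK _ (@C1on_cst R _ 0)) => x nKx.
  by have [-> ->] := C1on_zero ha oK nKx a0; rewrite a0// !mul0r !addr0.
apply: C1on_sub (C1on_setU h1 h2) => x _.
by have [Kx|nKx] := pselect (K x); [left; exact: KU|right].
Qed.

Section C1_on_subset_of_line.
Variables (J : set R) (k : R -> R).
Hypothesis kC1 : C1_in J k.

(** A first order expansion along [J] only, which is all that is seen by [k (psi x)], since [psi]
    takes its values on the closure in [J]. *)
Lemma C1_in_expansion t0 e : J t0 -> 0 < e ->
  \forall t \near t0, J t -> `|k t - k t0 - derive_in J k t0 * (t - t0)| <= e * `|t - t0|.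
Proof.
move=> Jt0 e0; have [dk _] := kC1; have dk0 := dk _ Jt0.
have /cvgrPdist_lt /(_ _ e0) := dk0.
move=> h; have {}h : \forall t \near t0, t != t0 -> J t ->
    `|derive_in J k t0 - (k t - k t0) / (t - t0)| < e by exact: h.
apply: filterS h => t h Jt; have [->|tx] := eqVneq t t0.
  by rewrite !subrr mulr0 subr0 normr0 mulr0.
have tx0 : t - t0 != 0 by rewrite subr_eq0.
have -> : k t - k t0 - derive_in J k t0 * (t - t0) =
    - (derive_in J k t0 - (k t - k t0) / (t - t0)) * (t - t0) by field.
by rewrite normrM normrN ler_wpM2r// ltW// h.
Qed.

Lemma C1_in_continuous : {within J, continuous k}.
Proof.
apply/subspace_continuousP => t0 Jt0; apply/cvgrPdist_le => e e0.
have n1 := C1_in_expansion Jt0 ltr01.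
pose C := `|derive_in J k t0| + 1; have C0 : 0 < C by rewrite /C ltr_wpDl.
have n2 : \forall t \near t0, `|t0 - t| < e / C.
  by apply: (nbhsx_ballx t0 (e / C)); exact: divr_gt0.
suff : \forall t \near t0, J t -> `|k t0 - k t| <= e by [].
apply: filterS (filterI n1 n2) => t [h1 h2] Jt; have {}h1 := h1 Jt.
rewrite distrC -(subrK (derive_in J k t0 * (t - t0)) (k t - k t0)).
rewrite (le_trans (ler_normD _ _))//.
apply: (le_trans (lerD h1 (lexx _))); rewrite normrM mul1r distrC.
have -> : `|t0 - t| + `|derive_in J k t0| * `|t0 - t| = `|t0 - t| * C by rewrite /C; ring.
by rewrite -ler_pdivlMr// ltW.
Qed.
End C1_on_subset_of_line.

Section fields_on_domain.
Variable Omega : set R2.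
Hypotheses (oO : open Omega) (bO : bounded_set Omega).
Definition cont_cl (Y : R2 -> R) := {within closure Omega, continuous Y}.
Local Notation cc := cont_cl.

Definition ext (Y : R2 -> R) (x : R2) : R := if x \in Omega then Y x else 0.

Lemma extE Y x : Omega x -> ext Y x = Y x.
Proof. by move=> Ox; rewrite /ext mem_set. Qed.

Lemma ext_out Y x : ~ Omega x -> ext Y x = 0.
Proof. by move=> Ox; rewrite /ext memNset. Qed.

Lemma cc_cvg Y x : cc Y -> closure Omega x -> Y y @[y --> within (closure Omega) (nbhs x)] --> Y x.
Proof. by move=> cY cx; exact: (subspace_continuousP _ _).1 cY _ cx. Qed.

Lemma ccP (Y : R2 -> R) : (forall x, closure Omega x -> Y y @[y --> within (closure Omega) (nbhs x)] --> Y x) ->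
  cc Y.
Proof. by move=> h; apply/subspace_continuousP. Qed.

Lemma cc_continuous Y : continuous Y -> cc Y.
Proof. by move=> cY; apply: ccP => x _; apply: cvg_within_filter; exact: cY. Qed.

Lemma ccD Y Z : cc Y -> cc Z -> cc (fun x => Y x + Z x).
Proof. by move=> cY cZ; apply: ccP => x cx; apply: cvgD; exact: cc_cvg. Qed.

Lemma ccM Y Z : cc Y -> cc Z -> cc (fun x => Y x * Z x).
Proof. by move=> cY cZ; apply: ccP => x cx; apply: cvgM; exact: cc_cvg. Qed.

Lemma ccN Y : cc Y -> cc (fun x => - Y x).
Proof. by move=> cY; apply: ccP => x cx; apply: cvgN; exact: cc_cvg. Qed.

Lemma cc_comp (k : R -> R) Y : cc Y -> {within Y @` closure Omega, continuous k} ->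
  cc (fun x => k (Y x)).
Proof.
move=> cY ck; apply: ccP => x cx V nV.
have JY : (Y @` closure Omega) (Y x) by exists x.
have nW : \forall t \near Y x, (Y @` closure Omega) t -> V (k t).
  exact: ((subspace_continuousP _ _).1 ck _ JY V nV).
have : \forall y \near x, closure Omega y -> (Y @` closure Omega) (Y y) -> V (k (Y y)).
  exact: (cc_cvg cY cx nW).
by apply: filterS => y h cy; apply: h => //; exists y.
Qed.

Lemma cc_for Y x : cc Y -> Omega x -> {for x, continuous Y}.
Proof.
move=> cY Ox V nV; have h : \forall y \near x, closure Omega y -> V (Y y).
  exact: (cc_cvg cY (subset_closure Ox) nV).
apply: filterS (filterI h (open_nbhs_nbhs (conj oO Ox))) => y [h1 Oy].
by apply: h1; exact: subset_closure.
Qed.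

Lemma bounded_N2 : exists M : R, closure Omega `<=` [set x | N2 x <= M].
Proof.
have [M0 [_ hM]] := bO; exists (M0 + 1).
have cl : closed [set x : R2 | N2 x <= M0 + 1].
  have := @N2_ball_closed R 0 (M0 + 1).
  by congr closed; apply/seteqP; split => x /=; rewrite subr0.
rewrite [X in _ `<=` X](closure_id _).1//; apply: closureS => x Ox /=.
by rewrite N2E; apply: hM => //; rewrite ltrDl.
Qed.

Lemma compact_closure_domain : compact (closure Omega).
Proof.
have [M hM] := bounded_N2.
exact: (subclosed_compact (@closed_closure _ Omega) (N2_compact (R := R) (M := M)) hM).
Qed.

(** The jump at the boundary is harmless: the preimage of an open [U] is an open part of the domain,
    together with the complement of the domain when [U 0] holds. *)
Lemma ext_measurable Y : (forall x, Omega x -> {for x, continuous Y}) ->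
  measurable_fun setT (ext Y).
Proof.
move=> cY; apply: measurable_fun_preimage_open => U oU.
have oV : open (Omega `&` Y @^-1` U).
  rewrite openE => x [Ox Ux]; apply: filterI; first exact: open_nbhs_nbhs.
  by apply: (cY x Ox); exact: open_nbhs_nbhs.
have -> : ext Y @^-1` U = (Omega `&` Y @^-1` U) `|` (~` Omega `&` [set x | U 0]).
  apply/seteqP; split => x /=.
    by have [Ox|nOx] := pselect (Omega x); [rewrite extE//; left|rewrite ext_out//; right].
  by move=> [[Ox Ux]|[nOx U0]]; [rewrite extE|rewrite ext_out].
apply: measurableU; first exact: open_measurable2.
apply: measurableI; first by apply: measurableC; exact: open_measurable2.
have [U0|nU0] := pselect (U 0).
  by have -> : [set x : R2 | U 0] = setT by apply/seteqP; split.
by have -> : [set x : R2 | U 0] = set0 by apply/seteqP; split.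
Qed.

Lemma ext_bcf Y : cc Y -> bcf N2 (ext Y).
Proof.
move=> cY; split; first by apply: ext_measurable => x; exact: cc_for.
have [M hM] := bounded_N2; have [B hB] := compact_bound compact_closure_domain cY.
exists (`|M| + `|B|) => x; have [Ox|nOx] := pselect (Omega x); last first.
  by rewrite ext_out// normr0; split=> //; rewrite addr_ge0.
rewrite extE//; have cx := subset_closure Ox; split.
  by rewrite (le_trans (hB x cx))// (le_trans (ler_norm B))// lerDr.
move=> h; exfalso; have := le_lt_trans (le_trans (hM x cx) (ler_norm M)) (le_lt_trans _ h).
by rewrite lerDl normr_ge0 ltxx => /(_ isT).
Qed.

Lemma C1on_comp_in (k : R -> R) (psi psi1 psi2 : R2 -> R) : cc psi -> C1on Omega psi psi1 psi2 ->
  C1_in (psi @` closure Omega) k ->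
  let k' := derive_in (psi @` closure Omega) k in
  C1on Omega (fun x => k (psi x)) (fun x => k' (psi x) * psi1 x) (fun x => k' (psi x) * psi2 x).
Proof.
move=> cpsi hpsi kC1 k' x Ox; have [dk ck] := kC1; have [dpsi c1 c2] := hpsi x Ox.
have cpx : {for x, continuous psi} := cc_for cpsi Ox.
have ckx : {for x, continuous (fun y => k' (psi y))} := cc_for (cc_comp cpsi ck) Ox.
split; [|exact: cvgM ckx c1|exact: cvgM ckx c2].
apply/is_diff2P => e e0.
pose J := psi @` closure Omega; have Jx : J (psi x) by exists x => //; exact: subset_closure.
pose C := `|psi1 x| + `|psi2 x| + 1.
have C0 : 0 < C by rewrite /C ltr_wpDl ?addr_ge0.
(* [e1] is the error allowed to [k] and [e2] the one allowed to [psi]; each contributes half of [e].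
   The bound [e2 <= 1] is what makes [C] a Lipschitz constant of [psi] at [x]. *)
pose e1 := e / (2 * C); have e10 : 0 < e1 by rewrite divr_gt0// mulr_gt0.
pose e2 := Num.min 1 (e / (2 * (`|k' (psi x)| + 1))).
have k0 : 0 < 2 * (`|k' (psi x)| + 1) by rewrite mulr_gt0// ltr_wpDl.
have e20 : 0 < e2 by rewrite lt_min ltr01 divr_gt0.
have nk := C1_in_expansion kC1 Jx e10.
have nd := (is_diff2P _ _ _ _).1 dpsi _ e20.
have nO := open_nbhs_nbhs (conj oO Ox).
have nk' := cpx _ nk.
apply: filterS (filterI nO (filterI nd nk')) => y [Oy [hd hk]].
have {}hk := hk (ex_intro2 _ _ y (subset_closure Oy) erefl).
have hdot : `|dot_grad (psi1 x) (psi2 x) (y - x)| <= (`|psi1 x| + `|psi2 x|) * `|y - x|.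
  rewrite /dot_grad (le_trans (ler_normD _ _))// !normrM mulrDl -!N2E.
  by rewrite lerD// mulrC ler_wpM2l//; [exact: N2_fst (y - x)|exact: N2_snd (y - x)].
have hpx : `|psi y - psi x| <= C * `|y - x|.
  rewrite -(subrK (dot_grad (psi1 x) (psi2 x) (y - x)) (psi y - psi x)).
  rewrite (le_trans (ler_normD _ _))// /C mulrDl addrC lerD// (le_trans hd)//.
  by rewrite ler_wpM2r// ge_min lexx.
have -> : k (psi y) - k (psi x) - dot_grad (k' (psi x) * psi1 x) (k' (psi x) * psi2 x) (y - x) =
   (k (psi y) - k (psi x) - k' (psi x) * (psi y - psi x))
   + k' (psi x) * (psi y - psi x - dot_grad (psi1 x) (psi2 x) (y - x)) by rewrite /dot_grad; ring.
rewrite (le_trans (ler_normD _ _))//.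
have h1 : `|k (psi y) - k (psi x) - k' (psi x) * (psi y - psi x)| <= e / 2 * `|y - x|.
  rewrite (le_trans hk)// (le_trans (ler_wpM2l (ltW e10) hpx))//.
  by rewrite mulrA /e1; have -> : e / (2 * C) * C = e / 2 by field; rewrite gt_eqF.
have h2 : `|k' (psi x) * (psi y - psi x - dot_grad (psi1 x) (psi2 x) (y - x))| <= e / 2 * `|y - x|.
  rewrite normrM (le_trans (ler_wpM2l (normr_ge0 _) hd))// mulrA ler_wpM2r//.
  have : `|k' (psi x)| * e2 <= `|k' (psi x)| * (e / (2 * (`|k' (psi x)| + 1))).
    by rewrite ler_wpM2l// ge_min lexx orbT.
  move=> h; apply: (le_trans h); set q := `|k' (psi x)|.
  have q0 : 0 <= q by exact: normr_ge0.
  rewrite mulrA ler_pdivrMr ?mulr_gt0 ?ltr_wpDl//.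
  have -> : e / 2 * (2 * (q + 1)) = q * e + e by field.
  by rewrite lerDl ltW.
by have := lerD h1 h2; have -> : e / 2 * `|y - x| + e / 2 * `|y - x| = e * `|y - x| by field.
Qed.

(** The factor 4 leaves room around the support of the test, both for mollifying it and for a
    cut-off of [psi] that equals 1 near that support. *)
Lemma interior_of_balls (A1 A2 b : R2 -> R) : bcf N2 A1 -> bcf N2 A2 -> bcf N2 b ->
  (forall x r, 0 < r -> (forall y, N2 (y - x) <= 4 * r -> Omega y) -> weak_in_ball A1 A2 b (x, r)) ->
  weak_identity_in Omega A1 A2 b.
Proof.
move=> bA1 bA2 bb hball f f1 f2 hf [K [cK KO fK]].
apply: (weak_form_local bA1 bA2 bb cK _ hf fK) => x Kx.
have /nbhs_ballP[r /= r0 hr] := open_nbhs_nbhs (conj oO (KO _ Kx)).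
exists (r / 8); first exact: divr_gt0.
apply: hball; first exact: divr_gt0.
move=> y h; apply: hr; have {}h : N2 (y - x) < r by rewrite (le_lt_trans h)//; lra.
by split; rewrite /ball /= distrC; [exact: le_lt_trans (N2_fst (y - x)) h|exact: le_lt_trans (N2_snd (y - x)) h].
Qed.

End fields_on_domain.

End interior_tools.

Section bump_second_derivatives.
Context {R : realType}.
Local Notation R2 := (R * R)%type.

Lemma bump1'_C1 U r (f f1 f2 : R2 -> R) : C1on U f f1 f2 ->
  exists b : R2 -> R, C1on U (fun x => bump1' r (f x)) (fun x => b x * f1 x) (fun x => b x * f2 x).
Proof.
move=> hf; have h1 := C1onB (@C1on_cst R U (r ^+ 2)) (C1onM hf hf).
have h2 := @C1on_compr _ U _ _ _ (flat (flat_next 1)) (flat (flat_next (flat_next 1))) h1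
    (fun x _ => conj (is_derive_flat _ _) (@continuous_flat _ _ _)).
have h3 := C1onM h2 (C1onM (@C1on_cst R U (- 2)) hf).
exists (fun x => flat (flat_next (flat_next 1)) (r ^+ 2 - f x ^+ 2) * (-2 * f x) * (-2 * f x)
  + flat (flat_next 1) (r ^+ 2 - f x ^+ 2) * -2).
apply: C1on_eq h3 => x; rewrite /= /bump1' ?expr2 //; ring.
Qed.

(** The same [b12] serves in both conclusions: this symmetry of the mixed derivatives is the
    cancellation behind [div_bump]. *)
Lemma bump_12_C1 r (y : R2) : exists b11 b12 b22 : R2 -> R,
  C1on setT (bump_1 r y) b11 b12 /\ C1on setT (bump_2 r y) b12 b22.
Proof.
have s1 := C1onB (@C1on_fst R setT) (@C1on_cst R setT y.1).
have s2 := C1onB (@C1on_snd R setT) (@C1on_cst R setT y.2).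
have [c1 h1] := bump1'_C1 r s1; have [c2 h2] := bump1'_C1 r s2.
have k1 := bump1_C1 r s1; have k2 := bump1_C1 r s2.
exists (fun x => c1 x * bump1 r (x.2 - y.2)),
  (fun x => bump1' r (x.1 - y.1) * bump1' r (x.2 - y.2)), (fun x => bump1 r (x.1 - y.1) * c2 x).
split; first by apply: C1on_eq (C1onM h1 k2) => x //; ring.
by apply: C1on_eq (C1onM k1 h2) => x //; ring.
Qed.
End bump_second_derivatives.

(** * Algebraic form of the momentum identities *)

Section pointwise_identities.
Variables (R : realType) (h y1 y2 p1 p2 F H dF dH a a1 a2 : R).
Hypothesis h_gt0 : 0 < h.
Let s := y1 ^+ 2 + y2 ^+ 2 + h ^+ 2.
Let k11 := s^-1 * (h ^+ 2 + y2 ^+ 2).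
Let k12 := s^-1 * - (y1 * y2).
Let k22 := s^-1 * (h ^+ 2 + y1 ^+ 2).
Let k11_1 := - s ^- 2 * (2 * y1) * (h ^+ 2 + y2 ^+ 2).
Let k11_2 := - s ^- 2 * (2 * y2) * (h ^+ 2 + y2 ^+ 2) + s^-1 * (2 * y2).
Let k12_1 := - s ^- 2 * (2 * y1) * - (y1 * y2) + s^-1 * - y2.
Let k12_2 := - s ^- 2 * (2 * y2) * - (y1 * y2) + s^-1 * - y1.
Let k22_1 := - s ^- 2 * (2 * y1) * (h ^+ 2 + y1 ^+ 2) + s^-1 * (2 * y1).
Let k22_2 := - s ^- 2 * (2 * y2) * (h ^+ 2 + y1 ^+ 2).
Let m := s^-1 * (- (y1 * p1) - y2 * p2 + F).
Let v1 := s^-1 * (- (y1 * y2 * p1) + (h ^+ 2 + y1 ^+ 2) * p2 + F * y2).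
Let v2 := s^-1 * (- ((h ^+ 2 + y2 ^+ 2) * p1) + y1 * y2 * p2 - F * y1).
Let P := H - s^-1 * ((h ^+ 2 + y2 ^+ 2) * p1 ^+ 2 + (h ^+ 2 + y1 ^+ 2) * p2 ^+ 2
                - 2 * y1 * y2 * p1 * p2 + F ^+ 2) / 2.
Let f := - (2 * h ^+ 2 * F / s ^+ 2) - dF * F / s + dH.

Lemma s_neq0 : s != 0.
Proof.
rewrite gt_eqF// /s; apply: (@lt_le_trans _ _ (h ^+ 2)); first by rewrite exprn_gt0.
by rewrite lerDr addr_ge0 ?sqr_ge0.
Qed.

(** Here [p1], [p2] are the derivatives of [psi]. The right side consists of [- 1 / 2] times the
    integrand of [stress1], the first derivatives of [a H(psi)] and of [- a F(psi)^2 / (2 s)], and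
    the integrand of (F) tested with [a y2 / s], so every term has integral zero. *)
Lemma momentum_identity1 :
  (v1 * p2 + P) * a1 + - (v1 * p1) * a2 + - (m * v2) * a =
  - 2^-1 * (- ((k11_1 * a + k11 * a1) * (p1 * p1)
     + 2 * ((k12_1 * a + k12 * a1) * (p1 * p2))
     + (k22_1 * a + k22 * a1) * (p2 * p2))
  + 2 * (p1 * ((k11 * p1 + k12 * p2) * a1 + (k12 * p1 + k22 * p2) * a2))
  + 2 * (f * (p1 * a)))
  + ((a1 * H + a * (dH * p1))
  + (- 2^-1 * (a1 * (F * F * s^-1) + a * ((dF * p1 * F + F * (dF * p1)) * s^-1 + F * F * (- s ^- 2 * (2 * y1))))
  + (F * p2 * (a1 * (y2 * s^-1) + a * (y2 * (- s ^- 2 * (2 * y1))))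
     + - (F * p1) * (a2 * (y2 * s^-1) + a * (s^-1 + y2 * (- s ^- 2 * (2 * y2))))))).
Proof.
rewrite /P /f /v1 /v2 /m /k11_1 /k12_1 /k22_1 /k11 /k12 /k22.
have := s_neq0; rewrite /s => s0; field; exact: s0.
Qed.

(** The counterpart in the second direction; here (F) is tested with [- a y1 / s]. *)
Lemma momentum_identity2 :
  (v2 * p2) * a1 + (P - v2 * p1) * a2 + (m * v1) * a =
  - 2^-1 * (- ((k22_2 * a + k22 * a2) * (p2 * p2)
     + 2 * ((k12_2 * a + k12 * a2) * (p2 * p1))
     + (k11_2 * a + k11 * a2) * (p1 * p1))
  + 2 * (p2 * ((k22 * p2 + k12 * p1) * a2 + (k12 * p2 + k11 * p1) * a1))
  + 2 * (f * (p2 * a)))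
  + ((a2 * H + a * (dH * p2))
  + (- 2^-1 * (a2 * (F * F * s^-1) + a * ((dF * p2 * F + F * (dF * p2)) * s^-1 + F * F * (- s ^- 2 * (2 * y2))))
  + - (F * p2 * (a1 * (y1 * s^-1) + a * (s^-1 + y1 * (- s ^- 2 * (2 * y1))))
     + - (F * p1) * (a2 * (y1 * s^-1) + a * (y1 * (- s ^- 2 * (2 * y2))))))).
Proof.
rewrite /P /f /v1 /v2 /m /k11_2 /k12_2 /k22_2 /k11 /k12 /k22.
have := s_neq0; rewrite /s => s0; field; exact: s0.
Qed.
(** The balance of angular momentum: (2) tested with [y1 a], minus (1) tested with [y2 a], plus (F)
    tested with [a], all divided by [h]. It rests on [h^2 m = F + y1 v2 - y2 v1]. *)
Lemma momentum_identity3 (q : R) :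
  (h * m * p2 - q / h * y2) * a1 + (- (h * m * p1) + q / h * y1) * a2 =
  h^-1 * (v2 * p2 * (1 * a + y1 * a1) + (q - v2 * p1) * (0 * a + y1 * a2) + m * v1 * (y1 * a))
  + (- h^-1 * ((v1 * p2 + q) * (0 * a + y2 * a1) + - (v1 * p1) * (1 * a + y2 * a2) + - (m * v2) * (y2 * a))
  + h^-1 * (F * p2 * a1 + - (F * p1) * a2)).
Proof.
rewrite /v1 /v2 /m; have := s_neq0; rewrite /s => s0; field.
by rewrite s0 gt_eqF.
Qed.
End pointwise_identities.

Lemma I2_combination (R : realType) (k1 k2 k3 k4 k5 : R) (f1 f2 f3 f4 f5 : R * R -> R) :
  bcf N2 f1 -> bcf N2 f2 -> bcf N2 f3 -> bcf N2 f4 -> bcf N2 f5 ->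
  I2 f1 = 0 -> I2 f2 = 0 -> I2 f3 = 0 -> I2 f4 = 0 -> I2 f5 = 0 ->
  I2 (fun x => k1 * f1 x + (k2 * f2 x + (k3 * f3 x + (k4 * f4 x + k5 * f5 x)))) = 0.
Proof.
move=> B1 B2 B3 B4 B5 e1 e2 e3 e4 e5.
have z (k : R) (f : R * R -> R) : bcf N2 f -> I2 f = 0 -> I2 (fun x => k * f x) = 0.
  by move=> bf If; have := IntZ lf2 k bf; rewrite [X in _ * X]If mulr0.
have z1 := z k1 _ B1 e1; have z2 := z k2 _ B2 e2; have z3 := z k3 _ B3 e3.
have z4 := z k4 _ B4 e4; have z5 := z k5 _ B5 e5.
have b1 := bcfZ k1 B1; have b2 := bcfZ k2 B2; have b3 := bcfZ k3 B3.
have b4 := bcfZ k4 B4; have b5 := bcfZ k5 B5.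
have b45 := bcfD b4 b5; have b345 := bcfD b3 b45; have b2345 := bcfD b2 b345.
have := IntD lf2 b1 b2345; rewrite (IntD lf2 b2 b345) (IntD lf2 b3 b45) (IntD lf2 b4 b5).
by rewrite [X in X + _]z1 [X in _ + (X + _)]z2 [X in _ + (_ + (X + _))]z3 [X in _ + (_ + (_ + (X + _)))]z4 [X in _ + (_ + (_ + (_ + X)))]z5 !addr0.
Qed.

Section planar_weak_forms.
Context {R : realType}.
Local Notation R2 := (R * R)%type.
Variables (h c : R) (Omega : set R2) (F H : R -> R) (psi G1 G2 : R2 -> R).
Hypotheses (h_gt0 : 0 < h) (oO : open Omega) (bO : bounded_set Omega).
Local Notation cc := (cont_cl Omega).
Local Notation J := (psi @` closure Omega).
Hypotheses (F_C1 : C1_in J F) (H_C1 : C1_in J H).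
Hypotheses (cpsi : cc psi) (cG1 : cc G1) (cG2 : cc G2) (hpsi : C1on Omega psi G1 G2).

Let s x : R := x.1 ^+ 2 + x.2 ^+ 2 + h ^+ 2.
Let Fp x := F (psi x).
Let Hp x := H (psi x).
Let dF x := derive_in J F (psi x).
Let dH x := derive_in J H (psi x).

Definition source (x : R2) : R :=
  - (2 * h ^+ 2 * Fp x / s x ^+ 2) - dF x * Fp x / s x + dH x.
Definition vel1 (x : R2) : R := (velocity h x (G1 x, G2 x) (Fp x)).1.1.
Definition vel2 (x : R2) : R := (velocity h x (G1 x, G2 x) (Fp x)).1.2.
(** The vertical velocity over [h]: the angular rate at which the helical frame turns along the
    flow. *)
Definition slope (x : R2) : R := (s x)^-1 * (- (x.1 * G1 x) - x.2 * G2 x + Fp x).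
Definition pressure (x : R2) : R := Hp x - speed2 h x (G1 x, G2 x) (Fp x) / 2.
Definition flux1 (x : R2) : R := (Kmul h x (G1 x, G2 x)).1.
Definition flux2 (x : R2) : R := (Kmul h x (G1 x, G2 x)).2.

Lemma xi2_neq0 (x : R2) : s x != 0.
Proof. exact: s_neq0. Qed.

Let hs U : C1on U s (fun x => 2 * x.1) (fun x => 2 * x.2).
Proof.
have h1 := C1onM (@C1on_fst R U) (@C1on_fst R U).
have h2 := C1onM (@C1on_snd R U) (@C1on_snd R U).
apply: C1on_eq (C1onD (C1onD h1 h2) (@C1on_cst R U (h ^+ 2))) => x; rewrite /s ?expr2 //; ring.
Qed.

Let hsV U : C1on U (fun x => (s x)^-1) (fun x => - s x ^- 2 * (2 * x.1)) (fun x => - s x ^- 2 * (2 * x.2)).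
Proof. exact: C1onV (@hs U) (fun x _ => xi2_neq0 x). Qed.

Let hx1 U : C1on U (fun x : R2 => h ^+ 2 + x.1 ^+ 2) (fun x => 2 * x.1) (fun=> 0).
Proof.
have h1 := C1onM (@C1on_fst R U) (@C1on_fst R U).
apply: C1on_eq (C1onD (@C1on_cst R U (h ^+ 2)) h1) => x; rewrite ?expr2 //; ring.
Qed.

Let hx2 U : C1on U (fun x : R2 => h ^+ 2 + x.2 ^+ 2) (fun=> 0) (fun x => 2 * x.2).
Proof.
have h1 := C1onM (@C1on_snd R U) (@C1on_snd R U).
apply: C1on_eq (C1onD (@C1on_cst R U (h ^+ 2)) h1) => x; rewrite ?expr2 //; ring.
Qed.

Let hx12 U : C1on U (fun x : R2 => - (x.1 * x.2)) (fun x => - x.2) (fun x => - x.1).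
Proof.
have h1 := C1onN (C1onM (@C1on_fst R U) (@C1on_snd R U)).
apply: C1on_eq h1 => x //; ring.
Qed.

Let k11 x := (s x)^-1 * (h ^+ 2 + x.2 ^+ 2).
Let k12 x := (s x)^-1 * - (x.1 * x.2).
Let k22 x := (s x)^-1 * (h ^+ 2 + x.1 ^+ 2).
Let k11_1 x := - s x ^- 2 * (2 * x.1) * (h ^+ 2 + x.2 ^+ 2).
Let k11_2 x := - s x ^- 2 * (2 * x.2) * (h ^+ 2 + x.2 ^+ 2) + (s x)^-1 * (2 * x.2).
Let k12_1 x := - s x ^- 2 * (2 * x.1) * - (x.1 * x.2) + (s x)^-1 * - x.2.
Let k12_2 x := - s x ^- 2 * (2 * x.2) * - (x.1 * x.2) + (s x)^-1 * - x.1.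
Let k22_1 x := - s x ^- 2 * (2 * x.1) * (h ^+ 2 + x.1 ^+ 2) + (s x)^-1 * (2 * x.1).
Let k22_2 x := - s x ^- 2 * (2 * x.2) * (h ^+ 2 + x.1 ^+ 2).

Let hk11 : C1on setT k11 k11_1 k11_2.
Proof. by apply: C1on_eq (C1onM (@hsV setT) (@hx2 setT)) => x //; rewrite /k11_1 mulr0 addr0. Qed.
Let hk12 : C1on setT k12 k12_1 k12_2.
Proof. exact: C1onM (@hsV setT) (@hx12 setT). Qed.
Let hk22 : C1on setT k22 k22_1 k22_2.
Proof. by apply: C1on_eq (C1onM (@hsV setT) (@hx1 setT)) => x //; rewrite /k22_2 mulr0 addr0. Qed.

Let psd x v1 v2 : 0 <= k11 x * v1 ^+ 2 + 2 * k12 x * v1 * v2 + k22 x * v2 ^+ 2.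
Proof.
have -> : k11 x * v1 ^+ 2 + 2 * k12 x * v1 * v2 + k22 x * v2 ^+ 2 =
   (s x)^-1 * (h ^+ 2 * (v1 ^+ 2 + v2 ^+ 2) + (x.2 * v1 - x.1 * v2) ^+ 2).
  by rewrite /k11 /k12 /k22; ring.
have s0 : 0 <= s x by rewrite /s; do 2?[apply: addr_ge0]; exact: sqr_ge0.
apply: mulr_ge0; first by rewrite invr_ge0.
by apply: addr_ge0; [apply: mulr_ge0; [|apply: addr_ge0]|]; exact: sqr_ge0.
Qed.

Let cc1 : cc (fun x => x.1). Proof. by apply: cc_continuous; have [] := C1on_continuousT (@C1on_fst R setT). Qed.
Let cc2 : cc (fun x => x.2). Proof. by apply: cc_continuous; have [] := C1on_continuousT (@C1on_snd R setT). Qed.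
Let ccs : cc (fun x => (s x)^-1). Proof. by apply: cc_continuous; have [] := C1on_continuousT (@hsV setT). Qed.
Let cck (k : R) : cc (fun=> k). Proof. by apply: cc_continuous; exact: continuous_const. Qed.
Let ccF : cc Fp. Proof. exact: cc_comp cpsi (C1_in_continuous F_C1). Qed.
Let ccH : cc Hp. Proof. exact: cc_comp cpsi (C1_in_continuous H_C1). Qed.
Let ccdF : cc dF. Proof. by apply: cc_comp cpsi _; have [] := F_C1. Qed.
Let ccdH : cc dH. Proof. by apply: cc_comp cpsi _; have [] := H_C1. Qed.

Ltac prove_cc := repeat lazymatch goal with
  | |- cont_cl _ (fun x => @?a x + @?b x) => apply: (@ccD R Omega a b)
  | |- cont_cl _ (fun x => @?a x * @?b x) => apply: (@ccM R Omega a b)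
  | |- cont_cl _ (fun x => - @?a x) => apply: (@ccN R Omega a)
  | |- cont_cl _ (fun x => @?a x ^+ 2) => apply: (@ccM R Omega a a)
  | |- cont_cl _ (fun=> ?k) => exact: cck
  | |- cont_cl _ (fun x => x.1) => exact: cc1
  | |- cont_cl _ (fun x => x.2) => exact: cc2
  | |- cont_cl _ (fun x => (_ x)^-1) => exact: ccs
  | Y : cont_cl _ ?a |- cont_cl _ (fun x => ?a x) => exact: Y
  | Y : cont_cl _ ?a |- cont_cl _ ?a => exact: Y
  end.

Lemma cc_vel1 : cc vel1.
Proof. by rewrite /vel1 /velocity /=; prove_cc. Qed.

Lemma cc_vel2 : cc vel2.
Proof. by rewrite /vel2 /velocity /=; prove_cc. Qed.

Lemma cc_slope : cc slope.
Proof. by rewrite /slope; prove_cc. Qed.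

Lemma cc_pressure : cc pressure.
Proof. by rewrite /pressure /speed2 /=; prove_cc. Qed.

Lemma cc_flux1 : cc flux1.
Proof. by rewrite /flux1 /Kmul /=; prove_cc. Qed.

Lemma cc_flux2 : cc flux2.
Proof. by rewrite /flux2 /Kmul /=; prove_cc. Qed.

Lemma cc_source : cc source.
Proof.
have e : source = (fun x => - (2 * h ^+ 2 * Fp x * ((s x)^-1 * (s x)^-1)) - dF x * Fp x * (s x)^-1 + dH x).
  by apply/funext => x; rewrite /source expr2 invfM.
by rewrite e; prove_cc.
Qed.

Hypothesis weak_source : forall (y : R2) (r : R), 0 < r -> (forall x, N2 (x - y) <= r -> Omega x) ->
  weak_form (ext Omega flux1) (ext Omega flux2) (ext Omega source)
    (bump r y) (bump_1 r y) (bump_2 r y) = 0.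

Local Notation inner := (weak_identity_in Omega).

Let inner_of_bumps A1 A2 b : bcf N2 A1 -> bcf N2 A2 -> bcf N2 b ->
  (forall (y : R2) (r : R), 0 < r -> (forall x, N2 (x - y) <= r -> Omega x) ->
    weak_form A1 A2 b (bump r y) (bump_1 r y) (bump_2 r y) = 0) -> inner A1 A2 b.
Proof.
move=> bA1 bA2 bb hb; apply: interior_of_balls => // x r r0 hr f f1 f2 hf f0.
apply: (weak_form_of_bumps bA1 bA2 bb hf (M := r + N2 x) (r0 := r)) => //.
  move=> y; rewrite N2E N2E => hy; apply: f0; rewrite /= N2E.
  by have := ler_normD (y - x) x; rewrite subrK => hy'; lra.
move=> y rho fy /andP[rho0 rhor]; apply: hb => // z hz; apply: hr.
have hy : N2 (y - x) < r by rewrite ltNge; apply: contraNN fy => /f0 ->.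
rewrite !N2E in hz hy *; have := ler_normD (z - y) (y - x).
by rewrite addrA subrK => hy'; lra.
Qed.

Let bG1 : bcf N2 (ext Omega (fun x => - G1 x)).
Proof. by apply: ext_bcf => //; exact: ccN. Qed.
Let bG2 : bcf N2 (ext Omega G2). Proof. exact: ext_bcf. Qed.

(** As [psi] has no second derivatives, they are put on the bump: [G2 b_1 - G1 b_2] is the second
    derivative of [psi b_1] minus the first derivative of [psi b_2], where [b_i] denotes a partial
    derivative of the bump. *)
Lemma div_bump y r : 0 < r -> (forall x, N2 (x - y) <= r -> Omega x) ->
  weak_form (ext Omega G2) (ext Omega (fun x => - G1 x)) (fun=> 0)
    (bump r y) (bump_1 r y) (bump_2 r y) = 0.
Proof.
move=> r0 hr.
have [b11 [b12 [b22 [h1 h2]]]] := bump_12_C1 r y.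
have out x : ~ [set x | N2 (x - y) <= r] x -> [/\ bump r y x = 0, bump_1 r y x = 0 & bump_2 r y x = 0].
  by move=> /negP; rewrite -ltNge => /ltW; exact: bump_out.
have cK := @N2_ball_closed R y r.
have p1 := C1on_mul_supported hpsi h1 oO cK hr (fun x nx => let: And3 _ e _ := out x nx in e).
have p2 := C1on_mul_supported hpsi h2 oO cK hr (fun x nx => let: And3 _ _ e := out x nx in e).
have far k x : (forall x, ~ [set x | N2 (x - y) <= r] x -> k x = 0) -> r + N2 y < N2 x -> k x * psi x = 0.
  move=> hk hx; rewrite hk ?mul0r//= => hn; have := le_lt_trans (N2_ball_le hn) hx.
  by rewrite ltxx.
have z1 := I2_grad2 p1 (fun x => far _ x (fun x nx => let: And3 _ e _ := out x nx in e)).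
have z2 := I2_grad1 p2 (fun x => far _ x (fun x nx => let: And3 _ _ e := out x nx in e)).
have [_ _ q1] := C1on_bcf p1 (fun x => far _ x (fun x nx => let: And3 _ e _ := out x nx in e)).
have [_ q2 _] := C1on_bcf p2 (fun x => far _ x (fun x nx => let: And3 _ _ e := out x nx in e)).
have D := IntB lf2 q1 q2; rewrite [X in X - _]z1 [X in _ - X]z2 subr0 in D.
rewrite -[RHS]D; congr Rintegral; apply/funext => x; have [Ox|nOx] := pselect (Omega x); first by rewrite !extE//; ring.
have [|_ -> ->] := out x; first by move=> /hr.
by rewrite !mul0r !mulr0 !addr0 subrr.
Qed.

Lemma div_interior : inner (ext Omega G2) (ext Omega (fun x => - G1 x)) (fun=> 0).
Proof. by apply: inner_of_bumps => //; [exact: bcf0|exact: div_bump]. Qed.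

Lemma source_interior : inner (ext Omega flux1) (ext Omega flux2) (ext Omega source).
Proof.
by apply: inner_of_bumps => //; apply: ext_bcf => //;
  [exact: cc_flux1|exact: cc_flux2|exact: cc_source].
Qed.

(** The term in which the gradient falls on [F(psi)] drops out, because [w] is orthogonal to the
    gradient of [psi]. *)
Lemma swirl_interior : inner (ext Omega (fun x => Fp x * G2 x)) (ext Omega (fun x => - (Fp x * G1 x))) (fun=> 0).
Proof.
move=> a a1 a2 ha [K [cK KO aK]].
have clK : closed K by apply: compact_closed => //; exact: norm_hausdorff.
have a0 x : ~ K x -> a x = 0 by move=> nK; apply/eqP; apply: contra_notT nK; exact: aK.
have hF := C1on_comp_in oO cpsi hpsi F_C1.
have hp := C1on_mul_supported hF ha oO clK KO a0.
rewrite -[RHS](div_interior hp); last first.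
  by exists K; split=> // x; apply: contra_neqP => nK; rewrite a0// mul0r.
rewrite /weak_form /I2; congr Rintegral; apply/funext => x.
have [Ox|nOx] := pselect (Omega x); last by rewrite !ext_out// !mul0r.
by rewrite !extE// /Fp; ring.
Qed.

(** The subtracted constant is the pressure outside the domain, so the difference is 0 on the
    boundary and its extension by zero is the pressure up to a constant. *)
Definition pressure_jump (x : R2) : R := pressure x - (H 0 - c / 2).

Section momentum_in_ball.
Variables (z : R2) (r : R) (a a1 a2 : R2 -> R).
Hypotheses (r_gt0 : 0 < r) (ballO : forall y, N2 (y - z) <= 4 * r -> Omega y).
Hypotheses (ha : C1on setT a a1 a2) (ha0 : forall x, r <= N2 (x - z) -> a x = 0).

Let K := [set x : R2 | N2 (x - z) <= r].
Let clK : closed K. Proof. exact: N2_ball_closed. Qed.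
Let KO : K `<=` Omega.
Proof. by move=> x Kx; apply: ballO; apply: (le_trans Kx); rewrite ler_peMl ?(ltW r_gt0)// ler1n. Qed.
Let a0 x : ~ K x -> a x = 0.
Proof. by move=> /negP; rewrite -ltNge => /ltW; exact: ha0. Qed.
Let a12 x : ~ K x -> a1 x = 0 /\ a2 x = 0.
Proof. by move=> nK; exact: C1on_zero ha (closed_openC clK) nK a0. Qed.
Let far x : 4 * r + N2 z < N2 x -> ~ K x.
Proof. move=> hx /N2_ball_le Kx; have := lt_le_trans hx Kx.
by rewrite ltrD2r gtr_pMl// ltNge ler1n. Qed.
Let a_far x : 4 * r + N2 z < N2 x -> a x = 0. Proof. by move=> /far/a0. Qed.

(** The energy variation needs a C^1 function on the whole plane with bounded support. The cut-off
    is 1 on the ball of radius [2 * r], so on [K], which carries the test, the gradient of the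
    product is still that of [psi]. *)
Let cut : exists t1 t2 : R2 -> R, [/\
  C1on setT (fun x => cutoff z (4 * r) x * psi x) (fun x => t1 x * psi x + cutoff z (4 * r) x * G1 x)
    (fun x => t2 x * psi x + cutoff z (4 * r) x * G2 x),
  forall x, 4 * r + N2 z < N2 x -> cutoff z (4 * r) x * psi x = 0 &
  forall x, K x -> t1 x * psi x + cutoff z (4 * r) x * G1 x = G1 x /\
                   t2 x * psi x + cutoff z (4 * r) x * G2 x = G2 x].
Proof.
have r4 : 0 < 4 * r by rewrite mulr_gt0.
have [t1 [t2 ht]] := cutoff_C1 z (4 * r); exists t1, t2; split.
- apply: (C1on_mul_supported hpsi ht oO (@N2_ball_closed R z (4 * r))) => //.
  by move=> x /negP; rewrite -ltNge => /ltW; exact: cutoff_out.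
- move=> x hx; rewrite cutoff_out ?mul0r// leNgt; apply/negP => /ltW/N2_ball_le hn.
  by have := lt_le_trans hx hn; rewrite ltxx.
move=> x Kx; have xU : N2 (x - z) < 2 * r by apply: (le_lt_trans Kx); lra.
have half : 4 * r / 2 = 2 * r by field.
have one y : [set y | N2 (y - z) < 2 * r] y -> cutoff z (4 * r) y - 1 = 0.
  by move=> hy; rewrite cutoff_in ?subrr// half ltW.
have h1 := C1onB ht (@C1on_cst R setT 1).
have [] := C1on_zero h1 (@N2_ball_open R z (2 * r)) xU one.
rewrite !subr0 => -> ->; have /eqP := one x xU; rewrite subr_eq0 => /eqP ->.
by rewrite !mul0r !mul1r !add0r.
Qed.

(** A test that vanishes with [a] is supported in [K], where the cut-off of [psi] is invisible. *)
Let weak_cut (p1 p2 : R2 -> R) : (forall x, K x -> p1 x = G1 x /\ p2 x = G2 x) ->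
  forall phi phi1 phi2, C1on setT phi phi1 phi2 -> (forall x, a x = 0 -> phi x = 0) ->
  weak_form (fun x => k11 x * p1 x + k12 x * p2 x) (fun x => k12 x * p1 x + k22 x * p2 x)
    (ext Omega source) phi phi1 phi2 = 0.
Proof.
move=> hp phi phi1 phi2 hphi phi0.
have phiK x : ~ K x -> phi x = 0 by move=> /a0/phi0.
have phi12 x : ~ K x -> phi1 x = 0 /\ phi2 x = 0.
  by move=> nK; exact: C1on_zero hphi (closed_openC clK) nK phiK.
rewrite -[RHS](source_interior hphi); last first.
  exists K; split; [exact: N2_ball_compact|exact: KO|move=> x].
  by apply: contra_neqP => nK; exact: phiK.
rewrite /weak_form /I2; congr Rintegral; apply/funext => x.
have [Kx|nK] := pselect (K x); last first.
  by have [-> ->] := phi12 x nK; rewrite (phiK x nK) !mulr0.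
have [-> ->] := hp x Kx; rewrite !(extE _ (KO Kx)); congr (_ + _).
by congr (_ * _ + _ * _); rewrite /flux1 /flux2 /Kmul /k11 /k12 /k22 /xi2 /= -/(s x); ring.
Qed.

Let bsource : bcf N2 (ext Omega source).
Proof. by apply: ext_bcf => //; exact: cc_source. Qed.

Let hH := C1on_comp_in oO cpsi hpsi H_C1.
Let hF := C1on_comp_in oO cpsi hpsi F_C1.
Let pH := C1on_mul_supported hH ha oO clK KO a0.
Let pF := C1on_mul_supported (C1onM (C1onM hF hF) (@hsV Omega)) ha oO clK KO a0.
Let pH_far x : 4 * r + N2 z < N2 x -> a x * H (psi x) = 0.
Proof. by move=> /a_far ->; rewrite mul0r. Qed.
Let pF_far x : 4 * r + N2 z < N2 x -> a x * (F (psi x) * F (psi x) * (s x)^-1) = 0.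
Proof. by move=> /a_far ->; rewrite mul0r. Qed.

Let bFG1 : bcf N2 (ext Omega (fun x => - (Fp x * G1 x))).
Proof. by apply: ext_bcf => //; apply: ccN; apply: ccM. Qed.
Let bFG2 : bcf N2 (ext Omega (fun x => Fp x * G2 x)).
Proof. by apply: ext_bcf => //; apply: ccM. Qed.

Let supp (k : R2 -> R) : exists K, [/\ compact K, K `<=` Omega & forall x, a x * k x != 0 -> K x].
Proof.
exists K; split; [exact: N2_ball_compact|exact: KO|move=> x].
by apply: contra_neqP => nK; rewrite a0// mul0r.
Qed.

Lemma momentum1_in_ball :
  weak_form (ext Omega (fun x => vel1 x * G2 x + pressure_jump x))
    (ext Omega (fun x => - (vel1 x * G1 x))) (ext Omega (fun x => - (slope x * vel2 x))) a a1 a2 = 0.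
Proof.
have [t1 [t2 [hcut cut0 cutK]]] := cut.
have [bS IS] := energy_variation1 hk11 hk12 hk22 psd hcut cut0 bsource ha a_far (weak_cut cutK).
set S := stress1 _ _ _ _ _ _ _ _ _ _ _ _ in bS IS.
have I1 := I2_grad1 pH pH_far; have [_ b1 _] := C1on_bcf pH pH_far.
have I3 := I2_grad1 pF pF_far; have [_ b3 _] := C1on_bcf pF pF_far.
have I5 := I2_grad1 ha a_far; have [_ b5 _] := C1on_bcf ha a_far.
have pq := C1onM ha (C1onM (@C1on_snd R setT) (@hsV setT)).
have b4 := weak_form_bcf bFG2 bFG1 (@bcf0 _ _ _ (@N2 R)) pq.
have I4 := swirl_interior pq (supp _).
(* The first four terms are those of [momentum_identity1]; the fifth comes from the constant
   subtracted in [pressure_jump]. *)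
rewrite -(I2_combination (- 2^-1) 1 (- 2^-1) 1 (- (H 0 - c / 2)) bS b1 b3 b4 b5 IS I1 I3 I4 I5).
rewrite /weak_form; congr I2; apply/funext => x.
have [Kx|nK] := pselect (K x); last first.
  have [z1 z2] := a12 nK; rewrite /S /stress1 (a0 nK) z1 z2; ring.
have := @momentum_identity1 R h x.1 x.2 (G1 x) (G2 x) (Fp x) (Hp x) (dF x) (dH x) (a x) (a1 x) (a2 x) h_gt0.
rewrite !(extE _ (KO Kx)); have [e1 e2] := cutK x Kx.
rewrite /S /stress1 e1 e2 (extE _ (KO Kx)).
move=> E.
have -> : (vel1 x * G2 x + pressure_jump x) * a1 x + - (vel1 x * G1 x) * a2 x + - (slope x * vel2 x) * a x
  = (vel1 x * G2 x + pressure x) * a1 x + - (vel1 x * G1 x) * a2 x + - (slope x * vel2 x) * a x - (H 0 - c / 2) * a1 x.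
  by rewrite /pressure_jump; ring.
have -> : (vel1 x * G2 x + pressure x) * a1 x + - (vel1 x * G1 x) * a2 x + - (slope x * vel2 x) * a x = _ := E.
rewrite -/(s x) -/(Fp x) -/(Hp x) -/(dF x) -/(dH x) /source /k11_1 /k12_1 /k22_1 /k11 /k12 /k22.
ring.
Qed.
Lemma momentum2_in_ball :
  weak_form (ext Omega (fun x => vel2 x * G2 x))
    (ext Omega (fun x => pressure_jump x - vel2 x * G1 x)) (ext Omega (fun x => slope x * vel1 x)) a a1 a2 = 0.
Proof.
have [t1 [t2 [hcut cut0 cutK]]] := cut.
have [bS IS] := energy_variation2 hk11 hk12 hk22 psd hcut cut0 bsource ha a_far (weak_cut cutK).
set S := stress1 _ _ _ _ _ _ _ _ _ _ _ _ in bS IS.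
have I1 := I2_grad2 pH pH_far; have [_ _ b1] := C1on_bcf pH pH_far.
have I3 := I2_grad2 pF pF_far; have [_ _ b3] := C1on_bcf pF pF_far.
have I5 := I2_grad2 ha a_far; have [_ _ b5] := C1on_bcf ha a_far.
have pq := C1onM ha (C1onM (@C1on_fst R setT) (@hsV setT)).
have b4 := weak_form_bcf bFG2 bFG1 (@bcf0 _ _ _ (@N2 R)) pq.
have I4 := swirl_interior pq (supp _).
rewrite -(I2_combination (- 2^-1) 1 (- 2^-1) (- 1) (- (H 0 - c / 2)) bS b1 b3 b4 b5 IS I1 I3 I4 I5).
rewrite /weak_form; congr I2; apply/funext => x.
have [Kx|nK] := pselect (K x); last first.
  have [z1 z2] := a12 nK; rewrite /S /stress1 (a0 nK) z1 z2; ring.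
have := @momentum_identity2 R h x.1 x.2 (G1 x) (G2 x) (Fp x) (Hp x) (dF x) (dH x) (a x) (a1 x) (a2 x) h_gt0.
rewrite !(extE _ (KO Kx)); have [e1 e2] := cutK x Kx.
rewrite /S /stress1 e1 e2 (extE _ (KO Kx)).
move=> E.
have -> : vel2 x * G2 x * a1 x + (pressure_jump x - vel2 x * G1 x) * a2 x + slope x * vel1 x * a x
  = vel2 x * G2 x * a1 x + (pressure x - vel2 x * G1 x) * a2 x + slope x * vel1 x * a x - (H 0 - c / 2) * a2 x.
  by rewrite /pressure_jump; ring.
have -> : vel2 x * G2 x * a1 x + (pressure x - vel2 x * G1 x) * a2 x + slope x * vel1 x * a x = _ := E.
rewrite -/(s x) -/(Fp x) -/(Hp x) -/(dF x) -/(dH x) /source /k11_2 /k12_2 /k22_2 /k11 /k12 /k22.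
ring.
Qed.
End momentum_in_ball.

Lemma cc_pressure_jump : cc pressure_jump.
Proof. by apply: (@ccD R Omega _ (fun=> - (H 0 - c / 2))); [exact: cc_pressure|exact: cck]. Qed.
Let cc_jump := cc_pressure_jump. Let ccv1 := cc_vel1. Let ccv2 := cc_vel2. Let ccm := cc_slope.

Let bextcc Y : cc Y -> bcf N2 (ext Omega Y). Proof. exact: ext_bcf. Qed.

Let mom11 : cc (fun x => vel1 x * G2 x + pressure_jump x). Proof. by prove_cc. Qed.
Let mom12 : cc (fun x => - (vel1 x * G1 x)). Proof. by prove_cc. Qed.
Let mom10 : cc (fun x => - (slope x * vel2 x)). Proof. by prove_cc. Qed.
Let mom21 : cc (fun x => vel2 x * G2 x). Proof. by prove_cc. Qed.
Let mom22 : cc (fun x => pressure_jump x - vel2 x * G1 x). Proof. by prove_cc. Qed.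
Let mom20 : cc (fun x => slope x * vel1 x). Proof. by prove_cc. Qed.
Let sw1 : cc (fun x => Fp x * G2 x). Proof. by prove_cc. Qed.
Let sw2 : cc (fun x => - (Fp x * G1 x)). Proof. by prove_cc. Qed.
Let dv2 : cc (fun x => - G1 x). Proof. by prove_cc. Qed.

Lemma momentum1_interior : inner (ext Omega (fun x => vel1 x * G2 x + pressure_jump x))
    (ext Omega (fun x => - (vel1 x * G1 x))) (ext Omega (fun x => - (slope x * vel2 x))).
Proof.
apply: interior_of_balls => //; try exact: bextcc.
by move=> x r r0 hr f f1 f2 hf /= f0; exact: (momentum1_in_ball r0 hr hf f0).
Qed.

Lemma momentum2_interior : inner (ext Omega (fun x => vel2 x * G2 x))
    (ext Omega (fun x => pressure_jump x - vel2 x * G1 x)) (ext Omega (fun x => slope x * vel1 x)).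
Proof.
apply: interior_of_balls => //; try exact: bextcc.
by move=> x r r0 hr f f1 f2 hf /= f0; exact: (momentum2_in_ball r0 hr hf f0).
Qed.

Hypotheses (hO : C2_boundary Omega) (psi_bd : forall x, frontier Omega x -> psi x = 0)
  (grad_bd : forall x, frontier Omega x -> speed2 h x (G1 x, G2 x) (F 0) = c).

(** Turning by a right angle exchanges gradient and [w]: the normal component of [w] is, up to sign,
    the tangential derivative of [psi]. *)
Let normal_eq0 theta g x : C2_line g -> (\forall y \near x, Omega y <-> 0 < chart_fun theta g y) ->
  frontier Omega x -> G2 x * chart_fun1 theta g x - G1 x * chart_fun2 theta g x = 0.
Proof.
move=> hg nx fx; have := tangential_eq0 hg oO nx cpsi cG1 cG2 hpsi psi_bd fx.
by rewrite /chart_fun1 /chart_fun2 => e; rewrite -[RHS]oppr0 -e; ring.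
Qed.

Let jump_eq0 x : frontier Omega x -> pressure_jump x = 0.
Proof.
by move=> fx; rewrite /pressure_jump /pressure /Fp /Hp psi_bd// grad_bd// subrr.
Qed.

Local Notation weak := weak_identity.

Let weak_upto B1 B2 b : cc B1 -> cc B2 -> bcf N2 b -> (forall x, ~ Omega x -> b x = 0) ->
  inner (ext Omega B1) (ext Omega B2) b ->
  (forall theta g x, C2_line g -> (\forall y \near x, Omega y <-> 0 < chart_fun theta g y) ->
    frontier Omega x -> B1 x * chart_fun1 theta g x + B2 x * chart_fun2 theta g x = 0) ->
  weak (ext Omega B1) (ext Omega B2) b.
Proof.
move=> cB1 cB2 bb b0 hi hn f f1 f2 M hf f0.
apply: (weak_form_up_to_boundary oO hO (bextcc cB1) (bextcc cB2) bb _ cB1 cB2 _ hi hn hf f0).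
  by move=> x nOx; rewrite !ext_out// b0.
by move=> x Ox; rewrite !extE.
Qed.

Lemma div_weak : weak (ext Omega G2) (ext Omega (fun x => - G1 x)) (fun=> 0).
Proof.
apply: weak_upto => //; first exact: bcf0; first exact: div_interior.
by move=> theta g x hg nx fx; rewrite mulNr; exact: normal_eq0.
Qed.

Lemma swirl_weak : weak (ext Omega (fun x => Fp x * G2 x)) (ext Omega (fun x => - (Fp x * G1 x))) (fun=> 0).
Proof.
apply: weak_upto => //; first exact: bcf0; first exact: swirl_interior.
move=> theta g x hg nx fx; have := normal_eq0 hg nx fx => e.
by rewrite -[RHS](mulr0 (Fp x)) -e; ring.
Qed.

Lemma momentum1_weak : weak (ext Omega (fun x => vel1 x * G2 x + pressure_jump x))
    (ext Omega (fun x => - (vel1 x * G1 x))) (ext Omega (fun x => - (slope x * vel2 x))).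
Proof.
apply: weak_upto => //; [exact: bextcc|by move=> x; exact: ext_out|exact: momentum1_interior|].
move=> theta g x hg nx fx; have := normal_eq0 hg nx fx => e.
by rewrite jump_eq0// addr0 -[RHS](mulr0 (vel1 x)) -e; ring.
Qed.

Lemma momentum2_weak : weak (ext Omega (fun x => vel2 x * G2 x))
    (ext Omega (fun x => pressure_jump x - vel2 x * G1 x)) (ext Omega (fun x => slope x * vel1 x)).
Proof.
apply: weak_upto => //; [exact: bextcc|by move=> x; exact: ext_out|exact: momentum2_interior|].
move=> theta g x hg nx fx; have := normal_eq0 hg nx fx => e.
by rewrite jump_eq0// sub0r -[RHS](mulr0 (vel2 x)) -e; ring.
Qed.

(** Derived from the identities on the whole plane, with tests multiplied by a coordinate, so the
    boundary does not have to be treated again. *)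
Lemma momentum3_weak : weak (ext Omega (fun x => h * slope x * G2 x - pressure_jump x / h * x.2))
    (ext Omega (fun x => - (h * slope x * G1 x) + pressure_jump x / h * x.1)) (fun=> 0).
Proof.
move=> f f1 f2 M hf f0.
have p1 := C1onM (@C1on_fst R setT) hf; have p2 := C1onM (@C1on_snd R setT) hf.
have far1 x : M < N2 x -> x.1 * f x = 0 by move=> /f0 ->; rewrite mulr0.
have far2 x : M < N2 x -> x.2 * f x = 0 by move=> /f0 ->; rewrite mulr0.
have b1 := weak_form_bcf (bextcc mom21) (bextcc mom22) (bextcc mom20) p1.
have b2 := weak_form_bcf (bextcc mom11) (bextcc mom12) (bextcc mom10) p2.
have b3 := weak_form_bcf (bextcc sw1) (bextcc sw2) (@bcf0 _ _ _ (@N2 R)) hf.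
have z : bcf (@N2 R) (fun=> 0) := @bcf0 _ _ _ _.
rewrite -[RHS](I2_combination h^-1 (- h^-1) h^-1 0 0 b1 b2 b3 z z (momentum2_weak p1 far1)
  (momentum1_weak p2 far2) (swirl_weak hf f0) (Int0 _) (Int0 _)).
rewrite /weak_form; congr I2; apply/funext => x.
have [Ox|nOx] := pselect (Omega x); last by rewrite !ext_out//; ring.
rewrite !extE//.
have E := @momentum_identity3 R h x.1 x.2 (G1 x) (G2 x) (Fp x) (f x) (f1 x) (f2 x) h_gt0 (pressure_jump x).
have -> : (h * slope x * G2 x - pressure_jump x / h * x.2) * f1 x
  + (- (h * slope x * G1 x) + pressure_jump x / h * x.1) * f2 x = _ := E.
rewrite /vel1 /vel2 /slope /velocity /xi2 /= -/(s x); ring.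
Qed.
End planar_weak_forms.

Lemma bcf_integrable_on (R : realType) (d : measure_display) (T : measurableType d)
    (mu : {measure set T -> \bar R}) (N : T -> R) (f g : T -> R) (D : set T) :
  locally_finite mu N -> bcf N g -> measurable D -> {in D, g =1 f} -> mu.-integrable D (EFin \o f).
Proof.
move=> lf bg mD fg.
have i1 := integrableS measurableT mD (@subsetT _ D) (bcf_integrable lf bg).
by apply: (eq_integrable mD _ _ _ i1) => x Dx /=; rewrite fg.
Qed.

(** * Helical fields in space *)

Section sums_over_coordinates.
Variable R : realType.
Let i0 : 'I_3 := @Ordinal 3 0 isT.
Let i1 : 'I_3 := @Ordinal 3 1 isT.
Let i2 : 'I_3 := @Ordinal 3 2 isT.

Lemma sum3 (G : 'I_3 -> R) : \sum_(i < 3) G i = G i0 + G i1 + G i2.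
Proof.
rewrite !big_ord_recl big_ord0 addr0 addrA.
by congr (G _ + G _ + G _); exact: val_inj.
Qed.

Lemma momentum_sum (U : 'I_3 -> R) (D : 'I_3 -> 'I_3 -> R) (p k : R) :
  \sum_(i < 3) \sum_(j < 3) U i * U j * D i j + (p + k) * \sum_(i < 3) D i i =
  (U i0 * (U i0 * D i0 i0 + U i1 * D i1 i0 + U i2 * D i2 i0)
   + U i1 * (U i0 * D i0 i1 + U i1 * D i1 i1 + U i2 * D i2 i1)
   + U i2 * (U i0 * D i0 i2 + U i1 * D i1 i2 + U i2 * D i2 i2)
   + p * (D i0 i0 + D i1 i1 + D i2 i2)) + k * (D i0 i0 + D i1 i1 + D i2 i2).
Proof. rewrite !sum3; ring. Qed.
End sums_over_coordinates.

Section space_calculus.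
Context {R : realType}.
Local Notation R2 := (R * R)%type.
Local Notation R3 := (R * R * R)%type.

Lemma is_diff_eq' (V W : normedModType R) (f df dg : V -> W) x : df = dg ->
  is_diff x f df -> is_diff x f dg.
Proof. by move=> <-. Qed.

Definition dot_grad3 (a b c : R) (v : R3) : R := v.1.1 * a + v.1.2 * b + v.2 * c.

Definition C1_3 (g g1 g2 g3 : R3 -> R) :=
  [/\ forall x, is_diff x g (dot_grad3 (g1 x) (g2 x) (g3 x)),
    continuous g1, continuous g2 & continuous g3].

Lemma C1_3_continuous g g1 g2 g3 : C1_3 g g1 g2 g3 -> continuous g.
Proof. by move=> [dg _ _ _] x; apply: differentiable_continuous; case: (dg x). Qed.

Lemma C1_3_eq f f1 f2 f3 g g1 g2 g3 : (forall x, f x = g x) -> (forall x, f1 x = g1 x) ->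
  (forall x, f2 x = g2 x) -> (forall x, f3 x = g3 x) -> C1_3 g g1 g2 g3 -> C1_3 f f1 f2 f3.
Proof. by move=> /funext -> /funext -> /funext -> /funext ->. Qed.

Lemma C1_3D f f1 f2 f3 g g1 g2 g3 : C1_3 f f1 f2 f3 -> C1_3 g g1 g2 g3 ->
  C1_3 (fun x => f x + g x) (fun x => f1 x + g1 x) (fun x => f2 x + g2 x) (fun x => f3 x + g3 x).
Proof.
move=> [df f1c f2c f3c] [dg g1c g2c g3c]; split; try exact: continuous_add.
move=> x; have dfx := df x; have dgx := dg x.
apply: is_diff_eq; apply/funext => v.
transitivity (dot_grad3 (f1 x) (f2 x) (f3 x) v + dot_grad3 (g1 x) (g2 x) (g3 x) v) => //.
by rewrite /dot_grad3; ring.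
Qed.

Lemma C1_3M f f1 f2 f3 g g1 g2 g3 : C1_3 f f1 f2 f3 -> C1_3 g g1 g2 g3 ->
  C1_3 (fun x => f x * g x) (fun x => f1 x * g x + f x * g1 x)
    (fun x => f2 x * g x + f x * g2 x) (fun x => f3 x * g x + f x * g3 x).
Proof.
move=> hf hg; have cf := C1_3_continuous hf; have cg := C1_3_continuous hg.
have [df f1c f2c f3c] := hf; have [dg g1c g2c g3c] := hg.
split; try by apply: continuous_add; apply: continuous_mul.
move=> x; have dfx := df x; have dgx := dg x.
apply: is_diff_eq; apply/funext => v.
transitivity (f x * dot_grad3 (g1 x) (g2 x) (g3 x) v + g x * dot_grad3 (f1 x) (f2 x) (f3 x) v) => //.
by rewrite /dot_grad3; ring.
Qed.

Lemma is_diff_continuous_linear (V W : normedModType R) (f : {linear V -> W}) x :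
  continuous f -> is_diff x f f.
Proof. by move=> cf; split; [exact: linear_differentiable|rewrite diff_lin]. Qed.

Lemma is_diff_fst (V W : normedModType R) (x : V * W) : is_diff x fst fst.
Proof. by apply: is_diff_continuous_linear => y; exact: cvg_fst. Qed.

Lemma is_diff_snd (V W : normedModType R) (x : V * W) : is_diff x snd snd.
Proof. by apply: is_diff_continuous_linear => y; exact: cvg_snd. Qed.

Lemma C1_3_height (k k' : R -> R) : (forall t : R, is_derive t 1 k (k' t)) -> continuous k' ->
  C1_3 (fun x => k x.2) (fun=> 0) (fun=> 0) (fun x => k' x.2).
Proof.
move=> dk ck'; split; try exact: continuous_const; last first.
  by apply: continuous_after ck' => x; exact: cvg_snd.
move=> [y t]; have [dk1 dkE] := dk t.
have dk2 : is_diff t k (fun v : R => v * k' t).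
  have dkk : differentiable k t by apply/derivable1_diffP.
  by split => //; rewrite deriv1E// derive1E dkE.
have := is_diff_comp (is_diff_snd ((y, t) : R3)) dk2.
by apply: is_diff_eq'; apply/funext => v /=; rewrite /dot_grad3; ring.
Qed.

Lemma C1_3_x1 : C1_3 (fun x => x.1.1) (fun=> 1) (fun=> 0) (fun=> 0).
Proof.
split; try exact: continuous_const.
move=> x; have := is_diff_comp (is_diff_fst x) (is_diff_fst x.1).
by apply: is_diff_eq'; apply/funext => v /=; rewrite /dot_grad3; ring.
Qed.

Lemma C1_3_x2 : C1_3 (fun x => x.1.2) (fun=> 0) (fun=> 1) (fun=> 0).
Proof.
split; try exact: continuous_const.
move=> x; have := is_diff_comp (is_diff_fst x) (is_diff_snd x.1).
by apply: is_diff_eq'; apply/funext => v /=; rewrite /dot_grad3; ring.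
Qed.

Lemma C1_3_slice g g1 g2 g3 (z : R) : C1_3 g g1 g2 g3 ->
  C1on setT (fun y : R2 => g (y, z)) (fun y => g1 (y, z)) (fun y => g2 (y, z)).
Proof.
move=> [dg g1c g2c g3c].
have cz : continuous (fun y : R2 => (y, z)).
  move=> y; apply: (@differentiable_continuous _ _ _ y (fun y : R2 => (y, z))).
  by apply: differentiable_pair.
move=> y _; split; [|exact: (continuous_after cz g1c)|exact: (continuous_after cz g2c)].
have dgy := dg (y, z); apply: (@is_diff_eq _ _ _ (g \o (fun y : R2 => (y, z)))).
apply/funext => v; transitivity (dot_grad3 (g1 (y, z)) (g2 (y, z)) (g3 (y, z)) (v, 0)) => //.
by rewrite /dot_grad3 /dot_grad /=; ring.
Qed.

Lemma C1_3_fiber g g1 g2 g3 (y : R2) (z : R) : C1_3 g g1 g2 g3 ->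
  is_derive z 1 (fun t : R => g (y, t)) (g3 (y, z)).
Proof.
move=> [dg _ _ _]; have dgz := dg (y, z).
have [dd dE] : is_diff z (fun t => g (y, t)) (fun v => v * g3 (y, z)).
  apply: (@is_diff_eq _ _ _ (g \o (fun t : R => (y, t)))).
  apply/funext => v; transitivity (dot_grad3 (g1 (y, z)) (g2 (y, z)) (g3 (y, z)) (0, v)) => //.
  by rewrite /dot_grad3 /=; ring.
split; first exact: diff_derivable.
by rewrite deriveE// dE mul1r.
Qed.

Lemma C1_3_comp g g1 g2 g3 a a1 a2 a3 b b1 b2 b3 : C1_3 g g1 g2 g3 ->
  C1_3 a a1 a2 a3 -> C1_3 b b1 b2 b3 ->
  let Psi x := (a x, b x, x.2) in
  C1_3 (fun x => g (Psi x)) (fun x => g1 (Psi x) * a1 x + g2 (Psi x) * b1 x)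
    (fun x => g1 (Psi x) * a2 x + g2 (Psi x) * b2 x)
    (fun x => g1 (Psi x) * a3 x + g2 (Psi x) * b3 x + g3 (Psi x)).
Proof.
move=> hg ha hb Psi; have [dg g1c g2c g3c] := hg.
have [da a1c a2c a3c] := ha; have [db b1c b2c b3c] := hb.
have cPsi : continuous Psi.
  move=> x; apply: differentiable_continuous; apply: differentiable_pair; last by case: (is_diff_snd x).
  by apply: differentiable_pair; [case: (da x)|case: (db x)].
have cP (k : R3 -> R) : continuous k -> continuous (fun x => k (Psi x)) := continuous_after cPsi.
have cgg k l : continuous k -> continuous l -> continuous (fun x => g1 (Psi x) * k x + g2 (Psi x) * l x).
  by move=> ck cl; apply: continuous_add; apply: continuous_mul => //; exact: cP.
split; [|exact: cgg|exact: cgg|].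
  2: by apply: continuous_add; [exact: cgg|exact: cP].
move=> x; have dgx := dg (Psi x); have dax := da x; have dbx := db x; have dsx := is_diff_snd x.
apply: (@is_diff_eq _ _ _ (g \o Psi)).
by apply/funext => v; rewrite /dot_grad3 /=; ring.
Qed.

Lemma continuous_fiber (g : R3 -> R) (y : R2) : continuous g -> continuous (fun z : R => g (y, z)).
Proof.
apply: continuous_after => z; apply: (@differentiable_continuous _ _ _ z (fun z : R => (y, z))).
by apply: differentiable_pair.
Qed.

Lemma N3_gt_open M : open [set x : R3 | M < N3 x].
Proof.
have -> : [set x : R3 | M < N3 x] = ~` [set x | N3 x <= M].
  by apply/seteqP; split => x /=; rewrite ltNge => /negP.
apply: closed_openC; apply: compact_closed; [exact: norm_hausdorff|exact: N3_compact].
Qed.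

Lemma C1_3_zero_far g g1 g2 g3 M : C1_3 g g1 g2 g3 -> (forall x, M < N3 x -> g x = 0) ->
  forall x, M < N3 x -> [/\ g1 x = 0, g2 x = 0 & g3 x = 0].
Proof.
move=> [dg _ _ _] g0 x Mx.
have [d dE] := dg x.
have z v : 'd g x v = 0.
  rewrite -deriveE// (@near_eq_derive _ _ _ g (cst 0)) ?derive_cst//.
  have := open_nbhs_nbhs (conj (@N3_gt_open M) Mx).
  by apply: filterS => y /g0.
have := z ((1, 0), 0); have := z ((0, 1), 0); have := z ((0, 0), 1).
by rewrite dE /dot_grad3 /= !mul1r !mul0r !addr0 !add0r => -> -> ->.
Qed.

Lemma C1_3_bcf g g1 g2 g3 M : C1_3 g g1 g2 g3 -> (forall x, M < N3 x -> g x = 0) ->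
  [/\ bcf N3 g, bcf N3 g1, bcf N3 g2 & bcf N3 g3].
Proof.
move=> hg g0; have gz := C1_3_zero_far hg g0; have cg := C1_3_continuous hg.
have [_ c1 c2 c3] := hg.
by split; apply: (bcf3_continuous (M := M)) => // x /gz[].
Qed.

Lemma N3_fst (x : R3) : N2 x.1 <= N3 x.
Proof. by rewrite /N3 /gauge_prod le_max lexx. Qed.

Lemma N3_snd (x : R3) : `|x.2| <= N3 x.
Proof. by rewrite /N3 /gauge_prod le_max lexx orbT. Qed.

Section compact_support.
Variables (g g1 g2 g3 : R3 -> R) (M : R).
Hypotheses (hg : C1_3 g g1 g2 g3) (g0 : forall x, M < N3 x -> g x = 0).

Lemma slice_far (t : R) (y : R2) : M < N2 y -> g (y, t) = 0.
Proof. by move=> h; apply: g0; exact: lt_le_trans h (N3_fst (y, t)). Qed.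

Lemma fiber_far (y : R2) (z : R) : M < `|z| -> g (y, z) = 0.
Proof. by move=> h; apply: g0; exact: lt_le_trans h (N3_snd (y, z)). Qed.

Lemma I3_grad1 : I3 g1 = 0.
Proof.
have [_ b1 _ _] := C1_3_bcf hg g0.
rewrite I3_Fubini2// -[RHS](Int0 (@lebesgue_measure R)); congr Rintegral; apply/funext => z.
by rewrite (I2_grad1 (C1_3_slice z hg) (@slice_far z)).
Qed.

Lemma I3_grad2 : I3 g2 = 0.
Proof.
have [_ _ b2 _] := C1_3_bcf hg g0.
rewrite I3_Fubini2// -[RHS](Int0 (@lebesgue_measure R)); congr Rintegral; apply/funext => z.
by rewrite (I2_grad2 (C1_3_slice z hg) (@slice_far z)).
Qed.

(** [V] is constant on vertical lines and comes out of the inner integral, which is zero; no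
    derivative of [V] is involved. *)
Lemma I3_grad3 (V : R2 -> R) : measurable_fun setT V -> (exists B : R, forall y, `|V y| <= B) ->
  bcf N3 (fun x => V x.1 * g3 x) /\ I3 (fun x => V x.1 * g3 x) = 0.
Proof.
move=> mV [B hB]; have [_ _ _ b3] := C1_3_bcf hg g0.
have b : bcf N3 (fun x => V x.1 * g3 x).
  apply: bcf_bounded_mul b3 _ _; first exact: (measurableT_comp mV (@measurable_fst _ _ _ _)).
  by move=> M'; exists B => x _; exact: hB.
split=> //; rewrite I3_Fubini1// -[RHS](Int0 (@lam2 R)); congr Rintegral; apply/funext => y.
have -> : \int[lebesgue_measure]_z (V y * g3 (y, z)) = V y * \int[lebesgue_measure]_z g3 (y, z).
  by apply: (IntZ locally_finite_lebesgue); exact: (bcf_section1 b3).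
rewrite (Int_derive_eq0 (fun z => C1_3_fiber y z hg) _ (@fiber_far y)) ?mulr0//.
by apply: continuous_fiber; have [] := hg.
Qed.
End compact_support.

Definition axis1 : R3 := (1, 0, 0).
Definition axis2 : R3 := (0, 1, 0).
Definition axis3 : R3 := (0, 0, 1).

Lemma C1_3_of_derivable (g : R3 -> R) : (forall x, differentiable g x) ->
  (forall v, continuous (fun x => 'D_v g x)) ->
  C1_3 g (fun x => 'D_axis1 g x) (fun x => 'D_axis2 g x) (fun x => 'D_axis3 g x).
Proof.
move=> dg cg; split; try exact: cg.
move=> x; split; first exact: dg.
apply/funext => v; rewrite /dot_grad3 !deriveE//.
have E : v = v.1.1 *: axis1 + v.1.2 *: axis2 + v.2 *: axis3.
  case: v => [[p q] r].
  transitivity ((p * 1 + q * 0 + r * 0, p * 0 + q * 1 + r * 0, p * 0 + q * 0 + r * 1) : R3) => //.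
  by congr (_, _, _); ring.
by rewrite [in LHS]E !linearD !linearZ /=; rewrite /GRing.scale /=; ring.
Qed.

(** The hypothesis on [L] says that it is linear and continuous. [smooth] asserts differentiability
    of all iterated derivatives, and the first ones are continuous because they are
    differentiable. *)
Lemma smooth_C1_3 (L : R3 -> R) (eta : R3 -> R3) : (forall x, is_diff x L L) -> smooth eta ->
  C1_3 (L \o eta) (fun x => 'D_axis1 (L \o eta) x) (fun x => 'D_axis2 (L \o eta) x)
    (fun x => 'D_axis3 (L \o eta) x).
Proof.
move=> dL seta; have deta x : differentiable eta x := seta [::] x.
have dLe x : is_diff x (L \o eta) (L \o 'd eta x).
  by have h1 := differentiableP (deta x); exact: is_diff_comp h1 (dL (eta x)).
apply: C1_3_of_derivable; first by move=> x; case: (dLe x).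
move=> v; have -> : (fun x => 'D_v (L \o eta) x) = L \o (fun x => 'D_v eta x).
  by apply/funext => x /=; have [d dE] := dLe x; rewrite !deriveE// dE.
move=> x; apply: differentiable_continuous; apply: differentiable_comp; last by case: (dL ('D_v eta x)).
exact: (seta [:: v] x).
Qed.

End space_calculus.

Section helical_weak_forms.
Context {R : realType}.
Local Notation R2 := (R * R)%type.
Local Notation R3 := (R * R * R)%type.
Variable h : R.
Hypothesis h_gt0 : 0 < h.

Let C (x : R3) : R := cos (x.2 / h).
Let S (x : R3) : R := sin (x.2 / h).

Let CS1 x : C x ^+ 2 + S x ^+ 2 = 1.
Proof. exact: cos2Dsin2. Qed.

Let is_derive_div (t : R) : is_derive t 1 (fun s : R => s / h) h^-1.
Proof.
have e : (fun s : R => s / h) = h^-1 \*: (id : R -> R) by apply/funext => s /=; rewrite mulrC.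
by rewrite e; apply: is_derive_eq; rewrite /GRing.scale /= mulr1.
Qed.

Let continuous_div : continuous (fun s : R => s / h).
Proof.
by move=> t; apply: differentiable_continuous; apply/derivable1_diffP; case: (is_derive_div t).
Qed.

Let continuous_cos_div : continuous (fun s : R => cos (s / h)).
Proof. by apply: continuous_after; [exact: continuous_div|exact: continuous_cos]. Qed.

Let continuous_sin_div : continuous (fun s : R => sin (s / h)).
Proof. by apply: continuous_after; [exact: continuous_div|exact: continuous_sin]. Qed.

Let hC : C1_3 C (fun=> 0) (fun=> 0) (fun x => - S x / h).
Proof.
apply: (@C1_3_height _ (fun s => cos (s / h)) (fun s => - sin (s / h) / h)).
  by move=> t; exact: (@is_derive1_comp R cos (fun s => s / h) t _ _ (is_derive_cos (t / h)) (is_derive_div t)).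
apply: continuous_mul; last exact: continuous_const.
by apply: continuous_opp; exact: continuous_sin_div.
Qed.

Let hS : C1_3 S (fun=> 0) (fun=> 0) (fun x => C x / h).
Proof.
apply: (@C1_3_height _ (fun s => sin (s / h)) (fun s => cos (s / h) / h)).
  by move=> t; exact: (@is_derive1_comp R sin (fun s => s / h) t _ _ (is_derive_sin (t / h)) (is_derive_div t)).
by apply: continuous_mul; [exact: continuous_cos_div|exact: continuous_const].
Qed.

Definition unscrew (x : R3) : R3 := (rot2 (x.2 / h) x.1, x.2).

(** The partial derivatives of [g \o unscrew]; the bracket in [pull3] comes from the turning of the
    frame with height. *)
Definition pull1 (g1 g2 : R3 -> R) x := C x * g1 (unscrew x) - S x * g2 (unscrew x).
Definition pull2 (g1 g2 : R3 -> R) x := S x * g1 (unscrew x) + C x * g2 (unscrew x).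
Definition pull3 (g1 g2 g3 : R3 -> R) x :=
  h^-1 * ((- (S x * x.1.1) + C x * x.1.2) * g1 (unscrew x)
          + (- (C x * x.1.1) - S x * x.1.2) * g2 (unscrew x)) + g3 (unscrew x).

Lemma pull_C1 g g1 g2 g3 : C1_3 g g1 g2 g3 ->
  C1_3 (g \o unscrew) (pull1 g1 g2) (pull2 g1 g2) (pull3 g1 g2 g3).
Proof.
move=> hg.
have ha := C1_3D (C1_3M hC (@C1_3_x1 R)) (C1_3M hS (@C1_3_x2 R)).
have hS' := C1_3M (C1_3_height (fun t => is_derive_cst (-1 : R) t 1) (@continuous_const _ _ 0)) hS.
have hb := C1_3D (C1_3M hS' (@C1_3_x1 R)) (C1_3M hC (@C1_3_x2 R)).
have e x : (C x * x.1.1 + S x * x.1.2, -1 * S x * x.1.1 + C x * x.1.2, x.2) = unscrew x.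
  by rewrite /unscrew /rot2 -/(C x) -/(S x) !mulN1r.
by apply: C1_3_eq (C1_3_comp hg ha hb) => x; rewrite /= e // /pull1 /pull2 /pull3; ring.
Qed.

(** The factor 4 bounds the inverse rotation in the maximum norm: it has four entries of modulus at
    most 1. *)
Lemma pull_far (g : R3 -> R) M : (forall x, M < N3 x -> g x = 0) ->
  forall x, 4 * `|M| < N3 x -> g (unscrew x) = 0.
Proof.
move=> g0 x hx; apply: g0; apply: (le_lt_trans (ler_norm M)).
rewrite /N3 /gauge_prod lt_max; move: hx; rewrite {1}/N3 /gauge_prod lt_max => /orP[hx|hx]; apply/orP.
  left; have e := lin2_rot_cancel (CS1 x) x.1.
  have := N2_lin2 (C x) (- S x) (S x) (C x) (lin2 (C x) (S x) (- S x) (C x) x.1).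
  rewrite e => hN; have c1 : `|C x| <= 1 by rewrite ler_norml cos_geN1 cos_le1.
  have s1 : `|S x| <= 1 by rewrite ler_norml sin_geN1 sin_le1.
  have hN' : N2 x.1 <= 4 * N2 (unscrew x).1.
    apply: (le_trans hN); apply: ler_wpM2r; first exact: N2_ge0.
    by rewrite normrN; lra.
  have := lt_le_trans hx hN'; rewrite ltr_pM2l//.
right; apply: le_lt_trans hx; rewrite ler_peMl// ler1n//.
Qed.

Lemma I3_unscrew (E : R3 -> R) : bcf N3 E ->
  I3 E = \int[lebesgue_measure]_z I2 (fun y => E (unscrew (y, z))).
Proof.
move=> bE; rewrite (I3_Fubini2 bE); apply: eq_Rintegral => z _.
by rewrite -(I2_rot (CS1 (0, z)) (bcf_section2 bE z)).
Qed.

Definition bounded_measurable (U : R3 -> R) :=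
  measurable_fun setT U /\ exists B : R, forall x, `|U x| <= B.

Lemma bounded_measurableM U V : bounded_measurable U -> bounded_measurable V ->
  bounded_measurable (fun x => U x * V x).
Proof.
move=> [mU [B hB]] [mV [B' hB']]; split; first exact: measurable_funM.
by exists (B * B') => x; rewrite normrM ler_pM.
Qed.

Lemma bounded_measurableD U V : bounded_measurable U -> bounded_measurable V ->
  bounded_measurable (fun x => U x + V x).
Proof.
move=> [mU [B hB]] [mV [B' hB']]; split; first exact: measurable_funD.
by exists (B + B') => x; rewrite (le_trans (ler_normD _ _))// lerD.
Qed.

Lemma bounded_measurable_cst (k : R) : bounded_measurable (fun=> k).
Proof. by split; [exact: measurable_cst|exists `|k|]. Qed.

Lemma bcf_bounded_measurable U g : bounded_measurable U -> bcf N3 g -> bcf N3 (fun x => U x * g x).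
Proof.
move=> [mU [B hB]] bg; apply: bcf_bounded_mul => // M.
by exists B => x _; exact: hB.
Qed.

Let bmC : bounded_measurable C.
Proof.
split; first by apply: continuous_measurable3; exact: C1_3_continuous hC.
by exists 1 => x; rewrite ler_norml cos_geN1 cos_le1.
Qed.

Let bmS : bounded_measurable S.
Proof.
split; first by apply: continuous_measurable3; exact: C1_3_continuous hS.
by exists 1 => x; rewrite ler_norml sin_geN1 sin_le1.
Qed.

Lemma bounded_measurable_screw (V : R2 -> R) : measurable_fun setT V -> (exists B : R, forall y, `|V y| <= B) ->
  bounded_measurable (fun x => V (rot2 (- x.2 / h) x.1)).
Proof.
move=> mV [B hB]; split; last by exists B.
have c1 := C1_3_continuous (@C1_3_x1 R); have c2 := C1_3_continuous (@C1_3_x2 R).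
have cC := C1_3_continuous hC; have cS := C1_3_continuous hS.
have m : measurable_fun setT (fun x : R3 => (C x * x.1.1 + - (S x * x.1.2), S x * x.1.1 + C x * x.1.2)).
  apply: measurable_fun_pair; apply: continuous_measurable3; apply: continuous_add; try exact: continuous_mul.
  by apply: continuous_opp; exact: continuous_mul.
have -> : (fun x : R3 => V (rot2 (- x.2 / h) x.1)) =
    V \o (fun x : R3 => (C x * x.1.1 + - (S x * x.1.2), S x * x.1.1 + C x * x.1.2)).
  apply/funext => x; rewrite /= /rot2 mulNr cosN sinN opprK; congr (V (_, _)).
  by rewrite mulNr.
exact: measurableT_comp.
Qed.

Lemma N3_bounded_on_compact (K : set R3) : compact K -> exists M : R, forall x, K x -> N3 x <= M.
Proof.
move=> cK; have cN : continuous (fun x : R3 => `|x|) by exact: norm_continuous.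
have [B hB] := compact_bound cK (continuous_subspaceT cN).
by exists B => x Kx; have := hB x Kx; rewrite normr_id.
Qed.

Lemma bounded_measurable_integrable (f : R3 -> R) (K : set R3) : bounded_measurable f -> compact K ->
  mu3.-integrable K (EFin \o f).
Proof.
move=> [mf [B hB]] cK.
have mK : measurable K.
  have clK : closed K by apply: compact_closed => //; exact: norm_hausdorff.
  by rewrite -[K]setCK; apply: measurableC; apply: open_measurable3; exact: closed_openC.
have [M hM] := N3_bounded_on_compact cK.
have bf : bcf N3 (f \_ K).
  split; first by apply/(measurable_restrictT f mK); exact: measurable_funTS.
  exists (`|B| + `|M|) => x; rewrite patchE; case: ifPn => [|_]; last first.
    by rewrite normr0; split=> //; exact: addr_ge0.
  rewrite inE => Kx; split.
    by rewrite (le_trans (hB x))// (le_trans (ler_norm B))// lerDl.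
  move=> hx; exfalso; have := lt_le_trans hx (le_trans (hM x Kx) (ler_norm M)).
  by rewrite gtrDr ltNge normr_ge0.
apply: (bcf_integrable_on lf3 bf); first exact: mK.
by move=> x Kx; rewrite patchE Kx.
Qed.

Lemma tsupport_far (W : normedModType R) (eta : R3 -> W) : compact (tsupport eta) ->
  exists M : R, forall x, M < N3 x -> eta x = 0.
Proof.
move=> /N3_bounded_on_compact[M hM]; exists M => x hx; apply/eqP/negPn/negP => nz.
have tx : tsupport eta x by apply: subset_closure.
by have := hM x tx; rewrite leNgt hx.
Qed.

Section planar_fields.
Variables V1 V2 V3 q : R2 -> R.
Hypotheses (bV1 : bcf N2 V1) (bV2 : bcf N2 V2) (bV3 : bcf N2 V3) (bq : bcf N2 q).

(** The horizontal velocity relative to the turning frame. For the fields of the theorem it is [w],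
    extended by zero. *)
Definition transport1 (y : R2) : R := V1 y - V3 y / h * y.2.
Definition transport2 (y : R2) : R := V2 y + V3 y / h * y.1.

Local Notation weak := weak_identity.

Hypothesis weak0 : weak transport1 transport2 (fun=> 0).
Hypothesis weak1 : weak (fun y => V1 y * transport1 y + q y) (fun y => V1 y * transport2 y)
  (fun y => - (V3 y / h * V2 y)).
Hypothesis weak2 : weak (fun y => V2 y * transport1 y) (fun y => V2 y * transport2 y + q y)
  (fun y => V3 y / h * V1 y).
Hypothesis weak3 : weak (fun y => V3 y * transport1 y - q y / h * y.2)
  (fun y => V3 y * transport2 y + q y / h * y.1) (fun=> 0).

Let mul_coord (f : R2 -> R) : bcf N2 f ->
  bcf N2 (fun y => f y / h * y.1) /\ bcf N2 (fun y => f y / h * y.2).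
Proof.
move=> bf; have bfh : bcf N2 (fun y => f y / h).
  by have := bcfZ h^-1 bf; congr (bcf _ _); apply/funext => y; rewrite mulrC.
have [c1 _ _] := C1on_continuousT (@C1on_fst R setT).
have [c2 _ _] := C1on_continuousT (@C1on_snd R setT).
by split; apply: bcf_mul_continuous.
Qed.

Let bt1 : bcf N2 transport1.
Proof. by apply: bcfB => //; have [] := mul_coord bV3. Qed.
Let bt2 : bcf N2 transport2.
Proof. by apply: bcfD => //; have [] := mul_coord bV3. Qed.

Let us (y : R2) : R3 := (V1 y, V2 y, V3 y).
Let u := helical_u h us.
Let u1 x := (u x).1.1. Let u2 x := (u x).1.2. Let u3 x := (u x).2.
Let pq (x : R3) : R := helical_p h q x.

Let bm (V : R2 -> R) : bcf N2 V -> measurable_fun setT V /\ exists B : R, forall y, `|V y| <= B.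
Proof. by move=> [mV [M hM]]; split=> //; exists M => y; have [] := hM y. Qed.

Let bmV (V : R2 -> R) : bcf N2 V -> bounded_measurable (fun x => V (rot2 (- x.2 / h) x.1)).
Proof. by move=> /bm[mV hV]; exact: bounded_measurable_screw. Qed.

Lemma helical_bounded_measurable :
  [/\ bounded_measurable u1, bounded_measurable u2, bounded_measurable u3 & bounded_measurable pq].
Proof.
have bmN : bounded_measurable (fun x => - S x).
  have e : (fun x => - S x) = (fun x => -1 * S x) by apply/funext => x; rewrite mulN1r.
  by rewrite e; apply: bounded_measurableM => //; exact: bounded_measurable_cst.
split; [| |exact: (bmV bV3)|exact: (bmV bq)].
  exact: (bounded_measurableD (bounded_measurableM bmC (bmV bV1)) (bounded_measurableM bmS (bmV bV2))).
exact: (bounded_measurableD (bounded_measurableM bmN (bmV bV1)) (bounded_measurableM bmC (bmV bV2))).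
Qed.

Let u_unscrew y z : [/\ u1 (unscrew (y, z)) = C (y, z) * V1 y + S (y, z) * V2 y,
  u2 (unscrew (y, z)) = - S (y, z) * V1 y + C (y, z) * V2 y,
  u3 (unscrew (y, z)) = V3 y & pq (unscrew (y, z)) = q y].
Proof.
have e : rot2 (- z / h) (rot2 (z / h) y) = y.
  have := lin2_rot_cancel (CS1 (y, z)) y.
  by rewrite mulNr /rot2 cosN sinN opprK.
by rewrite /u1 /u2 /u3 /pq /u /helical_u /helical_p /unscrew /= e.
Qed.

(** In the helical frame [u . grad g] becomes the transport field applied to the horizontal gradient
    of [g \o unscrew], plus [V3] times its vertical derivative. [weak0] kills the first part on each
    slice and [I3_grad3] the second. *)
Lemma helical_div_free g g1 g2 g3 M : C1_3 g g1 g2 g3 -> (forall x, M < N3 x -> g x = 0) ->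
  I3 (fun x => u1 x * g1 x + u2 x * g2 x + u3 x * g3 x) = 0.
Proof.
move=> hg g0; have [_ b1 b2 b3] := C1_3_bcf hg g0.
have [m1 m2 m3 _] := helical_bounded_measurable.
have bE : bcf N3 (fun x => u1 x * g1 x + u2 x * g2 x + u3 x * g3 x).
  by apply: bcfD; [apply: bcfD|]; exact: bcf_bounded_measurable.
have hp := pull_C1 hg; have p0 := pull_far g0.
have [mV3 BV3] := bm bV3.
have [bB IB] := I3_grad3 hp p0 mV3 BV3.
rewrite (I3_unscrew bE) -[RHS]IB (I3_Fubini2 bB); apply: eq_Rintegral => z _.
have hz := C1_3_slice z hp; have z0 := @slice_far _ _ _ p0 z.
have D := IntD lf2 (weak_form_bcf bt1 bt2 (@bcf0 _ _ _ (@N2 R)) hz) (bcf_section2 bB z).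
rewrite [X in _ = X + _](weak0 hz z0) add0r in D; rewrite -[RHS]D; congr I2; apply/funext => y.
have [-> -> -> _] := u_unscrew y z.
rewrite /= /pull1 /pull2 /pull3 /transport1 /transport2 /=; field.
by rewrite gt_eqF.
Qed.

Let hNS : C1_3 (fun x => - S x) (fun=> 0) (fun=> 0) (fun x => - (C x / h)).
Proof.
have hN := C1_3M (C1_3_height (fun t => is_derive_cst (-1 : R) t 1) (@continuous_const _ _ 0)) hS.
by apply: C1_3_eq hN => x; rewrite /cst /=; ring.
Qed.

Section momentum.
Variables a a1 a2 a3 b b1 b2 b3 e e1 e2 e3 : R3 -> R.
Variable M : R.
Hypotheses (ha : C1_3 a a1 a2 a3) (hb : C1_3 b b1 b2 b3) (he : C1_3 e e1 e2 e3).
Hypotheses (a0 : forall x, M < N3 x -> a x = 0) (b0 : forall x, M < N3 x -> b x = 0)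
  (e0 : forall x, M < N3 x -> e x = 0).

Lemma helical_momentum_bcf :
  bcf N3 (fun x => u1 x * (u1 x * a1 x + u2 x * a2 x + u3 x * a3 x)
             + u2 x * (u1 x * b1 x + u2 x * b2 x + u3 x * b3 x)
             + u3 x * (u1 x * e1 x + u2 x * e2 x + u3 x * e3 x)
             + pq x * (a1 x + b2 x + e3 x)).
Proof.
have [_ ba1 ba2 ba3] := C1_3_bcf ha a0; have [_ bb1 bb2 bb3] := C1_3_bcf hb b0.
have [_ be1 be2 be3] := C1_3_bcf he e0.
have [m1 m2 m3 mq] := helical_bounded_measurable.
have bt k k1 k2 k3 : bounded_measurable k -> bcf N3 k1 -> bcf N3 k2 -> bcf N3 k3 ->
    bcf N3 (fun x => k x * (u1 x * k1 x + u2 x * k2 x + u3 x * k3 x)).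
  move=> mk c1 c2 c3; apply: bcf_bounded_measurable => //.
  by apply: bcfD; [apply: bcfD|]; exact: bcf_bounded_measurable.
apply: bcfD; first by apply: bcfD; [apply: bcfD|]; exact: bt.
by apply: bcf_bounded_measurable => //; apply: bcfD => //; exact: bcfD.
Qed.

Lemma helical_momentum :
  I3 (fun x => u1 x * (u1 x * a1 x + u2 x * a2 x + u3 x * a3 x)
             + u2 x * (u1 x * b1 x + u2 x * b2 x + u3 x * b3 x)
             + u3 x * (u1 x * e1 x + u2 x * e2 x + u3 x * e3 x)
             + pq x * (a1 x + b2 x + e3 x)) = 0.
Proof.
have bE := helical_momentum_bcf; set E := (fun x => _ + _) in bE *.
have pa := pull_C1 ha; have pb := pull_C1 hb; have pe := pull_C1 he.
have za := pull_far a0; have zb := pull_far b0; have ze := pull_far e0.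
(* [h1] and [h2] concern the horizontal components of the test field in the turning frame.
   Differentiating that frame in height produces the terms in [V3 / h] without derivatives in
   [weak1] and [weak2]. *)
have h1 := C1_3D (C1_3M hC pa) (C1_3M hNS pb).
have h2 := C1_3D (C1_3M hS pa) (C1_3M hC pb).
have z1 x : 4 * `|M| < N3 x -> C x * (a \o unscrew) x + - S x * (b \o unscrew) x = 0.
  by move=> hx; rewrite /= za// zb// !mulr0 addr0.
have z2 x : 4 * `|M| < N3 x -> S x * (a \o unscrew) x + C x * (b \o unscrew) x = 0.
  by move=> hx; rewrite /= za// zb// !mulr0 addr0.
have [mB1 hB1] := bm (bcfM bV1 bV3); have [bB1 IB1] := I3_grad3 h1 z1 mB1 hB1.
have [mB2 hB2] := bm (bcfM bV2 bV3); have [bB2 IB2] := I3_grad3 h2 z2 mB2 hB2.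
have [mB3 hB3] := bm (bcfD (bcfM bV3 bV3) bq); have [bB3 IB3] := I3_grad3 pe ze mB3 hB3.
have bB23 := bcfD bB2 bB3; have bB := bcfD bB1 bB23.
have DB := IntD lf3 bB1 bB23; rewrite (IntD lf3 bB2 bB3) in DB.
rewrite [X in _ = X + _]IB1 [X in _ = _ + (X + _)]IB2 [X in _ = _ + (_ + X)]IB3 !addr0 in DB.
rewrite (I3_unscrew bE) -[RHS]DB -/(I3 _) (I3_Fubini2 bB); apply: eq_Rintegral => z _.
have far g := @slice_far _ g (4 * `|M|).
have [bq1 bq2] := mul_coord bq.
have W1 := weak1 (C1_3_slice z h1) (far _ z1 z).
have W2 := weak2 (C1_3_slice z h2) (far _ z2 z).
have W3 := weak3 (C1_3_slice z pe) (far _ ze z).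
have b31 : bcf N2 (fun y => - (V3 y / h * V2 y)).
  have := bcfN (bcfZ h^-1 (bcfM bV3 bV2)); congr (bcf _ _); apply/funext => y; ring.
have b32 : bcf N2 (fun y => V3 y / h * V1 y).
  have := bcfZ h^-1 (bcfM bV3 bV1); congr (bcf _ _); apply/funext => y; ring.
have bW1 := weak_form_bcf (bcfD (bcfM bV1 bt1) bq) (bcfM bV1 bt2) b31 (C1_3_slice z h1).
have bW2 := weak_form_bcf (bcfM bV2 bt1) (bcfD (bcfM bV2 bt2) bq) b32 (C1_3_slice z h2).
have bW3 := weak_form_bcf (bcfB (bcfM bV3 bt1) bq2) (bcfD (bcfM bV3 bt2) bq1)
  (@bcf0 _ _ _ (@N2 R)) (C1_3_slice z pe).
have bBz := bcf_section2 bB z.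
have b3B := bcfD bW3 bBz; have b23B := bcfD bW2 b3B.
have D := IntD lf2 bW1 b23B; rewrite (IntD lf2 bW2 b3B) (IntD lf2 bW3 bBz) in D.
rewrite [X in _ = X + _]W1 [X in _ = _ + (X + _)]W2 [X in _ = _ + (_ + (X + _))]W3 !add0r in D.
rewrite -[RHS]D; congr I2; apply/funext => y.
have [eu1 eu2 eu3 eq] := u_unscrew y z.
rewrite /E eu1 eu2 eu3 eq /= /pull1 /pull2 /pull3 /transport1 /transport2 /=.
have cs := CS1 (y, z).
apply/eqP; rewrite -subr_eq0; apply/eqP.
(* Everything cancels identically except the trace [a1 + b2] met by the pressure, whose invariance
   under rotation uses [cos^2 + sin^2 = 1]. *)
transitivity (q y * (a1 (unscrew (y, z)) + b2 (unscrew (y, z))) * (1 - (C (y, z) ^+ 2 + S (y, z) ^+ 2))).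
  by field; rewrite gt_eqF.
by rewrite cs subrr mulr0.
Qed.
End momentum.

(** The constant [k] only contributes the integral of a divergence, so the pressure may be
    normalized to have bounded support. *)
Lemma helical_weak_Euler (k : R) : weak_Euler u (helical_p h (fun y => q y + k)).
Proof.
have [m1 m2 m3 mq] := helical_bounded_measurable.
have mp : bounded_measurable (helical_p h (fun y => q y + k)).
  exact: bounded_measurableD mq (bounded_measurable_cst k).
have mu i : bounded_measurable (fun x => coord3 i (u x)).
  by case: i => [[|[|i]] hi]; [exact: m1|exact: m2|exact: m3].
split.
- move=> i; split; first by case: (mu i).
  move=> K cK; apply: (@bounded_measurable_integrable (fun x => coord3 i (u x) ^+ 2)) cK.
  exact: bounded_measurableM.
- split; first by case: mp.
  by move=> K cK; exact: bounded_measurable_integrable.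
- move=> eta [seta ceta _].
  have [M hM] := tsupport_far ceta.
  have ha := smooth_C1_3 (fun x => is_diff_comp (is_diff_fst x) (is_diff_fst x.1)) seta.
  have hb := smooth_C1_3 (fun x => is_diff_comp (is_diff_fst x) (is_diff_snd x.1)) seta.
  have he := smooth_C1_3 (fun x => is_diff_snd x) seta.
  set a := _ \o eta in ha; set b := _ \o eta in hb; set e := _ \o eta in he.
  have a0 x : M < N3 x -> a x = 0 by move=> /hM hx; rewrite /a /= hx.
  have b0 x : M < N3 x -> b x = 0 by move=> /hM hx; rewrite /b /= hx.
  have e0 x : M < N3 x -> e x = 0 by move=> /hM hx; rewrite /e /= hx.
  have mom := helical_momentum ha hb he a0 b0 e0.
  have [_ ba _ _] := C1_3_bcf ha a0; have [_ _ bb _] := C1_3_bcf hb b0.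
  have [_ _ _ be] := C1_3_bcf he e0.
  have bab := bcfD ba bb; have bd := bcfD bab be.
  have div0 : I3 (fun x => k * ('D_axis1 a x + 'D_axis2 b x + 'D_axis3 e x)) = 0.
    rewrite /I3 (IntZ lf3 k bd) (IntD lf3 bab be) (IntD lf3 ba bb).
    have b1 : exists B : R, forall y : R2, `|cst (1 : R) y| <= B by exists 1 => y; rewrite normr1.
    have [_ ze] := I3_grad3 he e0 (measurable_cst (1 : R)) b1.
    rewrite [X in X + _ + _](I3_grad1 ha a0) [X in _ + X + _](I3_grad2 hb b0).
    rewrite (_ : (fun x => 'D_axis3 e x) = (fun x => cst 1 x.1 * 'D_axis3 e x)); last first.
      by apply/funext => x; rewrite /= mul1r.
    by rewrite [X in _ + X]ze !addr0 mulr0.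
  have D := IntD lf3 (helical_momentum_bcf ha hb he a0 b0 e0) (bcfZ k bd).
  rewrite [X in _ = X + _]mom [X in _ = _ + X]div0 addr0 in D.
  rewrite -[RHS]D; congr Rintegral; apply/funext => x.
  exact: (momentum_sum (fun i => coord3 i (u x)) (fun i j => 'D_(basis3 i) (coord3 j \o eta) x) (pq x) k).
move=> phi [sphi cphi _]; have [M hM] := tsupport_far cphi.
have hg : C1_3 phi (fun x => 'D_axis1 phi x) (fun x => 'D_axis2 phi x) (fun x => 'D_axis3 phi x).
  apply: C1_3_of_derivable; first exact: (sphi [::]).
  by move=> v x; apply: differentiable_continuous; exact: (sphi [:: v] x).
rewrite -[RHS](helical_div_free hg hM); congr Rintegral; apply/funext => x.
exact: (sum3 (fun i => coord3 i (u x) * 'D_(basis3 i) phi x)).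
Qed.
End planar_fields.
End helical_weak_forms.

(** * Helical symmetry and assembly of the solution *)

Lemma rot2D (R : realType) (a b : R) (x : R * R) : rot2 a (rot2 b x) = rot2 (a + b) x.
Proof. by rewrite /rot2 /= cosD sinD; congr pair; ring. Qed.

Section symmetry.
Variables (R : realType) (h : R).
Hypothesis h_neq0 : h != 0.

Lemma screwE th (x : R * R * R) : screw h th x = (rot2 th x.1, x.2 + h * th).
Proof.
rewrite /screw /rot3; transitivity ((rot2 th x.1 + 0, x.2 + h * th)) => //.
by rewrite addr0.
Qed.

Lemma helical_u_helical us : helical_field h (helical_u h us).
Proof.
move=> th x; rewrite screwE /helical_u /rot3 /= !rot2D.
have -> : - (x.2 + h * th) / h + th = - x.2 / h by field.
by have -> : th + x.2 / h = (x.2 + h * th) / h by field.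
Qed.

Lemma helical_p_helical ps : helical_function h (helical_p h ps).
Proof.
move=> th x; rewrite screwE /helical_p /= rot2D.
by have -> : - (x.2 + h * th) / h + th = - x.2 / h by field.
Qed.
End symmetry.

(** One pair [G1], [G2] serves inside and on the boundary: at a point of the closure the trace
    filter of the domain is proper, so the limits in [grad_closure] are unique and equal the
    continuous extensions. *)
Lemma C1_closure_gradient (R : realType) (Omega : set (R * R)) (psi : R * R -> R) :
  open Omega -> C1_closure Omega psi ->
  exists G1 G2 : R * R -> R, [/\ cont_cl Omega G1, cont_cl Omega G2, C1on Omega psi G1 G2,
    forall x, Omega x -> grad psi x = (G1 x, G2 x) &
    forall x, frontier Omega x -> grad_closure Omega psi x = (G1 x, G2 x)].
Proof.
move=> oO [cpsi dpsi gpsi].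
have [G1 [cG1 G1E]] := gpsi e1; have [G2 [cG2 G2E]] := gpsi e2.
exists G1, G2; split=> //.
- move=> x Ox; split; [|exact: cc_for cG1 Ox|exact: cc_for cG2 Ox].
  split; first exact: dpsi.
  apply/funext => v; rewrite /dot_grad -G1E// -G2E// !deriveE; try exact: dpsi.
  have E : v = v.1 *: e1 + v.2 *: e2.
    case: v => [p q]; transitivity ((p * 1 + q * 0, p * 0 + q * 1) : R * R) => //.
    by congr (_, _); ring.
  by rewrite [in LHS]E !linearD !linearZ.
- by move=> x Ox; rewrite /grad G1E// G2E.
move=> x /(frontier_open oO)[cx _].
have pF : ProperFilter (within Omega (nbhs x)).
  by apply: within_nbhs_proper.
have lim_ext (G : R * R -> R) v : cont_cl Omega G -> (forall y, Omega y -> 'D_v psi y = G y) ->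
    lim ('D_v psi y @[y --> within Omega (nbhs x)]) = G x.
  move=> cG GE; apply: cvg_lim => // V nV.
  have nV' : \forall y \near x, closure Omega y -> V (G y) by exact: (cc_cvg cG cx nV).
  suff : \forall y \near x, Omega y -> V ('D_v psi y) by [].
  by apply: filterS nV' => y hy Oy; rewrite GE//; apply: hy; exact: subset_closure.
by rewrite /grad_closure (lim_ext G1)// (lim_ext G2).
Qed.

Lemma eq_weak_identity (R : realType) (A1 A2 b B1 B2 b' : R * R -> R) :
  (forall x, A1 x = B1 x) -> (forall x, A2 x = B2 x) -> (forall x, b x = b' x) ->
  weak_identity A1 A2 b -> weak_identity B1 B2 b'.
Proof. by move=> /funext -> /funext -> /funext ->. Qed.

(** The integrals over the domain become integrals over the plane of fields extended by zero, and
    the two sides of the equation merge into one weak form. *)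
Lemma weak_source_of_distributional (R : realType) (h : R) (Omega : set (R * R)) (F H : R -> R)
    (psi G1 G2 : R * R -> R) :
  0 < h -> open Omega -> bounded_set Omega ->
  C1_in (psi @` closure Omega) F -> C1_in (psi @` closure Omega) H ->
  cont_cl Omega psi -> cont_cl Omega G1 -> cont_cl Omega G2 ->
  (forall x, Omega x -> grad psi x = (G1 x, G2 x)) ->
  distributional_div Omega (fun x => Kmul h x (grad psi x)) (source h Omega F H psi) ->
  forall (y : R * R) r, 0 < r -> (forall x, N2 (x - y) <= r -> Omega x) ->
  weak_form (ext Omega (flux1 h G1 G2)) (ext Omega (flux2 h G1 G2)) (ext Omega (source h Omega F H psi))
    (bump r y) (bump_1 r y) (bump_2 r y) = 0.
Proof.
move=> h0 oO bO F_C1 H_C1 cpsi cG1 cG2 gE eq y r r0 hr.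
have bf1 := ext_bcf oO bO (cc_flux1 h0 cG1 cG2).
have bf2 := ext_bcf oO bO (cc_flux2 h0 cG1 cG2).
have bs := ext_bcf oO bO (cc_source h0 F_C1 H_C1 cpsi).
have hb := bump_C1 r y; have z := @bcf0 _ _ _ (@N2 R).
have bA := weak_form_bcf bf1 bf2 z hb; have bS := weak_form_bcf z z bs hb.
have := eq _ (bump_test r0 hr); rewrite (Rintegral_mkcond (@lam2 R) Omega) [in RHS](Rintegral_mkcond (@lam2 R) Omega).
set A := Rintegral _ _ _; set S := Rintegral _ _ _.
have <- : I2 (fun x => ext Omega (flux1 h G1 G2) x * bump_1 r y x
     + ext Omega (flux2 h G1 G2) x * bump_2 r y x + 0 * bump r y x) = A.
  congr Rintegral; apply/funext => x; rewrite patchE.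
  case: ifPn => [|/negP]; rewrite inE => Ox; last by rewrite !ext_out// !mul0r !addr0.
  have [_ g1] := C1on_derive (e1 : R * R) hb (I : setT x).
  have [_ g2] := C1on_derive (e2 : R * R) hb (I : setT x).
  by rewrite !extE// gE// /dot2 /grad g1 g2 /flux1 /flux2 /=; ring.
have <- : I2 (fun x => 0 * bump_1 r y x + 0 * bump_2 r y x + ext Omega (source h Omega F H psi) x * bump r y x) = S.
  congr Rintegral; apply/funext => x; rewrite patchE.
  by case: ifPn => [|/negP]; rewrite inE => Ox; [rewrite extE|rewrite ext_out]; rewrite ?mul0r ?add0r ?mul0r.
move=> e; have D := IntD lf2 bA bS.
rewrite -[X in _ = _ + X]e subrr in D; rewrite -[RHS]D.
by congr Rintegral; apply/funext => x; ring.
Qed.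

Theorem lemma1p1 (R : realType) (h c : R) (Omega0 : set (R * R))
  (F H : R -> R) (psi : R * R -> R)
  (h_gt0 : 0 < h)
  (dom : bounded_C2_domain Omega0)
  (F_C1 : C1_in (psi @` closure Omega0) F)
  (H_C1 : C1_in (psi @` closure Omega0) H)
  (psi_C1 : C1_closure Omega0 psi)
  (psi_eq : distributional_div Omega0
    (fun x => Kmul h x (grad psi x))
    (fun x =>
       - (2 * h ^+ 2 * F (psi x) / xi2 h x ^+ 2)
       - derive_in (psi @` closure Omega0) F (psi x) * F (psi x) / xi2 h x
       + derive_in (psi @` closure Omega0) H (psi x)))
  (psi_bd : forall x, frontier Omega0 x -> psi x = 0)
  (grad_bd : forall x, frontier Omega0 x ->
    speed2 h x (grad_closure Omega0 psi x) (F 0) = c) :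
  let u := helical_u h (ustar h Omega0 F psi) in
  let p := helical_p h (pstar h Omega0 F H c psi) in
  weak_Euler u p /\ helical_field h u /\ helical_function h p.
Proof.
move=> u p; have h0 : h != 0 by rewrite gt_eqF.
split; last by split; [exact: helical_u_helical|exact: helical_p_helical].
have [_ oO _ bO hO] := dom; have [cpsi _ _] := psi_C1.
have [G1 [G2 [cG1 cG2 hpsi gE gcE]]] := C1_closure_gradient oO psi_C1.
have bd x : frontier Omega0 x -> speed2 h x (G1 x, G2 x) (F 0) = c.
  by move=> fx; rewrite -gcE// grad_bd.
have ws := weak_source_of_distributional h_gt0 oO bO F_C1 H_C1 cpsi cG1 cG2 gE psi_eq.
have wD := div_weak oO bO cpsi cG1 cG2 hpsi hO psi_bd.
have w1 := momentum1_weak h_gt0 oO bO F_C1 H_C1 cpsi cG1 cG2 hpsi ws hO psi_bd bd.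
have w2 := momentum2_weak h_gt0 oO bO F_C1 H_C1 cpsi cG1 cG2 hpsi ws hO psi_bd bd.
have w3 := momentum3_weak h_gt0 oO bO F_C1 H_C1 cpsi cG1 cG2 hpsi ws hO psi_bd bd.
pose V1 := ext Omega0 (vel1 h F psi G1 G2); pose V2 := ext Omega0 (vel2 h F psi G1 G2).
pose V3 := ext Omega0 (fun x => h * slope h F psi G1 G2 x).
pose q := ext Omega0 (pressure_jump h c F H psi G1 G2).
(* Subtracting the rotation of the frame cancels [F] and the denominator, leaving only derivatives
   of [psi]. *)
have t1 : transport1 h V1 V3 = ext Omega0 G2.
  apply/funext => x; rewrite /transport1 /V1 /V3; have [Ox|nOx] := pselect (Omega0 x); last first.
    by rewrite !ext_out// !mul0r subrr.
  rewrite !extE// /vel1 /slope /velocity /xi2 /=; have := @s_neq0 R h x.1 x.2 h_gt0 => s0.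
  by field; rewrite s0 h0.
have t2 : transport2 h V2 V3 = ext Omega0 (fun x => - G1 x).
  apply/funext => x; rewrite /transport2 /V2 /V3; have [Ox|nOx] := pselect (Omega0 x); last first.
    by rewrite !ext_out// !mul0r addr0.
  rewrite !extE// /vel2 /slope /velocity /xi2 /=; have := @s_neq0 R h x.1 x.2 h_gt0 => s0.
  by field; rewrite s0 h0.
have uE : ustar h Omega0 F psi = (fun x => (V1 x, V2 x, V3 x)).
  apply/funext => x; rewrite /ustar /V1 /V2 /V3 /ext; case: ifPn => // /set_mem Ox.
  rewrite gE//; congr (_, _, _); rewrite /velocity /slope /=.
  by rewrite /xi2; ring.
(* The constant [k] of [helical_weak_Euler] is the outer pressure. *)
have pE : pstar h Omega0 F H c psi = (fun x => q x + (H 0 - c / 2)).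
  apply/funext => x; rewrite /pstar /q /ext; case: ifPn => [/set_mem Ox|_]; last by rewrite add0r.
  by rewrite gE// /pressure_jump /pressure subrK.
have bV1 : bcf N2 V1 by apply: (ext_bcf oO bO); exact: cc_vel1.
have bV2 : bcf N2 V2 by apply: (ext_bcf oO bO); exact: cc_vel2.
have bV3 : bcf N2 V3.
  apply: (ext_bcf oO bO); apply: ccM; last exact: cc_slope.
  by apply: cc_continuous; exact: continuous_const.
have bq : bcf N2 q by apply: (ext_bcf oO bO); exact: cc_pressure_jump.
rewrite /u /p uE pE; apply: helical_weak_Euler => //; rewrite t1 t2.
- exact: wD.
- by apply: eq_weak_identity w1 => x; rewrite /V1 /V2 /V3 /q /ext; case: ifP => _; field.
- by apply: eq_weak_identity w2 => x; rewrite /V1 /V2 /V3 /q /ext; case: ifP => _; field.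
by apply: eq_weak_identity w3 => x; rewrite /V1 /V2 /V3 /q /ext //; case: ifP => _; field.
Qed.
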